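(* Let $\Omega$ be a connected Stein manifold for which there exists a point $z_0\in\Omega$ such that $$\lim_{\Omega\ni z\to\infty_\Omega}c_{\Omega}(z,z_0)=\infty.$$ Then $\Omega$ is taut and it belongs to the class $\mathcal{S}$. In particular, if $\varphi:\Omega\to\Omega$ is holomorphic and $C_\varphi$ is hypercyclic, then $C_\varphi$ is hereditarily hypercyclic.
   Context: A Stein manifold is a complex analytic manifold $\Omega$ of finite dimension $N$ such that: $\Omega$ has an exhaustion by compact sets $K_l$ with $K_l\subset\operatorname{int}K_{l+1}$ and $\bigcup_l K_l=\Omega$; the holomorphic hull $\widehat{K}_\Omega=\{z\in\Omega: |f(z)|\le\sup_K|f| \text{ for every } f\in\mathcal{O}(\Omega)\}$ of every compact set $K\subset\Omega$ is compact; holomorphic functions on $\Omega$ separate points; and for each $z\in\Omega$ some holomorphic map $F:\Omega\to\mathbb{C}^N$ has invertible derivative at $z$. $\mathcal{O}(\Omega)$ is the space of holomorphic functions $\Omega\to\mathbb{C}$ with the topology of uniform convergence on compact sets. For holomorphic $\varphi:\Omega\to\Omega$, $C_\varphi:\mathcal{O}(\Omega)\to\mathcal{O}(\Omega)$ is $C_\varphi(f)=f\circ\varphi$. For a self-map $T$, $T^{[n]}$ denotes its $n$-th iterate. ''Increasing'' means strictly increasing. $\mathbb{D}$ is the open unit disc. For $z,w\in\Omega$ put $c_\Omega^*(z,w)=\sup\{|F(z)|: F:\Omega\to\mathbb{D}\text{ holomorphic}, F(w)=0\}$ and $c_\Omega(z,w)=\frac12\log\frac{1+c_\Omega^*(z,w)}{1-c_\Omega^*(z,w)}$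 (the Carathéodory pseudodistance). $\infty_\Omega$ is the point added in the one-point compactification of $\Omega$; thus the limit condition means that for each $R>0$ there is a compact $L\subset\Omega$ with $c_\Omega(z,z_0)>R$ for all $z\in\Omega\setminus L$. A sequence $(T_l)_l$ of continuous self-maps of a topological space $X$ is universal if there is $x\in X$ with $\{T_l(x): l\in\mathbb{N}\}$ dense in $X$; it is hereditarily universal if each of its subsequences is universal. A continuous linear operator $T$ on a topological vector space is hypercyclic (resp. hereditarily hypercyclic) with respect to an increasing sequence $(n_l)_l\subset\mathbb{N}$ if $(T^{[n_l]})_l$ is universal (resp. hereditarily universal); it is hypercyclic (resp. hereditarily hypercyclic) if this holds for the full sequence $n_l=l$. A domain $U\subset\Omega$ is a Runge domain with respect to $\Omega$ if every function in $\mathcal{O}(U)$ can be approximated locally uniformly on $U$ by functions from $\mathcal{O}(\Omega)$. $\mathcal{S}$ is the class of all connected Stein manifolds $\Omega$ such that for every holomorphic $\varphi:\Omega\to\Omega$ and every increasing sequence $(n_l)_l$ of natural numbers: if (c1) $\varphi$ is injective, (c2) $\varphi(\Omega)$ is a Runge domain with respect to $\Omega$, and (c3) the sequence $(\varphi^{[n_l]})_l$ is run-away, i.e. for every compact $K\subset\Omega$ there is $l$ with $\varphi^{[n_l]}(K)\cap K=\varnothing$, then $C_\varphi$ is hypercyclic with respect to $(n_l)_l$. Tautness: let $\mathcal{O}(\mathbb{D},\Omega)$ be the set of holomorphic maps $\mathbb{D}\to\Omega$. An $N$-dimensional Stein manifold $\Omega$ admits an injective regular proper holomorphic map $F:\Omega\to\mathbb{C}^{2N+1}$;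 $\mathcal{O}(\mathbb{D},\Omega)$ carries the topology in which $f_n\to f$ means $F\circ f_n\to F\circ f$ uniformly on compact sets (this does not depend on $F$). A sequence $(f_n)_n\subset\mathcal{O}(\mathbb{D},\Omega)$ is compactly divergent if for all compact $K\subset\mathbb{D}$, $L\subset\Omega$ there is $n_0$ with $f_n(K)\cap L=\varnothing$ for all $n\ge n_0$. $\Omega$ is taut if every sequence in $\mathcal{O}(\mathbb{D},\Omega)$ is compactly divergent or has a subsequence convergent in $\mathcal{O}(\mathbb{D},\Omega)$. *)

(* Defs.v *)
From HB Require Import structures.
From mathcomp Require Import all_boot all_order all_algebra.
From mathcomp Require Import complex.
From mathcomp Require Import all_classical all_reals all_analysis.

Set Implicit Arguments.
Unset Strict Implicit.
Unset Printing Implicit Defensive.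

Import Order.TTheory GRing.Theory Num.Theory.
Import numFieldNormedType.Exports.

Local Open Scope classical_set_scope.
Local Open Scope ring_scope.

#[non_forgetful_inheritance]
HB.instance Definition _ (R : realType) := GRing.ComAlgebra.copy R[i] R[i]^o.
#[non_forgetful_inheritance]
HB.instance Definition _ (R : realType) := Vector.copy R[i] R[i]^o.
#[non_forgetful_inheritance]
HB.instance Definition _ (R : realType) := NormedModule.copy R[i] R[i]^o.

(* Since normed modules are taken over R[i], [differentiable] and ['d] mean
   Frechet differentiability with an R[i]-linear differential. *)

Record chart (R : realType) (V : normedModType R[i]) (X : topologicalType) :=
  Chart {
    chart_dom : set X ;
    chart_fun :> X -> V ;
    chart_inv : V -> X ;
    chart_dom_open : open chart_dom ;
    chart_img_open : open (chart_fun @` chart_dom) ;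
    chart_funK : forall x, chart_dom x -> chart_inv (chart_fun x) = x ;
    chart_fun_cont : forall x, chart_dom x -> {for x, continuous chart_fun} ;
    chart_inv_cont : forall x, chart_dom x ->
      {for chart_fun x, continuous chart_inv} }.

(* Second countability is not part of the structure: in a Stein manifold it
   follows from the exhaustion by compact sets. *)
Record complex_manifold (R : realType) (V : normedModType R[i]) :=
  ComplexManifold {
    carrier :> topologicalType ;
    atlas : set (chart V carrier) ;
    manifold_hausdorff : hausdorff_space carrier ;
    atlas_cover : forall x, exists2 c, atlas c & chart_dom c x ;
    atlas_compat : forall c d x, atlas c -> atlas d ->
      chart_dom c x -> chart_dom d x ->
      differentiable (d \o chart_inv c) (c x) }.

Section model.
Context {R : realType} (V : normedModType R[i]).

Program Definition id_chart : chart V V :=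
  {| chart_dom := setT ; chart_fun := id ; chart_inv := id |}.
Next Obligation. exact: openT. Qed.
Next Obligation. by rewrite image_id; exact: openT. Qed.
Next Obligation. by []. Qed.
Next Obligation. by move=> x _; exact: cvg_id. Qed.
Next Obligation. by move=> x _; exact: cvg_id. Qed.

Program Definition model : complex_manifold V :=
  {| carrier := V ; atlas := [set id_chart] |}.
Next Obligation. exact: norm_hausdorff. Qed.
Next Obligation. by move=> x; exists id_chart. Qed.
Next Obligation. by move=> c d x -> -> _ _; exact: ex_diff. Qed.

End model.

Notation CC R := (model R[i]).
Notation CCn R n := (model 'rV[R[i]]_n).

Section holomorphic.
Context {R : realType} {V W : normedModType R[i]}.
Implicit Types (M : complex_manifold V) (X : complex_manifold W).

(* Complex differentiability at the single point [x], tested in all charts;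
   holomorphy is this property at every point of an open set. *)
Definition cdifferentiable_at M X (f : M -> X) (x : M) : Prop :=
  {for x, continuous f} /\
  forall c d, atlas c -> atlas d -> chart_dom c x -> chart_dom d (f x) ->
    differentiable (d \o f \o chart_inv c) (c x).

(* Meaningful for open [U]; the values of [f] outside [U] are irrelevant. *)
Definition holomorphic_on M X (U : set M) (f : M -> X) : Prop :=
  forall x, U x -> cdifferentiable_at f x.

Record hol M X := Hol {
  hol_fun :> M -> X ;
  hol_funP : holomorphic_on setT hol_fun }.

HB.instance Definition _ M X := gen_eqMixin (hol M X).
HB.instance Definition _ M X := gen_choiceMixin (hol M X).

End holomorphic.

Lemma near_eq_differentiable (R : realType) (V W : normedModType R[i])
    (f g : V -> W) (x : V) :
  (\forall y \near x, f y = g y) -> differentiable f x -> differentiable g x.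
Proof.
move=> fg df; have [dfc dfE] := (diff_locallyP x f).1 df.
have gE : g \o shift x = cst (g x) + 'd f x +o_ 0 id.
  apply/eqaddoP => _/posnumP[e].
  have /eqaddoP/(_ e%:num (gt0 e)) fe := dfE.
  have fg0 : \forall h \near 0, f (h + x) = g (h + x).
    by have := fg; rewrite (near_shift 0 x) subr0.
  near=> h.
  have <- : (f \o shift x - (cst (f x) + 'd f x)) h =
            (g \o shift x - (cst (g x) + 'd f x)) h.
    rewrite !fctE /= /shift /=.
    by rewrite (near fg0 h) // (nbhs_singleton fg).
  by near: h; exact: fe.
have dgE : 'd g x = 'd f x :> (V -> W) by exact: diff_unique.
by apply/diff_locallyP; rewrite dgE.
Unshelve. all: by end_near. Qed.

Section composition.
Context {R : realType} {U V W : normedModType R[i]}.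
Variables (L : complex_manifold U) (M : complex_manifold V)
  (X : complex_manifold W).

Lemma cdifferentiable_at_comp (f : M -> X) (g : L -> M) (x : L) :
  cdifferentiable_at f (g x) -> cdifferentiable_at g x ->
  cdifferentiable_at (f \o g) x.
Proof.
move=> [fc df] [gc dg]; split; first exact: continuous_comp.
move=> c d Ac Ad cx dfx; have [e Ae egx] := atlas_cover (g x).
have cxK : chart_inv c (c x) = x by exact: chart_funK.
have ic := chart_inv_cont cx.
apply: (@near_eq_differentiable _ _ _
  ((d \o f \o chart_inv e) \o (e \o g \o chart_inv c))).
  have : \forall y \near c x, chart_dom e (g (chart_inv c y)).
    have gic : {for c x, continuous (g \o chart_inv c)}.
      by apply: continuous_comp => //; rewrite cxK.
    apply: gic; rewrite /= cxK.
    by apply: open_nbhs_nbhs; split; [exact: chart_dom_open|].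
  by apply: filterS => y ey /=; rewrite chart_funK.
apply: differentiable_comp; first exact: dg.
by rewrite /= cxK; exact: df.
Qed.

Lemma holomorphic_comp (f : hol M X) (g : hol L M) :
  holomorphic_on setT (f \o g).
Proof.
by move=> x _; apply: cdifferentiable_at_comp; exact: hol_funP.
Qed.

Definition hol_comp (f : hol M X) (g : hol L M) : hol L X :=
  Hol (holomorphic_comp f g).

End composition.

(* [OO Omega] carries the topology of uniform convergence on compact sets,
   induced from {family compact, Omega -> R[i]}. *)
Section function_algebra.
Context {R : realType} {V : normedModType R[i]}.

Definition OO (Omega : complex_manifold V) : Type := hol Omega (CC R).

Definition OO_fun (Omega : complex_manifold V) (f : OO Omega) :
  {family compact, Omega -> R[i]} := hol_fun f.

HB.instance Definition _ (Omega : complex_manifold V) :=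
  Choice.on (OO Omega).
HB.instance Definition _ (Omega : complex_manifold V) :=
  Topological.copy (OO Omega) (initial_topology (@OO_fun Omega)).

Definition composition_operator (Omega : complex_manifold V)
  (phi : hol Omega Omega) : OO Omega -> OO Omega := fun f => hol_comp f phi.

Lemma composition_operator_continuous (Omega : complex_manifold V)
  (phi : hol Omega Omega) : continuous (composition_operator phi).
Proof.
apply: continuous_comp_initial => f.
have FF : Filter (nbhs (f : OO Omega)) by exact: nbhs_filter.
have FF2 := @fmap_filter _ _ (@OO_fun Omega \o composition_operator phi) _ FF.
apply/(@fam_cvgP _ _ _ _ _ FF2) => K cK P /uniform_nbhs [E [entE EP]].
have cphiK : compact (phi @` K).
  apply: continuous_compact => //; apply: continuous_subspaceT => x.
  by have [] := @hol_funP _ _ _ _ _ phi x I.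
have := @fam_nbhs _ _ compact _ E (OO_fun f) entE cphiK.
move=> /(@initial_continuous (OO Omega) _ (@OO_fun Omega) f) H.
apply: (@filterS _ _ FF) H => g gE; apply: EP => y Ky /=.
by apply: gE; exists y.
Qed.

End function_algebra.

(* The maps to which this is applied, the iterates of a composition operator,
   are continuous ([composition_operator_continuous]) and linear, so these
   requirements are not repeated in the definitions. *)
Section universality.
Variable X : topologicalType.

Definition universal (T : nat -> X -> X) : Prop :=
  exists x, dense (range (fun l => T l x)).

Definition increasing (n : nat -> nat) : Prop :=
  {homo n : i j / (i < j)%N >-> (i < j)%N}.

Definition hereditarily_universal (T : nat -> X -> X) : Prop :=
  forall k, increasing k -> universal (T \o k).

Definition hypercyclic_wrt (T : X -> X) (n : nat -> nat) : Prop :=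
  universal (fun l => iter (n l) T).

Definition hereditarily_hypercyclic_wrt (T : X -> X) (n : nat -> nat) : Prop :=
  hereditarily_universal (fun l => iter (n l) T).

Definition hypercyclic (T : X -> X) : Prop := hypercyclic_wrt T id.

Definition hereditarily_hypercyclic (T : X -> X) : Prop :=
  hereditarily_hypercyclic_wrt T id.

End universality.

Section stein.
Context {R : realType} {N : nat}.
Implicit Types Omega : complex_manifold 'rV[R[i]]_N.

Definition hull Omega (K : set Omega) : set Omega :=
  [set z | forall f : OO Omega,
    Normc.normc (f z) <= sup [set Normc.normc (f w) | w in K]].

(* The derivative of [F] at [z], read in the chart [c]. *)
Definition chart_diff m Omega (F : hol Omega (CCn R m))
    (c : chart 'rV[R[i]]_N Omega) (z : Omega) : 'rV[R[i]]_N -> 'rV[R[i]]_m :=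
  'd (F \o chart_inv c : _ -> 'rV[R[i]]_m) (c z).

Definition stein Omega : Prop :=
  [/\ exists K : nat -> set Omega,
        [/\ forall l, compact (K l),
            forall l, K l `<=` interior (K l.+1) &
            \bigcup_l K l = setT],
      forall K : set Omega, compact K -> compact (hull K),
      forall z w : Omega, z <> w -> exists f : OO Omega, f z <> f w &
      forall z : Omega, exists F : hol Omega (CCn R N),
        exists c, [/\ atlas c, chart_dom c z & bijective (chart_diff F c z)]].

Definition caratheodory_star Omega (z w : Omega) : R :=
  sup [set Normc.normc (F z) | F in
    [set F : OO Omega | (forall x, Normc.normc (F x) < 1) /\ F w = 0]].

(* On a connected manifold [caratheodory_star z w < 1], so the argument of [ln]
   is a positive real number. *)
Definition caratheodory Omega (z w : Omega) : R :=
  2^-1 * ln ((1 + caratheodory_star z w) / (1 - caratheodory_star z w)).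

Definition caratheodory_tends_to_infinity Omega (z0 : Omega) : Prop :=
  forall r : R, 0 < r -> exists2 L : set Omega, compact L &
    forall z, ~ L z -> r < caratheodory z z0.

Definition runge_domain Omega (U : set Omega) : Prop :=
  [/\ U !=set0, open U, connected U &
    forall f : Omega -> CC R, holomorphic_on U f ->
    forall K, compact K -> K `<=` U -> forall e : R, 0 < e ->
    exists g : OO Omega, forall z, K z -> Normc.normc (f z - g z) < e].

Definition run_away Omega (T : nat -> Omega -> Omega) : Prop :=
  forall K : set Omega, compact K -> exists l, (T l @` K) `&` K = set0.

Definition class_S Omega : Prop :=
  [/\ stein Omega, connected [set: Omega] &
    forall (phi : hol Omega Omega) (n : nat -> nat), increasing n ->
      injective phi -> runge_domain (range phi) ->
      run_away (fun l => iter (n l) phi) ->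
      hypercyclic_wrt (composition_operator phi) n].

Definition unit_disc : set (CC R) := [set z | Normc.normc z < 1].

Definition regular_at m Omega (F : hol Omega (CCn R m)) (z : Omega) : Prop :=
  exists c, [/\ atlas c, chart_dom c z & injective (chart_diff F c z)].

Definition proper_embedding m Omega (F : hol Omega (CCn R m)) : Prop :=
  [/\ injective F, forall z, regular_at F z &
      forall L : set (CCn R m), compact L -> compact (F @^-1` L)].

Definition disc_cvg m Omega (F : hol Omega (CCn R m))
    (u : nat -> CC R -> Omega) (f : CC R -> Omega) : Prop :=
  forall K : set R[i], compact K -> K `<=` unit_disc ->
    {uniform K, (fun n => F \o u n) @ \oo --> (F \o f : R[i] -> 'rV[R[i]]_m)}.

Definition compactly_divergent Omega (u : nat -> CC R -> Omega) : Prop :=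
  forall (K : set (CC R)) (L : set Omega),
    compact K -> K `<=` unit_disc -> compact L ->
    exists n0, forall n, (n0 <= n)%N -> (u n @` K) `&` L = set0.

(* A map from the disc is represented by a function on the whole plane; only
   its restriction to [unit_disc] matters.  The embedding [F] exists for every
   Stein manifold (Remmert, Bishop, Narasimhan) and the topology it induces
   does not depend on it, so the quantifier over [F] only names a choice. *)
Definition taut Omega : Prop :=
  forall F : hol Omega (CCn R (2 * N).+1), proper_embedding F ->
  forall u : nat -> CC R -> Omega,
    (forall n, holomorphic_on unit_disc (u n)) ->
    compactly_divergent u \/
    exists k, increasing k /\
      exists f : CC R -> Omega,
        holomorphic_on unit_disc f /\ disc_cvg F (u \o k) f.

End stein.

(* Main.v *)
(* Say that x and y are C-close if |G x - G y| <= C (1 - |G x|) and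
   |G x - G y| <= C (1 - |G y|) for every holomorphic G from Omega to the unit
   disc.  The quantity ln (1 + C) then behaves like the Caratheodory distance:
   holomorphic maps do not increase it, it satisfies the triangle inequality,
   it is bounded on compact sets by Schwarz-Pick and connectedness, and by
   hypothesis its balls are relatively compact.

   Taut: the discs whose image meets a fixed compact set map each smaller disc
   into one compact set, and an ultrafilter limit of them is holomorphic by
   Weierstrass' theorem.

   Universality: if psi z1 is far away then some F with F z0 = 0 has |F| bounded
   away from 1 on K and F almost constant of modulus almost 1 on psi K; a power
   of F separates K from psi K.  When moreover C_phi has dense range, this makes
   the operators C_phi^n transitive along every sequence on which the orbit of
   one point leaves all compact sets, and a universal vector follows because
   O(Omega) is separable.  Density of the range comes from the Runge property
   once phi^-1 is known to be holomorphic, which is Osgood's theorem on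
   injective holomorphic maps.  Finally a hypercyclic C_phi has dense range and
   an unbounded orbit, and by Calka's argument an unbounded orbit tends to
   infinity, hence leaves all compact sets along every sequence. *)
From HB Require Import structures.
Require Import Defs.
From mathcomp Require Import all_boot all_order all_algebra ring lra.
From mathcomp Require Import complex.
From mathcomp Require Import all_classical all_reals all_analysis.

Set Implicit Arguments.
Unset Strict Implicit.
Unset Printing Implicit Defensive.

Import Order.TTheory GRing.Theory Num.Theory.
Import numFieldNormedType.Exports.

Local Open Scope classical_set_scope.
Local Open Scope ring_scope.

(** * Cauchy's theorem in one variable *)

(** The analysis rests on the fundamental theorem of calculus, and no power series expansion of a
    holomorphic function is formed. Goursat's theorem on rectangles passes to circles through
    [z -> c + exp z]; means over circles are therefore independent of the radius, which gives the
    maximum principle, and nothing is integrated after that. Estimates come from it by division: a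
    quotient [(f z - f a) / (z - a)] is bounded on a circle, hence inside. The outcome, a Lipschitz
    constant [8 M / rho] on the half ball for functions bounded by [M] on a ball of radius [rho],
    does the work of Cauchy's formula in Weierstrass' theorem, the inverse function theorem and
    Schwarz-Pick.

    Osgood's theorem is the main obstacle. Induction on the dimension leaves a map whose
    differential vanishes wherever its Jacobian does; a Lipschitz path in the zero set of the
    Jacobian is then collapsed to a point, against injectivity.

    C-closeness takes the place of the pseudodistance because the latter is a supremum inside a
    logarithm, while one inequality per [G] passes directly through composition with holomorphic
    maps. *)

Section oriented_integral.
Context {R : realType}.
Implicit Types (f g F G : R -> R) (a b c : R).
Local Notation mu := (@lebesgue_measure R).

Definition primitive f a : R -> R :=
  fun x => (\int[mu]_(t in [set` `[a, x]]) f t)%R.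

Lemma is_derive_primitive f a x : continuous f -> a < x ->
  is_derive x 1 (primitive f a) (f x).
Proof.
move=> cf ax; have x1 : x < x + 1 by rewrite ltrDl.
have fi : mu.-integrable `[a, x + 1] (EFin \o f).
  apply: continuous_compact_integrable; first exact: segment_compact.
  exact: continuous_subspaceT.
have [d e] := continuous_FTC1_closed x1 fi ax (cf x).
by rewrite -e derive1E; exact: derivableP.
Qed.

Lemma is_derive_eq_cst F G f a b : a <= b ->
  (forall x, a <= x <= b -> is_derive x 1 F (f x)) ->
  (forall x, a <= x <= b -> is_derive x 1 G (f x)) ->
  F b - F a = G b - G a.
Proof.
move=> ab dF dG.
have dFG x : x \in `[a, b] -> is_derive x 1 (F - G) 0.
  rewrite in_itv /= => xab; rewrite -(subrr (f x)).
  by apply: is_deriveB; [exact: dF|exact: dG].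
have cFG : {within `[a, b], continuous (F - G)}.
  by apply: derivable_within_continuous => x xab; have [] := dFG x xab.
have dFG' x : x \in `]a, b[ -> is_derive x 1 (F - G) 0.
  by move=> xab; apply: dFG; exact: subset_itv_oo_cc xab.
have [c _] := MVT_segment ab dFG' cFG.
by rewrite mul0r !fctE => /eqP; rewrite subr_eq0 => /eqP; lra.
Qed.

(** The base point [a - 1] lies strictly left of [a], so the primitive is differentiable at the
    endpoint [a] as well; [is_derive_primitive] requires a strict inequality. *)
Definition itg f a b := primitive f (a - 1) b - primitive f (a - 1) a.

Lemma itgE f F a b : continuous f -> a <= b ->
  (forall x, a <= x <= b -> is_derive x 1 F (f x)) -> itg f a b = F b - F a.
Proof.
move=> cf ab dF; apply: (@is_derive_eq_cst _ _ f) => // x /andP[ax _].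
by apply: is_derive_primitive => //; rewrite ltrBlDr (le_lt_trans ax) ?ltrDl.
Qed.

Lemma itg_split f a b c : continuous f -> a <= b -> b <= c ->
  itg f a c = itg f a b + itg f b c.
Proof.
move=> cf ab bc; have dF x : a <= x -> is_derive x 1 (primitive f (a - 1)) (f x).
  by move=> ax; apply: is_derive_primitive => //; rewrite ltrBlDr (le_lt_trans ax) ?ltrDl.
have -> : itg f b c = primitive f (a - 1) c - primitive f (a - 1) b.
  by apply: itgE => // x /andP[bx _]; apply: dF; exact: le_trans bx.
by rewrite /itg; lra.
Qed.

(** The mean value theorem for the difference of the two primitives; no inequality between Lebesgue
    integrals enters. *)
Lemma itgB_bound f g a b M : continuous f -> continuous g -> a <= b ->
  (forall x, a <= x <= b -> `|f x - g x| <= M) ->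
  `|itg f a b - itg g a b| <= M * (b - a).
Proof.
move=> cf cg ab fgM.
have aa1 x : a <= x -> a - 1 < x by move=> ax; rewrite ltrBlDr (le_lt_trans ax) ?ltrDl.
pose F := primitive f (a - 1); pose G := primitive g (a - 1).
have dFG x : x \in `[a, b] -> is_derive x 1 (F - G) (f x - g x).
  rewrite in_itv /= => /andP[/aa1 ax _].
  by apply: is_deriveB; apply: is_derive_primitive.
have cFG : {within `[a, b], continuous (F - G)}.
  by apply: derivable_within_continuous => x xab; have [] := dFG x xab.
have dFG' x : x \in `]a, b[ -> is_derive x 1 (F - G) (f x - g x).
  by move=> xab; apply: dFG; exact: subset_itv_oo_cc xab.
have [c] := MVT_segment ab dFG' cFG.
rewrite in_itv /= => /fgM cM; rewrite !fctE => e.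
have -> : itg f a b - itg g a b = F b - G b - (F a - G a) by rewrite /itg -/F -/G; lra.
by rewrite e normrM (ger0_norm (x := b - a)) ?subr_ge0 // ler_wpM2r ?subr_ge0.
Qed.

Lemma le_itg f g a b : continuous f -> continuous g -> a <= b ->
  (forall x, a <= x <= b -> f x <= g x) -> itg f a b <= itg g a b.
Proof.
move=> cf cg ab fg.
have aa1 x : a <= x -> a - 1 < x by move=> ax; rewrite ltrBlDr (le_lt_trans ax) ?ltrDl.
pose F := primitive f (a - 1); pose G := primitive g (a - 1).
have dFG x : x \in `[a, b] -> is_derive x 1 (G - F) (g x - f x).
  rewrite in_itv /= => /andP[/aa1 ax _].
  by apply: is_deriveB; apply: is_derive_primitive.
have cFG : {within `[a, b], continuous (G - F)}.
  by apply: derivable_within_continuous => x xab; have [] := dFG x xab.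
have dFG' x : x \in `]a, b[ -> is_derive x 1 (G - F) (g x - f x).
  by move=> xab; apply: dFG; exact: subset_itv_oo_cc xab.
have [c] := MVT_segment ab dFG' cFG.
rewrite in_itv /= => /fg cM; rewrite !fctE => e.
have -> : itg f a b = itg g a b - (G b - F b - (G a - F a)).
  by rewrite /itg -/F -/G; lra.
by rewrite e lerBlDr lerDl mulr_ge0 // subr_ge0.
Qed.

Lemma is_derive_affine c (d x : R) : is_derive x 1 (fun y : R => c + d * y) d.
Proof.
have H : is_derive x 1 (cst c + (d *: id) : R -> R) (0 + d *: 1).
  exact: is_deriveD.
by move: H; rewrite add0r /GRing.scale /= mulr1.
Qed.

Lemma continuous_affine c (d : R) : continuous (fun y : R => c + d * y).
Proof.
move=> x; apply: differentiable_continuous; apply/derivable1_diffP.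
by have [] := is_derive_affine c d x.
Qed.

Lemma itg_affine c (d a b : R) : a <= b ->
  itg (fun x => c + d * x) a b = c * (b - a) + d * (b ^+ 2 - a ^+ 2) / 2.
Proof.
move=> ab.
have dF (x : R) : is_derive x 1 ((c *: id + (d / 2) *: (id ^+ 2)) : R -> R) (c + d * x).
  have H : is_derive x 1 ((c *: id + (d / 2) *: (id ^+ 2)) : R -> R)
     (c *: 1 + (d / 2) *: ((2%:R * id x ^+ 1) *: 1)).
    by apply: is_deriveD; apply: is_deriveZ; exact: is_deriveX.
  suff -> : c + d * x = c *: 1 + (d / 2) *: ((2%:R * id x ^+ 1) *: 1) by [].
  by rewrite /GRing.scale /=; field.
have cf := @continuous_affine c d.
by rewrite (itgE cf ab (fun x _ => dF x)) !fctE /GRing.scale /=; field.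
Qed.

Lemma itg_cst c a b : a <= b -> itg (fun=> c) a b = c * (b - a).
Proof.
move=> ab; have -> : (fun=> c) = (fun x : R => c + 0 * x).
  by apply/funext => x; rewrite mul0r addr0.
by rewrite itg_affine // !mul0r addr0.
Qed.

End oriented_integral.

Lemma nested_intervals {R : realType} (u w : nat -> R) :
  (forall k j, u k <= u (j + k)%N /\ u (j + k)%N + w (j + k)%N <= u k + w k) ->
  (forall k, 0 <= w k) -> exists a, forall k, u k <= a <= u k + w k.
Proof.
move=> uw w0; exists (sup (range u)) => k.
have ub j l : u j <= u l + w l.
  have [h1 _] := uw j l; have [_ h2] := uw l j.
  by have := w0 (j + l)%N; rewrite addnC in h1; lra.
apply/andP; split.
  by apply: ub_le_sup; [exists (u k + w k) => _ [j _ <-]|exists k].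
by apply: ge_sup; [exists (u 0%N), 0%N|move=> _ [j _ <-]].
Qed.

Section goursat.
Context {R : realType}.
Variables (P Q : R -> R -> R).

(** The integral of [P dx + Q dy] over the boundary of a rectangle, counterclockwise: bottom, right,
    top, left. *)
Definition contour_integral x1 x2 y1 y2 :=
  itg (P^~ y1) x1 x2 + itg (Q x2) y1 y2 - itg (P^~ y2) x1 x2 - itg (Q x1) y1 y2.

(* [P dx + Q dy] is differentiable at [(a, b)] with [dP/dy = dQ/dx = p2]. *)
Definition closed_form_at (S : R -> R -> Prop) a b :=
  exists p1 p2 q2, forall e, 0 < e -> exists2 d, 0 < d &
    forall x y, S x y -> `|x - a| < d -> `|y - b| < d ->
      `|P x y - P a b - p1 * (x - a) - p2 * (y - b)| <= e * (`|x - a| + `|y - b|) /\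
      `|Q x y - Q a b - p2 * (x - a) - q2 * (y - b)| <= e * (`|x - a| + `|y - b|).

Hypothesis cP : forall y, continuous (P^~ y).
Hypothesis cQ : forall x, continuous (Q x).

Lemma contour_integral_quarter x y l h : 0 <= l -> 0 <= h ->
  contour_integral x (x + (l + l)) y (y + (h + h)) =
  contour_integral x (x + l) y (y + h) +
  contour_integral (x + l) (x + l + l) y (y + h) +
  contour_integral x (x + l) (y + h) (y + h + h) +
  contour_integral (x + l) (x + l + l) (y + h) (y + h + h).
Proof.
move=> l0 h0; rewrite [x + (l + l)]addrA [y + (h + h)]addrA.
set x1 := x + l; set x2 := x1 + l; set y1 := y + h; set y2 := y1 + h.
have x01 : x <= x1 by rewrite lerDl.
have x12 : x1 <= x2 by rewrite lerDl.
have y01 : y <= y1 by rewrite lerDl.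
have y12 : y1 <= y2 by rewrite lerDl.
rewrite /contour_integral.
rewrite (itg_split (@cP y) x01 x12) (itg_split (@cP y2) x01 x12).
rewrite (itg_split (@cQ x) y01 y12) (itg_split (@cQ x2) y01 y12).
by ring.
Qed.

(** Replacing [P] and [Q] by their affine parts changes each side by at most [e / 2 * w] times its
    length, where [w] is half the perimeter. The affine form has contour integral [0] because its
    two mixed coefficients are the same [p2]. *)
Lemma contour_integral_local S a b e : closed_form_at S a b -> 0 < e ->
  exists2 d, 0 < d & forall x1 x2 y1 y2, x1 <= a <= x2 -> y1 <= b <= y2 ->
    (forall x y, x1 <= x <= x2 -> y1 <= y <= y2 -> S x y) ->
    x2 - x1 < d -> y2 - y1 < d ->
    `|contour_integral x1 x2 y1 y2| <= e * (x2 - x1 + (y2 - y1)) ^+ 2.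
Proof.
move=> [p1 [p2 [q2 PQ]]] e0.
have e20 : 0 < e / 2 by lra.
have [d d0 dPQ] := PQ _ e20; exists d => // x1 x2 y1 y2 xa yb SS xd yd.
have x12 : x1 <= x2 by lra.
have y12 : y1 <= y2 by lra.
set w := x2 - x1 + (y2 - y1).
pose P' y x := (P a b - p1 * a + p2 * (y - b)) + p1 * x.
pose Q' x y := (Q a b - q2 * b + p2 * (x - a)) + q2 * y.
have near x y : x1 <= x <= x2 -> y1 <= y <= y2 ->
    `|P x y - P' y x| <= e / 2 * w /\ `|Q x y - Q' x y| <= e / 2 * w.
  move=> xx yy.
  have lx : `|x - a| <= x2 - x1 by rewrite ler_norml; lra.
  have ly : `|y - b| <= y2 - y1 by rewrite ler_norml; lra.
  have [|||] := dPQ x y; [exact: SS|exact: le_lt_trans lx xd|exact: le_lt_trans ly yd|].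
  have -> : P x y - P' y x = P x y - P a b - p1 * (x - a) - p2 * (y - b).
    by rewrite /P'; ring.
  have -> : Q x y - Q' x y = Q x y - Q a b - p2 * (x - a) - q2 * (y - b).
    by rewrite /Q'; ring.
  have le : e / 2 * (`|x - a| + `|y - b|) <= e / 2 * w.
    by rewrite ler_pM2l // /w lerD.
  by move=> h1 h2; split; apply: le_trans le.
have cP' y : continuous (P' y) by exact: continuous_affine.
have cQ' x : continuous (Q' x) by exact: continuous_affine.
have bP y : y1 <= y <= y2 -> `|itg (P^~ y) x1 x2 - itg (P' y) x1 x2| <= e / 2 * w * (x2 - x1).
  by move=> yy; apply: itgB_bound => // x xx; have [] := near x y xx yy.
have bQ x : x1 <= x <= x2 -> `|itg (Q x) y1 y2 - itg (Q' x) y1 y2| <= e / 2 * w * (y2 - y1).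
  by move=> xx; apply: itgB_bound => // y yy; have [] := near x y xx yy.
have /bP b1 : y1 <= y1 <= y2 by lra.
have /bP b2 : y1 <= y2 <= y2 by lra.
have /bQ b3 : x1 <= x1 <= x2 by lra.
have /bQ b4 : x1 <= x2 <= x2 by lra.
have aff : itg (P' y1) x1 x2 + itg (Q' x2) y1 y2 - itg (P' y2) x1 x2 - itg (Q' x1) y1 y2 = 0.
  by rewrite !itg_affine //; field.
rewrite /contour_integral -[X in `|X|]subr0 -aff.
have -> : e * w ^+ 2 = e / 2 * w * (x2 - x1) + e / 2 * w * (y2 - y1) +
  e / 2 * w * (x2 - x1) + e / 2 * w * (y2 - y1) by rewrite /w; field.
move: b1 b2 b3 b4; rewrite !ler_norml.
set i1 := itg _ _ _; set j1 := itg _ _ _; set i2 := itg _ _ _; set j2 := itg _ _ _.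
set i3 := itg _ _ _; set j3 := itg _ _ _; set i4 := itg _ _ _; set j4 := itg _ _ _.
set m1 := e / 2 * w * _; set m2 := e / 2 * w * _; lra.
Qed.

Lemma expr2V_small (L d : R) : 0 < d -> exists k : nat, L / 2 ^+ k < d.
Proof.
move=> d0; have kL : `|L| / d < (Num.bound (`|L| / d))%:R by apply: archi_boundP; rewrite divr_ge0 // ltW.
exists (Num.bound (`|L| / d)); set k := Num.bound _ in kL *.
have k2 : (k%:R : R) < 2 ^+ k by rewrite -natrX ltr_nat ltn_expl.
rewrite ltr_pdivrMr ?exprn_gt0 //; apply: le_lt_trans (ler_norm _) _.
by rewrite -ltr_pdivrMl // mulrC; exact: lt_trans kL k2.
Qed.

(** Quadrisection: one quarter keeps at least a fourth of the absolute value, so [4 ^ k] times the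
    integral over the [k]-th rectangle bounds the original one, while the local estimate at the
    common point makes this product at most [e]. *)
Lemma goursat x1 x2 y1 y2 : x1 <= x2 -> y1 <= y2 ->
  (forall a b, x1 <= a <= x2 -> y1 <= b <= y2 ->
     closed_form_at (fun x y => x1 <= x <= x2 /\ y1 <= y <= y2) a b) ->
  contour_integral x1 x2 y1 y2 = 0.
Proof.
move=> x12 y12 cl; set S := fun x y => _ in cl.
pose L := x2 - x1; pose H := y2 - y1.
pose W k (s : R * R) :=
  contour_integral s.1 (s.1 + L / 2 ^+ k) s.2 (s.2 + H / 2 ^+ k).
have L0 : 0 <= L by rewrite subr_ge0.
have H0 : 0 <= H by rewrite subr_ge0.
have k0 k : 0 < (2 : R) ^+ k by rewrite exprn_gt0.
have step k s : exists s' : R * R, [/\ s'.1 = s.1 \/ s'.1 = s.1 + L / 2 ^+ k.+1,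
    s'.2 = s.2 \/ s'.2 = s.2 + H / 2 ^+ k.+1 & `|W k s| <= 4 * `|W k.+1 s'|].
  have h (A : R) : 0 <= A -> A / 2 ^+ k = A / 2 ^+ k.+1 + A / 2 ^+ k.+1.
    by move=> _; rewrite exprS; field; rewrite gt_eqF.
  have Lk : 0 <= L / 2 ^+ k.+1 by rewrite divr_ge0 // ltW.
  have Hk : 0 <= H / 2 ^+ k.+1 by rewrite divr_ge0 // ltW.
  have q := contour_integral_quarter s.1 s.2 Lk Hk.
  rewrite -(h L L0) -(h H H0) -/(W k s) in q.
  have le : `|W k s| <= `|W k.+1 s| + `|W k.+1 (s.1 + L / 2 ^+ k.+1, s.2)| +
     `|W k.+1 (s.1, s.2 + H / 2 ^+ k.+1)| +
     `|W k.+1 (s.1 + L / 2 ^+ k.+1, s.2 + H / 2 ^+ k.+1)|.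
    rewrite q; apply: le_trans (ler_normD _ _) _; apply: lerD => //.
    apply: le_trans (ler_normD _ _) _; apply: lerD => //.
    by apply: le_trans (ler_normD _ _) _; apply: lerD.
  have [h1|h1] := leP `|W k s| (4 * `|W k.+1 s|).
    by exists s; split; [left|left|].
  have [h2|h2] := leP `|W k s| (4 * `|W k.+1 (s.1 + L / 2 ^+ k.+1, s.2)|).
    by exists (s.1 + L / 2 ^+ k.+1, s.2); split; [right|left|].
  have [h3|h3] := leP `|W k s| (4 * `|W k.+1 (s.1, s.2 + H / 2 ^+ k.+1)|).
    by exists (s.1, s.2 + H / 2 ^+ k.+1); split; [left|right|].
  exists (s.1 + L / 2 ^+ k.+1, s.2 + H / 2 ^+ k.+1); split; [by right|by right|].
  move: le h1 h2 h3; set w := `|W k s|; set w1 := `|W k.+1 s|.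
  set w2 := `|W _ (_, s.2)|; set w3 := `|W _ (s.1, _)|; set w4 := `|W _ _|; lra.
have [nx nxP] : {nx : nat -> R * R -> R * R | forall k s,
    [/\ (nx k s).1 = s.1 \/ (nx k s).1 = s.1 + L / 2 ^+ k.+1,
    (nx k s).2 = s.2 \/ (nx k s).2 = s.2 + H / 2 ^+ k.+1 &
    `|W k s| <= 4 * `|W k.+1 (nx k s)|]}.
  exists (fun k s => sval (cid (step k s))) => k s; exact: (svalP (cid (step k s))).
pose s := fix s k := if k is k'.+1 then nx k' (s k') else (x1, y1).
have sS k : s k.+1 = nx k (s k) by [].
have Ws k : `|W 0%N (s 0%N)| <= 4 ^+ k * `|W k (s k)|.
  elim: k => [|k ih]; first by rewrite expr0 mul1r.
  apply: le_trans ih _; rewrite exprSr -mulrA ler_wpM2l ?exprn_ge0 //.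
  by rewrite sS; have [] := nxP k (s k).
have half (A : R) k : A / 2 ^+ k = A / 2 ^+ k.+1 + A / 2 ^+ k.+1.
  by rewrite exprS; field; rewrite gt_eqF.
have nest1 k j : (s k).1 <= (s (j + k)%N).1 /\
    (s (j + k)%N).1 + L / 2 ^+ (j + k) <= (s k).1 + L / 2 ^+ k.
  elim: j => [|j [ih1 ih2]]; first by rewrite add0n.
  rewrite addSn sS; have [h _ _] := nxP (j + k)%N (s (j + k)%N).
  have := half L (j + k)%N.
  have : 0 <= L / 2 ^+ (j + k).+1 by rewrite divr_ge0 // ltW.
  by case: h => ->; lra.
have nest2 k j : (s k).2 <= (s (j + k)%N).2 /\
    (s (j + k)%N).2 + H / 2 ^+ (j + k) <= (s k).2 + H / 2 ^+ k.
  elim: j => [|j [ih1 ih2]]; first by rewrite add0n.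
  rewrite addSn sS; have [_ h _] := nxP (j + k)%N (s (j + k)%N).
  have := half H (j + k)%N.
  have : 0 <= H / 2 ^+ (j + k).+1 by rewrite divr_ge0 // ltW.
  by case: h => ->; lra.
have [a aP] := nested_intervals nest1 (fun k => divr_ge0 L0 (ltW (k0 k))).
have [b bP] := nested_intervals nest2 (fun k => divr_ge0 H0 (ltW (k0 k))).
have Sab : x1 <= a <= x2 /\ y1 <= b <= y2.
  have := aP 0%N; have := bP 0%N; rewrite /= !expr0 !divr1 /L /H; lra.
apply/eqP; rewrite -normr_le0; apply/ler_addgt0Pr => e e0; rewrite add0r.
(* The [+ 1] permits division by [w] when the rectangle degenerates to a point. *)
pose w := (L + H) ^+ 2 + 1.
have w0 : 0 < w by rewrite /w; have := sqr_ge0 (L + H); lra.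
have ew : 0 < e / w by rewrite divr_gt0.
have [d d0 dP] := contour_integral_local (cl a b Sab.1 Sab.2) ew.
have [k kd] := expr2V_small (L + H) d0.
have kL : L / 2 ^+ k <= (L + H) / 2 ^+ k by rewrite ler_pM2r ?invr_gt0 // lerDl.
have kH : H / 2 ^+ k <= (L + H) / 2 ^+ k by rewrite ler_pM2r ?invr_gt0 // lerDr.
have := @dP (s k).1 ((s k).1 + L / 2 ^+ k) (s k).2 ((s k).2 + H / 2 ^+ k) (aP k) (bP k).
rewrite -/(W k (s k)) !(addrC (s k).1, addrC (s k).2) !addrK => loc.
have {}loc : `|W k (s k)| <= e / w * (L / 2 ^+ k + H / 2 ^+ k) ^+ 2.
  apply: loc; [|lra|lra] => x y xk yk.
  have := nest1 0%N k; have := nest2 0%N k; rewrite !addn0 /= !expr0 !divr1.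
  by rewrite /S /L /H in xk yk *; lra.
have := Ws k; rewrite /W /= expr0 !divr1 /L /H !(addrC x1, addrC y1) !subrK => le0.
apply: le_trans le0 _; apply: le_trans (ler_wpM2l _ loc) _; first by rewrite exprn_ge0.
rewrite -mulrDl exprMn -exprVn -exprM mulnC exprM mulrCA.
have -> : 4 ^+ k * ((L + H) ^+ 2 * (2^-1 ^+ 2) ^+ k) = (L + H) ^+ 2.
  rewrite mulrCA -exprMn (_ : 4 * 2^-1 ^+ 2 = 1) ?expr1n ?mulr1 //; by field.
rewrite -mulrA ler_piMr ?(ltW e0) // mulrC ler_pdivrMr // mul1r /w lerDl //.
Qed.

End goursat.

(** * The maximum principle *)

Local Open Scope complex_scope.

Local Notation normc := Normc.normc.
Local Notation Re := complex.Re.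
Local Notation Im := complex.Im.


(** * Real-valued norms; continuity and differentiability by epsilon and delta *)

Section real_norm.
Context {R : realType}.
Implicit Types (V W : normedModType R[i]).

(** A norm over [R[i]] is itself a complex number; [nr] is the underlying real number, on which
    [lra] and [nra] can work. *)
Definition nr V (x : V) : R := Re `|x|.

Lemma nrE V (x : V) : `|x| = (nr x)%:C.
Proof. by rewrite /nr RRe_real // normr_real. Qed.

Lemma nr_normc (z : R[i]) : nr z = normc z.
Proof. by []. Qed.

Lemma nr_ge0 V (x : V) : 0 <= nr x.
Proof. by rewrite -ler0c -nrE. Qed.

Lemma normc_ge0 (z : R[i]) : 0 <= normc z.
Proof. exact: (nr_ge0 z). Qed.

Lemma nr0 V : nr (0 : V) = 0.
Proof. by rewrite /nr normr0. Qed.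

Lemma nr_eq0 V (x : V) : (nr x == 0) = (x == 0).
Proof. by rewrite -(normr_eq0 x) nrE -(inj_eq (@complexI R)). Qed.

Lemma normc_eq0 (z : R[i]) : (normc z == 0) = (z == 0).
Proof. exact: (nr_eq0 z). Qed.

Lemma nr_gt0 V (x : V) : (0 < nr x) = (x != 0).
Proof. by rewrite lt_def nr_eq0 nr_ge0 andbT. Qed.

Lemma normc_gt0 (z : R[i]) : (0 < normc z) = (z != 0).
Proof. exact: (nr_gt0 z). Qed.

Lemma ler_nrD V (x y : V) : nr (x + y) <= nr x + nr y.
Proof. by rewrite -lecR rmorphD /= -!nrE ler_normD. Qed.

Lemma nrN V (x : V) : nr (- x) = nr x.
Proof. by rewrite /nr normrN. Qed.

Lemma ler_nrB V (x y : V) : nr (x - y) <= nr x + nr y.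
Proof. by rewrite -(nrN y) ler_nrD. Qed.

Lemma nrBC V (x y : V) : nr (x - y) = nr (y - x).
Proof. by rewrite -nrN opprB. Qed.

Lemma ler_nr_dist V (x y z : V) : nr (x - z) <= nr (x - y) + nr (y - z).
Proof. by apply: le_trans (ler_nrD _ _); rewrite addrA subrK. Qed.

Lemma lerB_nr V (x y : V) : nr x - nr y <= nr (x - y).
Proof. by rewrite lerBlDr; apply: le_trans (ler_nrD _ _); rewrite subrK. Qed.

Lemma nrZ V (a : R[i]) (x : V) : nr (a *: x) = normc a * nr x.
Proof.
apply: (@complexI R); rewrite -nrE normrZ rmorphM /= -nrE.
by [].
Qed.

Lemma ler_normcD (x y : R[i]) : normc (x + y) <= normc x + normc y.
Proof. exact: (ler_nrD x y). Qed.

Lemma ler_normcB (x y : R[i]) : normc (x - y) <= normc x + normc y.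
Proof. exact: (ler_nrB x y). Qed.

Lemma ler_normc_dist (x y z : R[i]) : normc (x - z) <= normc (x - y) + normc (y - z).
Proof. exact: (ler_nr_dist x y z). Qed.

Lemma lerB_normc (x y : R[i]) : normc x - normc y <= normc (x - y).
Proof. exact: (lerB_nr x y). Qed.

Lemma normcBC (x y : R[i]) : normc (x - y) = normc (y - x).
Proof. exact: (nrBC x y). Qed.

Lemma normcN (x : R[i]) : normc (- x) = normc x.
Proof. exact: (nrN x). Qed.

Lemma normcM (x y : R[i]) : normc (x * y) = normc x * normc y.
Proof. exact: Normc.normcM. Qed.

Lemma normcV (x : R[i]) : normc x^-1 = (normc x)^-1.
Proof. exact: Normc.normcV. Qed.

Lemma normcX (x : R[i]) n : normc (x ^+ n) = normc x ^+ n.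
Proof.
elim: n => [|n ih]; first by rewrite !expr0; exact: Normc.normc1.
by rewrite !exprS normcM ih.
Qed.

Lemma normc_real (x : R) : normc x%:C = `|x|.
Proof. by rewrite /= expr0n addr0 sqrtr_sqr. Qed.

Lemma normr_Re (z : R[i]) : `|Re z| <= normc z.
Proof. by rewrite -lecR; exact: normc_ge_Re. Qed.

Lemma normr_Im (z : R[i]) : `|Im z| <= normc z.
Proof.
case: z => x y /=; rewrite -[X in X <= _]sqrtr_sqr.
by rewrite ler_wsqrtr // lerDr sqr_ge0.
Qed.

Lemma ler_normc_ReIm (z : R[i]) : normc z <= `|Re z| + `|Im z|.
Proof.
case: z => x y /=; rewrite -[X in _ <= X]ger0_norm ?addr_ge0 //.
rewrite -sqrtr_sqr ler_wsqrtr // sqrrD !real_normK ?num_real //.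
by rewrite addrAC lerDl mulrn_wge0 // mulr_ge0.
Qed.

Lemma nbhs_nrP V (x : V) (P : set V) :
  nbhs x P <-> exists2 d : R, 0 < d & forall y, nr (y - x) < d -> P y.
Proof.
split=> [/nbhs_normP[d /= d0 dP]|[d d0 dP]].
  have dE : d = (Re d)%:C by rewrite RRe_real // gtr0_real.
  exists (Re d); first by rewrite dE ltcR in d0.
  by move=> y yd; apply: dP; rewrite /= nrBC in yd *; rewrite nrE dE ltcR.
apply/nbhs_normP; exists d%:C; first by rewrite /= ltcR.
by move=> y /=; rewrite nrE ltcR nrBC; exact: dP.
Qed.

Lemma continuous_nrP (V W : normedModType R[i]) (f : V -> W) x :
  {for x, continuous f} <->
  forall e : R, 0 < e -> exists2 d : R, 0 < d &
    forall y, nr (y - x) < d -> nr (f y - f x) < e.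
Proof.
split=> [cf e e0|cf A /nbhs_nrP[e /cf[d d0 dP] eP]].
  have /cf /nbhs_nrP[d d0 dP] : nbhs (f x) [set y | nr (y - f x) < e].
    by apply/nbhs_nrP; exists e.
  by exists d.
by apply/nbhs_nrP; exists d => // y /dP /eP.
Qed.

Lemma differentiable_nrP V W (f : V -> W) (x : V) : differentiable f x ->
  forall e : R, 0 < e -> exists2 d : R, 0 < d &
    forall h, nr h < d -> nr (f (x + h) - f x - 'd f x h) <= e * nr h.
Proof.
move=> df e e0; have [_ /eqaddoP dE] := (diff_locallyP x f).1 df.
have /dE /nbhs_nrP[d d0 dP] : 0 < e%:C by rewrite ltcR.
exists d => // h hd; have := dP h; rewrite subr0 => /(_ hd).
by rewrite !nrE -rmorphM /= lecR !fctE /= /shift /= (addrC h) opprD addrA.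
Qed.

Lemma nrP_differentiable V W (f : V -> W) (x : V) (L : {linear V -> W}) :
  continuous L -> (forall e : R, 0 < e -> exists2 d : R, 0 < d &
    forall h, nr h < d -> nr (f (x + h) - f x - L h) <= e * nr h) ->
  differentiable f x /\ 'd f x = L :> (V -> W).
Proof.
move=> cL fL; have fE : f \o shift x = cst (f x) + L +o_ 0 id.
  apply/eqaddoP => e e0; have eE : e = (Re e)%:C by rewrite RRe_real // gtr0_real.
  have /fL[d d0 dP] : 0 < Re e by rewrite eE ltcR in e0.
  apply/nbhs_nrP; exists d => // h; rewrite subr0 => /dP.
  rewrite /= !nrE eE -rmorphM /= lecR !fctE /= /shift /= (addrC h).
  by rewrite opprD addrA.
have dE := diff_unique cL fE; split=> //.
by apply/diff_locallyP; rewrite dE.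
Qed.

(** A relation that carries the value [a] of the complex derivative as a number, in place of the
    linear map ['d f z]. *)
Definition cder (f : R[i] -> R[i]) z a :=
  forall e : R, 0 < e -> exists2 d : R, 0 < d &
    forall h, normc h < d -> normc (f (z + h) - f z - a * h) <= e * normc h.

Lemma differentiable_cder (f : R[i] -> R[i]) z :
  differentiable f z -> cder f z ('d f z 1).
Proof.
move=> df e e0; have [d d0 dP] := differentiable_nrP df e0.
exists d => // h hd; have := dP h hd.
have -> : 'd f z h = 'd f z 1 * h by rewrite -[X in 'd f z X]mulr1 linearZ /= mulrC.
by [].
Qed.

Definition mulc_lin (a : R[i]) : R[i] -> R[i] := fun h => a * h.

Lemma mulc_lin_linear a : linear (mulc_lin a).
Proof. by move=> k x y; rewrite /mulc_lin mulrDr /GRing.scale /= mulrCA. Qed.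

HB.instance Definition _ a :=
  GRing.isLinear.Build R[i] R[i] R[i] _ (mulc_lin a) (mulc_lin_linear a).

Lemma cder_differentiable (f : R[i] -> R[i]) z a :
  cder f z a -> differentiable f z /\ 'd f z 1 = a.
Proof.
move=> fa; have cL : continuous (mulc_lin a).
  move=> x; apply/continuous_nrP => e e0.
  have a1 : 0 < normc a + 1 by rewrite ltr_pwDr ?normc_ge0.
  exists (e / (normc a + 1)); first by rewrite divr_gt0.
  move=> y; rewrite nr_normc ltr_pdivlMr // => ye.
  rewrite /mulc_lin -mulrBr nr_normc normcM; apply: le_lt_trans ye.
  by rewrite mulrC ler_wpM2l ?normc_ge0 // lerDl.
have [df ->] := nrP_differentiable cL fa.
by split=> //; exact: mulr1.
Qed.

Lemma cder_continuous (f : R[i] -> R[i]) z a :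
  cder f z a -> {for z, continuous f}.
Proof. by move=> /cder_differentiable[df _]; exact: differentiable_continuous. Qed.

Lemma is_derive_dist (f : R -> R) (x a : R) : is_derive x 1 f a ->
  forall e : R, 0 < e -> exists2 d : R, 0 < d &
    forall h, `|h| < d -> `|f (x + h) - f x - a * h| <= e * `|h|.
Proof.
move=> [/derivable1_diffP df fa] e e0.
have [_ /eqaddoP dE] := (diff_locallyP x f).1 df.
have /dE /nbhs_normP[d /= d0 dP] := e0.
exists d => // h hd; have := dP h; rewrite /= sub0r normrN => /(_ hd).
rewrite !fctE /= /shift /= (addrC h) diff1E // derive1E fa.
by rewrite opprD addrA /GRing.scale /= (mulrC h).
Qed.

Lemma continuous_distP (u : R -> R) x : {for x, continuous u} <->
  forall e : R, 0 < e -> exists2 d : R, 0 < d &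
    forall y, `|y - x| < d -> `|u y - u x| < e.
Proof.
split=> [cu e e0|cu A /nbhs_normP[e /= /cu[d d0 dP] eP]].
  have /cu /nbhs_normP[d /= d0 dP] : nbhs (u x) [set y | `|y - u x| < e].
    by apply/nbhs_normP; exists e => // y /=; rewrite distrC.
  by exists d => // y yd; apply: dP; rewrite /= distrC.
apply/nbhs_normP; exists d => // y /= yd; apply: eP; rewrite /= distrC.
by apply: dP; rewrite distrC.
Qed.

End real_norm.

Section complex_exponential.
Context {R : realType}.
Implicit Types z w h : R[i].

Definition cexp z : R[i] := (expR (Re z))%:C * (cos (Im z) +i* sin (Im z)).

Lemma normc_cexp z : normc (cexp z) = expR (Re z).
Proof.
rewrite normcM normc_real gtr0_norm ?expR_gt0 // /= cos2Dsin2 sqrtr1.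
by rewrite mulr1.
Qed.

Lemma cexpD z w : cexp (z + w) = cexp z * cexp w.
Proof.
case: z => a b; case: w => c d; rewrite /cexp /= expRD cosD sinD.
by apply/eqP; rewrite eq_complex /=; apply/andP; split; apply/eqP; ring.
Qed.

Lemma cexp_2pi z : cexp (z + (0 +i* (pi *+ 2))) = cexp z.
Proof.
rewrite cexpD /cexp /= expR0 cos2pi sin2pi.
by rewrite [(1 +i* 0)%C](_ : _ = 1) ?mulr1.
Qed.

Lemma cexp_cder0 : forall e : R, 0 < e -> exists2 d : R, 0 < d &
    forall h, normc h < d -> normc (cexp h - 1 - h) <= e * normc h.
Proof.
(* The four errors [a1] to [a4] below add up to at most [7 * (e' * n)], hence the [8]. *)
move=> e e0; pose e' := Num.min (e / 8) 1.
have e'0 : 0 < e' by rewrite lt_min ltr01 andbT; lra.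
have e'1 : e' <= 1 by rewrite ge_min lexx orbT.
have e'8 : e' <= e / 8 by rewrite ge_min lexx.
clearbody e'.
have [d1 d10 d1P] := is_derive_dist (is_derive_expR (0 : R)) e'0.
have [d2 d20 d2P] := is_derive_dist (is_derive_cos (0 : R)) e'0.
have [d3 d30 d3P] := is_derive_dist (is_derive_sin (0 : R)) e'0.
(* [n < 1/2] keeps [expR x] at most [2]; [n < e'] controls the second order term in [a4]. *)
pose d4 := Num.min (Num.min d1 d2) (Num.min d3 (Num.min (1/2) e')).
exists d4; first by rewrite !lt_min d10 d20 d30 e'0 /= andbT; lra.
move=> [x y]; set n := normc _ => nd.
have xn : `|x| <= n := normr_Re (x +i* y).
have yn : `|y| <= n := normr_Im (x +i* y).
have n0 : 0 <= n := normc_ge0 _.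
move: nd; rewrite !lt_min => /andP[/andP[n1 n2] /andP[n3 /andP[n4 n5]]].
have := d1P x (le_lt_trans xn n1); have := d2P y (le_lt_trans yn n2).
have := d3P y (le_lt_trans yn n3).
rewrite !add0r expR0 cos0 sin0 !(oppr0, mul0r, mul1r, addr0).
set E := expR x; set c := cos y; set s := sin y => hs hc hE.
have E1 : `|E - 1| <= 2 * n.
  rewrite (_ : E - 1 = E - 1 - x + x); last by ring.
  apply: le_trans (ler_normD _ _) _; nra.
have E2 : `|E| <= 2.
  rewrite (_ : E = E - 1 + 1); last by ring.
  apply: le_trans (ler_normD _ _) _; rewrite normr1; lra.
apply: le_trans (ler_normc_ReIm _) _; rewrite /cexp /= -/E -/c -/s !mul0r !subr0 !addr0.
have -> : E * c - 1 - x = E - 1 - x + E * (c - 1) by ring.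
have -> : E * s - y = E * (s - y) + (E - 1) * y by ring.
have e'n : e' * n <= e / 8 * n by rewrite ler_wpM2r.
have a1 : `|E - 1 - x| <= e' * n by apply: le_trans hE _; rewrite ler_wpM2l // ltW.
have a2 : `|E * (c - 1)| <= 2 * (e' * n).
  rewrite normrM ler_pM //; apply: le_trans hc _; by rewrite ler_wpM2l // ltW.
have a3 : `|E * (s - y)| <= 2 * (e' * n).
  rewrite normrM ler_pM //; apply: le_trans hs _; by rewrite ler_wpM2l // ltW.
have a4 : `|(E - 1) * y| <= 2 * (e' * n).
  rewrite normrM; apply: (@le_trans _ _ (2 * n * n)); first by rewrite ler_pM.
  by rewrite -mulrA ler_wpM2l // ler_wpM2r // ltW.
have en : 0 <= e * n by rewrite mulr_ge0 // ltW.
have := ler_normD (E - 1 - x) (E * (c - 1)); have := ler_normD (E * (s - y)) ((E - 1) * y).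
lra.
Qed.

Lemma cexp_cder z : cder cexp z (cexp z).
Proof.
move=> e e0; have c0 : 0 < normc (cexp z) by rewrite normc_cexp expR_gt0.
have [d d0 dP] := cexp_cder0 (divr_gt0 e0 c0); exists d => // h hd.
rewrite cexpD (_ : _ - _ - _ = cexp z * (cexp h - 1 - h)); last by ring.
by rewrite normcM; have := dP h hd; rewrite mulrAC ler_pdivlMr // mulrC.
Qed.

End complex_exponential.

(** * Means over circles *)

Section mean_value.
Context {R : realType}.

(** The Cauchy-Riemann equations in the form wanted by [closed_form_at]: with [P = Im g] and
    [Q = Re g], the coefficient of [y] in [P] and that of [x] in [Q] are both [Re A]. *)
Lemma affine_ReIm (w w' A : R[i]) (x y a b : R) :
  Re (w - w' - A * (x +i* y - (a +i* b))) = Re w - Re w' - Re A * (x - a) - - Im A * (y - b) /\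
  Im (w - w' - A * (x +i* y - (a +i* b))) = Im w - Im w' - Im A * (x - a) - Re A * (y - b).
Proof. by case: w w' A => ? ? [? ?] [? ?] /=; split; ring. Qed.

(** In the coordinate [z] with [w = c + cexp z], a circle around [c] is a vertical segment of one
    period, and the horizontal sides of a rectangle cancel by periodicity. So the mean of [Re f] is
    the same on every circle; on tiny circles it exceeds [Re (f c) - eta] by continuity at [c]. *)
Lemma mean_value_not_dominated (f : R[i] -> R[i]) (c : R[i]) (rho r eta : R) :
  (forall z, 0 < normc (z - c) < rho -> differentiable f z) ->
  {for c, continuous f} -> 0 < r < rho -> 0 < eta ->
  ~ (forall z, normc (z - c) = r -> Re (f z) <= Re (f c) - eta).
Proof.
move=> df cf /andP[r0 rrho] eta0 dom.
pose X := ln r; pose g z := f (c + cexp z).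
(* [Num.min x X] freezes the integrands beyond the circle of radius [r]: they become continuous for
   every real [x], as [itg] requires, while differentiability is used only relative to [x <= X]. *)
pose pt (x y : R) : R[i] := Num.min x X +i* y.
pose P x y := Im (g (pt x y)); pose Q x y := Re (g (pt x y)).
have expX : expR X = r by rewrite lnK.
have gd z : Re z <= X -> differentiable g z.
  move=> zX; have dc : differentiable (fun z => c + cexp z) z.
    apply: (cder_differentiable (a := cexp z) _).1 => e e0.
    have [d d0 dP] := cexp_cder z e0; exists d => // h /dP.
    by rewrite opprD addrACA subrr add0r.
  apply: (differentiable_comp dc).
  apply: df; rewrite addrC addKr normc_cexp expR_gt0 /=.
  by apply: le_lt_trans rrho; rewrite -expX ler_expR.
have ptX x y : Re (pt x y) <= X by rewrite /= ge_min lexx orbT.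
have gder x y : exists A, cder g (pt x y) A.
  by exists ('d g (pt x y) 1); apply: differentiable_cder (gd _ (ptX x y)).
have lip (x x' y y' : R) : normc (pt x' y' - pt x y) <= `|x' - x| + `|y' - y|.
  apply: le_trans (ler_normc_ReIm _) _; rewrite /= lerD2r.
  have h1 := ler_norm (x' - x); have := ler_norm (x - x'); rewrite distrC => h2.
  by rewrite ler_norml /Num.min; do 2![case: ltP => ?]; lra.
have gc x y (e : R) : 0 < e -> exists2 d : R, 0 < d & forall x' y',
    `|x' - x| + `|y' - y| < d -> normc (g (pt x' y') - g (pt x y)) < e.
  move=> e0; have [A AP] := gder x y.
  have [d d0 dP] := (continuous_nrP _ _).1 (cder_continuous AP) e e0.
  by exists d => // x' y' h; apply: dP; apply: le_lt_trans (lip _ _ _ _) h.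
have cP y : continuous (P^~ y).
  move=> x; apply/continuous_distP => e e0; have [d d0 dP] := gc x y e e0.
  exists d => // x' xd; rewrite /P -raddfB; apply: le_lt_trans (normr_Im _) _.
  by apply: dP; rewrite subrr normr0 addr0.
have cQ x : continuous (Q x).
  move=> y; apply/continuous_distP => e e0; have [d d0 dP] := gc x y e e0.
  exists d => // y' yd; rewrite /Q -raddfB; apply: le_lt_trans (normr_Re _) _.
  by apply: dP; rewrite subrr normr0 add0r.
have [T T0 TP] : exists2 T : R, 0 < T & forall z, cexp (z + (0 +i* T)) = cexp z.
  by exists (pi *+ 2); [rewrite mulrn_wgt0 // pi_gt0|exact: cexp_2pi].
have pi0 := ltW T0.
have itgQ x0 : x0 <= X -> itg (Q X) 0 (T) = itg (Q x0) 0 (T).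
  move=> x0X; have := @goursat _ P Q cP cQ x0 X 0 (T) x0X pi0.
  have -> : contour_integral P Q x0 X 0 (T) =
      itg (Q X) 0 (T) - itg (Q x0) 0 (T).
    rewrite /contour_integral; have -> : P^~ (T) = P^~ 0.
      apply/funext => x; rewrite /P /g.
      have -> : pt x (T) = pt x 0 + (0 +i* (T)).
        by rewrite /pt; apply/eqP; rewrite eq_complex /= addr0 add0r !eqxx.
      by rewrite TP.
    by rewrite [itg _ x0 X + _]addrC addrK.
  move=> h; apply/eqP; rewrite -subr_eq0; apply/eqP/h => a b ab bb.
  have [A AP] := gder a b; exists (Im A), (Re A), (- Im A) => e e0.
  have [d d0 dP] := AP e e0; exists (d / 2); first by rewrite divr_gt0.
  move=> x y [/andP[_ xX] _] xd yd.
  have ptE u v : u <= X -> pt u v = u +i* v by move=> uX; rewrite /pt min_l.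
  have aX : a <= X by case/andP: ab.
  have [ReE ImE] := affine_ReIm (g (pt x y)) (g (pt a b)) A x y a b.
  rewrite /P /Q -ReE -ImE.
  have := lip a x b y; have := dP (pt x y - pt a b).
  rewrite (addrC (pt a b)) subrK !ptE // => {}dP hl.
  have {}dP := dP (le_lt_trans hl _).
  have {}dP := dP ltac:(by rewrite (splitr d) ltrD).
  have el : e * normc (x +i* y - (a +i* b)) <= e * (`|x - a| + `|y - b|) by rewrite ler_pM2l.
  split; [apply: le_trans (normr_Im _) _|apply: le_trans (normr_Re _) _];
    exact: le_trans dP el.
have [d d0 dP] := (continuous_nrP _ _).1 cf (eta / 2) ltac:(lra).
(* The corresponding circle has radius at most [d / 2], where [f] is within [eta / 2] of [f c]. *)
pose x0 := Num.min X (ln (d / 2)).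
have := itgQ x0; rewrite ge_min lexx => /(_ isT).
have up : itg (Q X) 0 (T) <= itg (fun=> Re (f c) - eta) 0 (T).
  apply: le_itg => // [|y _]; first exact: cst_continuous.
  by apply: dom; rewrite addrC addKr normc_cexp /= minxx.
have lo : itg (fun=> Re (f c) - eta / 2) 0 (T) <= itg (Q x0) 0 (T).
  apply: le_itg => // [|y _]; first exact: cst_continuous.
  have : normc (f (c + cexp (pt x0 y)) - f c) < eta / 2.
    apply: dP; rewrite nr_normc addrC addKr normc_cexp /= /x0 min_l ?ge_min ?lexx //.
    have d20 : 0 < d / 2 by lra.
    apply: (@le_lt_trans _ _ (expR (ln (d / 2)))); first by rewrite ler_expR ge_min lexx orbT.
    by rewrite lnK // ltr_pdivrMr // ltr_pMr // ltr1n.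
  move=> h; have := le_lt_trans (normr_Re _) h; rewrite raddfB ltr_norml /Q /g /=; lra.
move=> e; rewrite e in up; move: (le_trans lo up).
rewrite (itg_cst _ pi0) (itg_cst _ pi0) subr0; clear - T0 eta0.
by move: (Re _) => a; nra.
Qed.

End mean_value.

Section compactness.
Context {R : realType}.

Lemma compact_sup_attained (T : topologicalType) (K : set T) (v : T -> R) :
  compact K -> K !=set0 -> {within K, continuous v} ->
  exists2 c, K c & forall z, K z -> v z <= v c.
Proof.
move=> cK [x0 Kx0] cv; have cvK := continuous_compact cv cK.
have vK0 : v @` K !=set0 by exists (v x0), x0.
have bK : has_sup (v @` K).
  split=> //; have [M [_ MP]] := compact_bounded cvK.
  exists (M + 1) => y /MP h; apply: le_trans (ler_norm _) _.
  by apply: h; rewrite ltrDl.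
have clK : closed (v @` K) by apply: compact_closed => //; exact: norm_hausdorff.
have [c Kc cE] : (v @` K) (sup (v @` K)).
  apply: clK => A /nbhs_normP[e /= e0 eP].
  have [y Ky yP] := sup_adherent e0 bK.
  exists y; split=> //; apply: eP; rewrite /= ger0_norm ?subr_ge0 ?ltrBlDr.
    by rewrite -ltrBlDl.
  by apply: ub_le_sup Ky; case: bK.
exists c => // z Kz; rewrite cE; apply: ub_le_sup; [by case: bK|by exists z].
Qed.

Lemma compact_closed_disc (p : R[i]) (r : R) : compact [set z | normc (z - p) <= r].
Proof.
pose f (w : R * R) : R[i] := w.1 +i* w.2.
have cf : continuous f.
  move=> w A /nbhs_nrP[d d0 dP].
  have d20 : 0 < d / 2 by rewrite divr_gt0.
  apply/nbhs_ballP; exists (d / 2) => //= w' [/= h1 h2]; apply: dP.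
  rewrite nr_normc (splitr d); apply: le_lt_trans (ler_normc_ReIm _) _ => /=.
  by apply: ltrD; rewrite distrC.
have cS := compact_setX (@segment_compact R (Re p - r) (Re p + r))
  (@segment_compact R (Im p - r) (Im p + r)).
have cI := continuous_compact (continuous_subspaceT cf) cS.
apply: (subclosed_compact _ cI) => [|z /= zr].
  move=> z zcl; rewrite /= leNgt; apply/negP => rz.
  have [|y [/= yr yz]] := zcl [set y | normc (y - z) < normc (z - p) - r].
    by apply/nbhs_nrP; exists (normc (z - p) - r); rewrite ?subr_gt0.
  have := ler_normc_dist z y p; rewrite (normcBC z y).
  by move: yr yz; set a := normc _; set b := normc _; set c := normc _; lra.
exists (Re z, Im z); last by case: z {zr}.
have := normr_Re (z - p); have := normr_Im (z - p); rewrite !raddfB /=.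
move=> /le_trans/(_ zr) h1 /le_trans/(_ zr) h2.
split; rewrite /= in_itv /=.
  by move: h2; rewrite ler_norml; lra.
by move: h1; rewrite ler_norml; lra.
Qed.

End compactness.

Section max_principle.
Context {R : realType}.

Lemma cder_affine (q : R[i] -> R[i]) (a b c z A : R[i]) : cder q z A ->
  cder (fun z => a * q z + b * (z - c)) z (a * A + b).
Proof.
move=> qA e e0; have a1 : 0 < normc a + 1 by rewrite ltr_wpDl ?normc_ge0.
have [d d0 dP] := qA _ (divr_gt0 e0 a1); exists d => // h /dP hd.
have -> : a * q (z + h) + b * (z + h - c) - (a * q z + b * (z - c)) - (a * A + b) * h =
  a * (q (z + h) - q z - A * h) by ring.
rewrite normcM mulrAC ler_pdivlMr // in hd *; apply: le_trans hd.
by rewrite mulrC ler_wpM2l ?normc_ge0 // lerDl.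
Qed.

Lemma continuous_affine_comb (q : R[i] -> R[i]) (a b c z : R[i]) :
  {for z, continuous q} -> {for z, continuous (fun z => a * q z + b * (z - c))}.
Proof.
move=> cq; apply/continuous_nrP => e e0.
have a1 : 0 < normc a + 1 by rewrite ltr_wpDl ?normc_ge0.
have b1 : 0 < normc b + 1 by rewrite ltr_wpDl ?normc_ge0.
have e20 : 0 < e / 2 by rewrite divr_gt0.
have [d d0 dP] := (continuous_nrP _ _).1 cq _ (divr_gt0 e20 a1).
have d'0 : 0 < e / 2 / (normc b + 1) by rewrite divr_gt0.
exists (Num.min d (e / 2 / (normc b + 1))); first by rewrite lt_min d0.
move=> w; rewrite lt_min => /andP[/dP qd bd]; rewrite !nr_normc in qd bd *.
have -> : a * q w + b * (w - c) - (a * q z + b * (z - c)) =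
  a * (q w - q z) + b * (w - z) by ring.
apply: le_lt_trans (ler_normcD _ _) _; rewrite !normcM (splitr e); apply: ltrD.
  apply: (@le_lt_trans _ _ ((normc a + 1) * normc (q w - q z))).
    by rewrite ler_wpM2r ?normc_ge0 // lerDl.
  by rewrite mulrC -ltr_pdivlMr.
apply: (@le_lt_trans _ _ ((normc b + 1) * normc (w - z))).
  by rewrite ler_wpM2r ?normc_ge0 // lerDl.
by rewrite mulrC -ltr_pdivlMr.
Qed.

Lemma Re_continuous : continuous (@complex.Re R).
Proof.
move=> z A /nbhs_normP[e /= e0 eP]; apply/nbhs_nrP; exists e => // w wz.
apply: eP; rewrite /= distrC -raddfB; exact: le_lt_trans (normr_Re _) wz.
Qed.

Lemma nr_continuous (V : normedModType R[i]) : continuous (@nr R V).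
Proof.
move=> z A /nbhs_normP[e /= e0 eP]; apply/nbhs_nrP; exists e => // w wz.
apply: eP; apply: le_lt_trans wz; rewrite /= ler_norml.
by have := lerB_nr z w; have := lerB_nr w z; rewrite (nrBC w z); lra.
Qed.

Lemma Re_realM (a : R) (z : R[i]) : Re (a%:C * z) = a * Re z.
Proof. by case: z => x y /=; rewrite mul0r subr0. Qed.

(** The law of cosines, written so that the cross term is the real part of a function holomorphic in
    [z]; [max_principle] can then absorb a quadratic perturbation. *)
Lemma normc2_dist (z c p : R[i]) :
  normc (z - p) ^+ 2 = normc (c - p) ^+ 2 + normc (z - c) ^+ 2 +
    2 * Re ((c - p)^* * (z - c)).
Proof.
case: z c p => ? ? [? ?] [? ?] /=; rewrite !sqr_sqrtr ?addr_ge0 ?sqr_ge0 //.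
ring.
Qed.

(* [q] need only be differentiable on a punctured neighbourhood of each point,
   so that quotients [(f z - f a) / (z - a)] are covered. *)
Lemma max_principle (q : R[i] -> R[i]) (p : R[i]) (r M : R) :
  (forall c, normc (c - p) <= r -> {for c, continuous q}) ->
  (forall c, normc (c - p) < r -> exists2 d, 0 < d &
     forall z, 0 < normc (z - c) < d -> differentiable q z) ->
  (forall z, normc (z - p) = r -> normc (q z) <= M) ->
  forall z, normc (z - p) <= r -> normc (q z) <= M.
Proof.
move=> cq dq bd z0 z0r.
have r0 : 0 <= r := le_trans (normc_ge0 _) z0r.
have [q0|q0] := eqVneq (q z0) 0.
  rewrite q0 -nr_normc nr0.
  have : normc (p + r%:C - p) = r by rewrite addrC addKr normc_real ger0_norm.
  by move=> /bd; apply: le_trans; exact: normc_ge0.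
(* A factor of modulus one that turns [q z0] into the positive number [normc (q z0)], so that only a
   real part has to be bounded. *)
pose lam := (q z0)^* / (normc (q z0))%:C.
have nq0 : 0 < normc (q z0) by rewrite normc_gt0.
have lam1 : normc lam = 1.
  rewrite normcM normcV normc_real ger0_norm ?normc_ge0 //.
  have -> : normc (q z0)^* = normc (q z0) by apply: complexI; exact: normcJ.
  by rewrite mulfV ?gt_eqF.
have lamq : Re (lam * q z0) = normc (q z0).
  have n0 : (normc (q z0))%:C != 0 by rewrite (inj_eq (@complexI R)) gt_eqF.
  suff -> : lam * q z0 = (normc (q z0))%:C by [].
  by rewrite /lam mulrAC [_^* * _]mulrC -sqr_normc expr2 mulfK.
apply/ler_addgt0Pr => e e0.
pose eps := e / (r ^+ 2 + 1).
have r20 : 0 < r ^+ 2 + 1 by rewrite ltr_wpDl ?sqr_ge0.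
have eps0 : 0 < eps by rewrite divr_gt0.
have epsr : eps * r ^+ 2 <= e.
  by rewrite /eps mulrAC ler_pdivrMr // ler_pM2l // lerDl.
(* The [eps] term rules out a maximum inside the disc and costs at most [e] on the boundary. *)
pose v z := Re (lam * q z) + eps * normc (z - p) ^+ 2.
have cv z : normc (z - p) <= r -> {for z, continuous v}.
  move=> /cq cqz; apply: (@continuousD _ R _ (fun z => Re (lam * q z))
     (fun z => eps * normc (z - p) ^+ 2)).
    apply: (@continuous_comp _ _ _ (fun z => lam * q z) (@complex.Re R)).
      have -> : (fun z => lam * q z) = (fun z => lam * q z + 0 * (z - 0)).
        by apply/funext => w; rewrite mul0r addr0.
      exact: continuous_affine_comb.
    exact: Re_continuous.
  apply: (@continuousM _ _ (cst eps) (fun z => normc (z - p) ^+ 2)).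
    exact: cst_continuous.
  have cn : {for z, continuous (fun z => normc (z - p))}.
    apply: (@continuous_comp _ _ _ (fun z => z - p) (@normc R)).
      have -> : (fun z => z - p) = (fun z => 0 * q z + 1 * (z - p)).
        by apply/funext => w; rewrite mul0r add0r mul1r.
      exact: continuous_affine_comb.
    exact: (nr_continuous (V := R[i])).
  exact: (@continuousM _ _ (fun z => normc (z - p)) (fun z => normc (z - p))).
have [c /= cr cmax] : exists2 c, normc (c - p) <= r & forall z, normc (z - p) <= r -> v z <= v c.
  apply: (@compact_sup_attained _ _ [set z | normc (z - p) <= r]).
  - exact: compact_closed_disc.
  - by exists z0.
  - apply: continuous_in_subspaceT => z; rewrite inE /= => zr.
    exact: cv.
have v0 : normc (q z0) <= v z0 by rewrite /v lamq lerDl mulr_ge0 ?sqr_ge0 // ltW.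
apply: (le_trans v0); apply: (le_trans (cmax _ z0r)).
have := cr; rewrite le_eqVlt => /predU1P[cE|cltr].
  rewrite /v cE lerD //; apply: le_trans (ler_norm _) _.
  apply: le_trans (normr_Re _) _; rewrite normcM lam1 mul1r; exact: bd.
exfalso.
have [d d0 dP] := dq c cltr.
pose r1 := Num.min (d / 2) (r - normc (c - p)).
have r10 : 0 < r1 by rewrite lt_min divr_gt0 // subr_gt0.
have r1d : r1 < d by rewrite gt_min ltr_pdivrMr // ltr_pMr // ltr1n.
have r1r : normc (c - p) + r1 <= r by rewrite -lerBrDl ge_min lexx orbT.
(* By [normc2_dist], [v - eps * normc (c - p) ^+ 2] equals [Re Q] at [c] and [Re Q + eps * r1 ^+ 2]
   on the circle of radius [r1]. Maximality of [v c] thus makes [Re Q] drop by [eps * r1 ^+ 2] on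
   the whole circle. *)
pose Q z := lam * q z + (eps *+ 2)%:C * (c - p)^* * (z - c).
apply: (@mean_value_not_dominated _ Q c d r1 (eps * r1 ^+ 2)).
- move=> z /dP /differentiable_cder dqz.
  exact: (cder_differentiable (@cder_affine q lam _ c _ _ dqz)).1.
- exact: continuous_affine_comb (cq _ cr).
- by rewrite r10.
- by rewrite mulr_gt0 // exprn_gt0.
move=> z zr1; have zr : normc (z - p) <= r.
  apply: le_trans (ler_normc_dist z c p) _; rewrite zr1 addrC; exact: r1r.
have := cmax z zr; rewrite /v /Q subrr mulr0 addr0 raddfD /=.
have -> : normc (z - p) ^+ 2 = normc (c - p) ^+ 2 + r1 ^+ 2 +
    2 * Re ((c - p)^* * (z - c)).
  by rewrite -zr1; exact: normc2_dist.
have -> : Re ((eps *+ 2)%:C * (c - p)^* * (z - c)) = 2 * eps * Re ((c - p)^* * (z - c)).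
  by rewrite -mulrA Re_realM -mulr_natl.
set a := Re _; set b := Re _; set k := Re _; set l := _ ^+ 2; set m := _ ^+ 2.
lra.
Qed.

End max_principle.

(** * Cauchy estimates and Weierstrass' theorem *)

Lemma subrACA (V : zmodType) (a b c d : V) : a - b - (c - d) = a - c - (b - d).
Proof. by rewrite !opprB addrACA [RHS]addrACA (addrC (- b)). Qed.

Section linear_bounds.
Context {R : realType}.
Implicit Types (V W : normedModType R[i]).

Lemma bounded_linear_differentiable V W (f L : V -> W) (x : V) (C : R) :
  linear L -> (forall v, nr (L v) <= C * nr v) ->
  (forall e : R, 0 < e -> exists2 d : R, 0 < d &
    forall h, nr h < d -> nr (f (x + h) - f x - L h) <= e * nr h) ->
  differentiable f x /\ forall v, 'd f x v = L v.
Proof.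
move=> linL bL fL; pose lL := GRing.isLinear.Build _ _ _ _ L linL.
pose L' : {linear V -> W} := HB.pack L lL.
have cL : continuous L'.
  move=> u; apply/continuous_nrP => e e0.
  have C1 : 0 < `|C| + 1 by rewrite ltr_wpDl.
  exists (e / (`|C| + 1)); first by rewrite divr_gt0.
  move=> w wd; rewrite -linearB /=; apply: le_lt_trans (bL _) _.
  rewrite ltr_pdivlMr // mulrC in wd; apply: le_lt_trans wd.
  by rewrite ler_wpM2r ?nr_ge0 //; have := ler_norm C; lra.
have [df dE] := @nrP_differentiable _ _ _ f x L' cL fL.
by split=> // v; rewrite dE.
Qed.

Lemma diff_linear V W (f : V -> W) x : linear ('d f x).
Proof. by move=> a u v; rewrite linearP. Qed.

(** By homogeneity the bound is tested on a small multiple of [v], where the remainder is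
    negligible. *)
Lemma diff_nr_le V W (f : V -> W) (x : V) (C : R) : 0 <= C -> differentiable f x ->
  (exists2 d : R, 0 < d & forall h, nr h < d -> nr (f (x + h) - f x) <= C * nr h) ->
  forall v, nr ('d f x v) <= C * nr v.
Proof.
move=> C0 df [d d0 dP] v; have [->|v0] := eqVneq v 0.
  by rewrite linear0 !nr0 mulr0.
have nv : 0 < nr v by rewrite nr_gt0.
suff H e : 0 < e -> nr ('d f x v) <= C * nr v + e * nr v.
  apply/ler_addgt0Pr => e e0; have := H _ (divr_gt0 e0 nv).
  by rewrite divfK // gt_eqF.
move=> e0; have [d1 d10 d1P] := differentiable_nrP df e0.
pose t := Num.min d d1 / 2 / nr v.
have m0 : 0 < Num.min d d1 by rewrite lt_min d0.
have t0 : 0 < t by rewrite !divr_gt0.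
have tv : nr (t%:C *: v) = Num.min d d1 / 2.
  by rewrite nrZ normc_real gtr0_norm // /t divfK // gt_eqF.
have tvm : nr (t%:C *: v) < Num.min d d1.
  by rewrite tv ltr_pdivrMr // ltr_pMr // ltr1n.
have [h1 h2] : nr (t%:C *: v) < d /\ nr (t%:C *: v) < d1.
  by move: tvm; rewrite lt_min => /andP.
have := dP _ h1; have := d1P _ h2; rewrite linearZ.
set D := 'd f x v; set X := f _ - f _ => l1 l2.
have : nr (t%:C *: D) <= C * nr (t%:C *: v) + e * nr (t%:C *: v).
  have -> : t%:C *: D = X - (X - t%:C *: D) by rewrite opprB addrC subrK.
  apply: le_trans (ler_nrB _ _) _; exact: lerD.
rewrite !nrZ normc_real gtr0_norm // !(mulrCA _ t) -mulrDr ler_pM2l //.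
Qed.

Lemma diff_bounded V W (f : V -> W) (x : V) : differentiable f x ->
  exists2 C : R, 0 < C & forall v, nr ('d f x v) <= C * nr v.
Proof.
move=> df; have [cf _] := (diff_locallyP x f).1 df.
have /continuous_nrP := cf 0; move=> /(_ 1 ltr01)[d d0 dP].
exists (2 / d); first by rewrite divr_gt0.
move=> v; have [->|v0] := eqVneq v 0; first by rewrite linear0 !nr0 mulr0.
have nv : 0 < nr v by rewrite nr_gt0.
have t0 : 0 < d / 2 / nr v by rewrite !divr_gt0.
have := dP ((d / 2 / nr v)%:C *: v); rewrite subr0 => h.
move: h; rewrite (linear0 ('d f x)) subr0 linearZ !nrZ.
rewrite normc_real gtr0_norm // divfK ?gt_eqF // ltr_pdivrMr // ltr_pMr // ltr1n.
move=> /(_ isT) /ltW; rewrite -ler_pdivlMl // mulr1 !invfM invrK => h.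
by apply: le_trans h _; rewrite invrK (mulrC _ 2).
Qed.

Lemma differentiable_line V W (f : V -> W) (x v : V) (t : R[i]) :
  differentiable f (x + t *: v) ->
  differentiable (fun s : R[i] => f (x + s *: v)) t /\
  'd (fun s : R[i] => f (x + s *: v)) t 1 = 'd f (x + t *: v) v.
Proof.
move=> df; have [C C0 CP] := diff_bounded df.
have v1 : 0 < nr v + 1 by rewrite ltr_wpDl ?nr_ge0.
have [] := @bounded_linear_differentiable R[i] W (fun s => f (x + s *: v))
    (fun s => s *: 'd f (x + t *: v) v) t (C * nr v).
- by move=> a s s'; rewrite scalerDl scalerA.
- by move=> s; rewrite nrZ mulrC nr_normc ler_wpM2r ?CP // normc_ge0.
- move=> e e0; have [d d0 dP] := differentiable_nrP df (divr_gt0 e0 v1).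
  exists (d / (nr v + 1)); first by rewrite divr_gt0.
  move=> h; rewrite ltr_pdivlMr // nr_normc => hd.
  have hv : nr (h *: v) <= normc h * (nr v + 1).
    by rewrite nrZ ler_wpM2l ?normc_ge0 // lerDl.
  have := dP (h *: v) (le_lt_trans hv hd).
  rewrite scalerDl addrA linearZ => h1; apply: le_trans h1 _.
  by rewrite mulrAC ler_pdivrMr // -mulrA ler_pM2l.
by move=> ? ->; rewrite scale1r.
Qed.

Lemma differentiable_mulc V (f g : V -> R[i]) x :
  differentiable f x -> differentiable g x ->
  differentiable (fun z => f z * g z) x.
Proof. by move=> df dg; exact: (@differentiableM R[i] V f g x df dg). Qed.

Lemma differentiable_invc V (f : V -> R[i]) x :
  differentiable f x -> f x != 0 -> differentiable (fun z => (f z)^-1) x.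
Proof. by move=> df f0; exact: (@differentiableV R[i] V f x df f0). Qed.

Lemma differentiable_addv V W (f g : V -> W) x :
  differentiable f x -> differentiable g x ->
  differentiable (fun z => f z + g z) x.
Proof. by move=> df dg; exact: (differentiableD df dg). Qed.

Lemma differentiable_subv V W (f g : V -> W) x :
  differentiable f x -> differentiable g x ->
  differentiable (fun z => f z - g z) x.
Proof. by move=> df dg; exact: (differentiableB df dg). Qed.

Lemma diff_subv V W (f g : V -> W) x v :
  differentiable f x -> differentiable g x ->
  'd (fun z => f z - g z) x v = 'd f x v - 'd g x v.
Proof.
move=> df dg; have [C C0 CP] := diff_bounded df; have [D D0 DP] := diff_bounded dg.
have key (A B : V -> W) : linear A -> linear B ->
    (forall v, nr (A v) <= C * nr v) -> (forall v, nr (B v) <= D * nr v) ->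
    (forall e : R, 0 < e -> exists2 d : R, 0 < d &
      forall h, nr h < d -> nr (f (x + h) - f x - A h) <= e * nr h) ->
    (forall e : R, 0 < e -> exists2 d : R, 0 < d &
      forall h, nr h < d -> nr (g (x + h) - g x - B h) <= e * nr h) ->
    'd (fun z => f z - g z) x v = A v - B v.
  move=> lA lB bA bB fA gB.
  apply: (@bounded_linear_differentiable _ _ _ (fun v => A v - B v) x (C + D) _ _ _).2.
  - by move=> a u w; rewrite lA lB scalerBr opprD addrACA.
  - by move=> w; rewrite mulrDl; apply: le_trans (ler_nrB _ _) _; exact: lerD.
  - move=> e e0; have e20 : 0 < e / 2 by rewrite divr_gt0.
    have [d d0 dP] := fA _ e20; have [d' d'0 d'P] := gB _ e20.
    exists (Num.min d d'); first by rewrite lt_min d0.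
    move=> h; rewrite lt_min => /andP[/dP h1 /d'P h2].
    have -> : f (x + h) - g (x + h) - (f x - g x) - (A h - B h) =
      (f (x + h) - f x - A h) - (g (x + h) - g x - B h).
      by rewrite [in RHS]subrACA (subrACA (f (x + h))).
    apply: le_trans (ler_nrB _ _) _.
    by have -> : e * nr h = e / 2 * nr h + e / 2 * nr h; [field|exact: lerD].
exact: (key _ _ (diff_linear f x) (diff_linear g x) CP DP
  (differentiable_nrP df) (differentiable_nrP dg)).
Qed.

Lemma diff_subv_nr_le V W (f g : V -> W) (x : V) (C : R) : 0 <= C ->
  differentiable f x -> differentiable g x ->
  (exists2 d : R, 0 < d & forall h, nr h < d ->
     nr (f (x + h) - g (x + h) - (f x - g x)) <= C * nr h) ->
  forall v, nr ('d f x v - 'd g x v) <= C * nr v.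
Proof.
move=> C0 df dg h v; rewrite -(diff_subv v df dg).
exact: (diff_nr_le C0 (differentiable_subv df dg) h).
Qed.

Lemma differentiable_cstv V W (a : W) (x : V) : differentiable (fun=> a) x.
Proof. exact: differentiable_cst. Qed.

Lemma differentiable_idv V (x : V) : differentiable (fun z => z) x.
Proof. exact: ex_diff. Qed.

End linear_bounds.

Section cauchy_estimates.
Context {R : realType}.

(** Schwarz's argument: the quotient [(f z - f p) / (z - p)], completed by the derivative at [p], is
    at most [2 * M / r] on the circle of radius [r], hence inside by the maximum principle. *)
Lemma schwarz_estimate (f : R[i] -> R[i]) (p z : R[i]) (r rho M : R) :
  (forall z, normc (z - p) < rho -> differentiable f z) ->
  (forall z, normc (z - p) < rho -> normc (f z) <= M) ->
  normc (z - p) <= r -> 0 < r < rho ->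
  r * normc (f z - f p) <= 2 * M * normc (z - p).
Proof.
move=> df bf zr /andP[r0 rrho].
pose q w := if w == p then 'd f p 1 else (f w - f p) / (w - p).
have p0 : normc (p - p) < rho by rewrite subrr -nr_normc nr0 (lt_trans r0).
have dq w : normc (w - p) < rho -> w != p -> differentiable q w.
  move=> wr wp; apply: (@near_eq_differentiable _ _ _ (fun w => (f w - f p) / (w - p))).
    apply/nbhs_nrP; exists (normc (w - p)); first by rewrite normc_gt0 subr_eq0.
    move=> y; rewrite nr_normc /q; have [->|//] := eqVneq y p.
    by rewrite normcBC ltxx.
  have wp0 : w - p != 0 by rewrite subr_eq0.
  apply: differentiable_mulc.
    by apply: differentiable_subv; [exact: df|exact: differentiable_cstv].
  apply: differentiable_invc => //.
have cq w : normc (w - p) < rho -> {for w, continuous q}.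
  move=> wr; have [->|wp] := eqVneq w p; last first.
    exact: differentiable_continuous (dq w wr wp).
  apply/continuous_nrP => e e0; have e20 : 0 < e / 2 by rewrite divr_gt0.
  have [d d0 dP] := differentiable_cder (df p p0) e20.
  exists d => // y yd; rewrite nr_normc /q eqxx.
  have [_|yp] := eqVneq y p; first by rewrite subrr -nr_normc nr0.
  have yp0 : 0 < normc (y - p) by rewrite normc_gt0 subr_eq0.
  have := dP (y - p) yd; rewrite (addrC p) subrK.
  have -> : (f y - f p) / (y - p) - 'd f p 1 = (f y - f p - 'd f p 1 * (y - p)) / (y - p).
    by rewrite [in RHS]mulrBl mulfK // subr_eq0.
  rewrite normcM normcV => h; rewrite ltr_pdivrMr //; apply: le_lt_trans h _.
  by rewrite ltr_pM2r // ltr_pdivrMr // ltr_pMr // ltr1n.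
have := @max_principle _ q p r (2 * M / r) (fun c cr => cq c (le_lt_trans cr rrho)).
have [->|zp] := eqVneq z p.
  by move=> _; rewrite !subrr -!nr_normc nr0 !mulr0.
move=> /(_ _ _ z zr)-H.
have : normc (q z) <= 2 * M / r.
  apply: H.
  - move=> c cr; have [->|cp] := eqVneq c p.
      exists rho; first exact: lt_trans rrho.
      move=> w /andP[w0 wr]; apply: dq => //.
      by rewrite -subr_eq0 -normc_gt0.
    exists (Num.min (rho - normc (c - p)) (normc (c - p))).
      by rewrite lt_min subr_gt0 (lt_trans cr rrho) normc_gt0 subr_eq0.
    move=> w; rewrite lt_min => /and3P[w0 w1 w2]; apply: dq.
      apply: le_lt_trans (ler_normc_dist w c p) _; rewrite -ltrBrDr //.
    by apply: contraTneq w2 => ->; rewrite normcBC ltxx.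
  - move=> w wr; rewrite /q; have [wp|wp] := eqVneq w p.
      by move: wr r0; rewrite wp subrr -nr_normc nr0 => <-; rewrite ltxx.
    rewrite normcM normcV wr ler_pM2r ?invr_gt0 // mulr_natl mulr2n.
    apply: le_trans (ler_normcB _ _) _; apply: lerD; apply: bf => //.
    by rewrite wr.
rewrite /q (negbTE zp) normcM normcV ler_pdivlMr // mulrAC ler_pdivrMr ?normc_gt0 ?subr_eq0 //.
by rewrite mulrC.
Qed.

(** The substitute for Cauchy's estimate. If [x] and [y] are at distance at most [rho / 4],
    [schwarz_estimate] applies on the complex line through them, with [r] corresponding to
    [rho / 4]; otherwise the trivial bound [2 * M] suffices. Both cases give the factor [8]. *)
Lemma hol_lipschitz (V : normedModType R[i]) (f : V -> R[i]) (p : V) (rho M : R) :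
  (forall z, nr (z - p) < rho -> differentiable f z) ->
  (forall z, nr (z - p) < rho -> normc (f z) <= M) ->
  forall x y, nr (x - p) < rho / 2 -> nr (y - p) < rho / 2 ->
  rho * normc (f y - f x) <= 8 * M * nr (y - x).
Proof.
move=> df bf x y xp yp.
have rho0 : 0 < rho by have := nr_ge0 (x - p); lra.
have [->|xy] := eqVneq y x; first by rewrite !subrr -nr_normc !nr0 !mulr0.
set v := y - x; have v0 : 0 < nr v by rewrite nr_gt0 subr_eq0.
have M0 : 0 <= M by apply: le_trans (normc_ge0 _) (bf x _); lra.
have [vle|vgt] := leP (nr v) (rho / 4); last first.
  have h : normc (f y - f x) <= 2 * M.
    apply: le_trans (ler_normcB _ _) _; rewrite mulr_natl mulr2n lerD // bf //; lra.
  have : rho * normc (f y - f x) <= rho * (2 * M) by rewrite ler_pM2l.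
  have : M * (rho / 4) <= M * nr v by rewrite ler_wpM2l // ltW.
  lra.
pose rho1 := rho / 2 / nr v.
have h t : normc (t - 0) < rho1 -> nr (x + t *: v - p) < rho.
  rewrite subr0 ltr_pdivlMr // -nrZ => tv.
  rewrite addrAC; apply: le_lt_trans (ler_nrD _ _) _; lra.
have r1 : 0 < rho / 4 / nr v < rho1.
  by rewrite !divr_gt0 // /rho1 ltr_pM2r ?invr_gt0 //; lra.
have r2 : normc (1 - 0) <= rho / 4 / nr v.
  by rewrite subr0 Normc.normc1 ler_pdivlMr // mul1r.
have := @schwarz_estimate (fun t => f (x + t *: v)) 0 1 (rho / 4 / nr v) rho1 M
  (fun t tr => (differentiable_line (df _ (h t tr))).1) (fun t tr => bf _ (h t tr)) r2 r1.
rewrite scale0r scale1r addr0 (addrC x) subrK subr0 Normc.normc1 mulr1.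
rewrite mulrAC ler_pdivrMr //; lra.
Qed.

End cauchy_estimates.

Section row_vectors.
Context {R : realType} {n : nat}.
Implicit Types (V W : normedModType R[i]) (u w : 'rV[R[i]]_n).

Lemma nr_coord u j : normc (u 0 j) <= nr u.
Proof.
rewrite -nr_normc -lecR -!nrE [X in _ <= X]mx_normE.
rewrite -[X in X <= _]nngE num_le.
exact: (@le_bigmax _ _ _ _ (fun i : 'I_1 * 'I_n => `|u i.1 i.2|%:nng) (ord0, j)).
Qed.

Lemma nr_rV_le u (B : R) : 0 <= B -> (forall j, normc (u 0 j) <= B) -> nr u <= B.
Proof.
move=> B0 h; have [u0|u0] := eqVneq u 0; first by rewrite u0 nr0.
have [|[i j] uE] := @mx_norm_neq0 _ _ _ u.
  by apply: contra_neq u0; exact: mx_norm_eq0.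
have -> : nr u = normc (u i j) by apply: complexI; rewrite -nrE; exact: uE.
by rewrite ord1.
Qed.

Lemma differentiable_coordv V (f : V -> 'rV[R[i]]_n) x j :
  differentiable f x ->
  differentiable (fun z => f z 0 j) x /\
  forall v, 'd (fun z => f z 0 j) x v = 'd f x v 0 j.
Proof.
move=> df; have [C C0 CP] := diff_bounded df.
apply: (@bounded_linear_differentiable _ _ _ _ (fun v => 'd f x v 0 j) x C).
- by move=> a u v; rewrite linearP !mxE.
- by move=> v; rewrite nr_normc; apply: le_trans (CP v); exact: nr_coord.
- move=> e e0; have [d d0 dP] := differentiable_nrP df e0; exists d => // h /dP.
  by apply: le_trans; have := nr_coord (f (x + h) - f x - 'd f x h) j; rewrite !mxE.
Qed.

Lemma differentiable_rV V (f : V -> 'rV[R[i]]_n) x :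
  (forall j, differentiable (fun z => f z 0 j) x) -> differentiable f x.
Proof.
move=> df; have dfC j : exists2 C : R, 0 <= C & forall v, nr ('d (fun z => f z 0 j) x v) <= C * nr v.
  by have [C C0 CP] := diff_bounded (df j); exists C; first exact: ltW.
pose C j := sval (cid2 (dfC j)).
have [C0 CP] : (forall j, 0 <= C j) /\ forall j v, nr ('d (fun z => f z 0 j) x v) <= C j * nr v.
  by split=> j; rewrite /C; case: cid2.
apply: (@bounded_linear_differentiable _ _ _ _
  (fun v => \row_j 'd (fun z => f z 0 j) x v) x (\sum_j C j) _ _ _).1.
- by move=> a u v; apply/rowP => j; rewrite !mxE linearP.
- move=> v; apply: nr_rV_le => [|j].
    by rewrite mulr_ge0 ?nr_ge0 // sumr_ge0.
  rewrite mxE; apply: le_trans (CP j v) _; rewrite ler_wpM2r ?nr_ge0 //.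
  by rewrite (bigD1 j) //= lerDl sumr_ge0.
- move=> e e0.
  have dP j : exists d : R, 0 < d /\ forall h, nr h < d ->
     normc (f (x + h) 0 j - f x 0 j - 'd (fun z => f z 0 j) x h) <= e * nr h.
    by have [d d0 dP] := differentiable_nrP (df j) e0; exists d.
  have [d [d0 dd]] : exists d : R, 0 < d /\ forall j h, nr h < d ->
     normc (f (x + h) 0 j - f x 0 j - 'd (fun z => f z 0 j) x h) <= e * nr h.
    pose d j := sval (cid (dP j)); exists (\big[Num.min/1]_j d j); split.
      by apply: lt_bigmin => // j _; rewrite /d; case: cid => ? [].
    move=> j h hd; have : nr h < d j by apply: lt_le_trans hd _; exact: bigmin_le_cond.
    by rewrite /d; case: cid => ? [_ +] /= => /[apply].
  exists d => // h hd; apply: nr_rV_le => [|j]; first by rewrite mulr_ge0 ?nr_ge0 // ltW.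
  by rewrite !mxE; exact: dd.
Qed.

End row_vectors.

Section weierstrass.
Context {R : realType}.

Lemma complex_cauchy_cvg (u : nat -> R[i]) :
  (forall e : R, 0 < e -> exists n0, forall n m, (n0 <= n)%N -> (n0 <= m)%N ->
     normc (u n - u m) <= e) ->
  exists l, forall e : R, 0 < e -> exists n0, forall n, (n0 <= n)%N ->
     normc (u n - l) <= e.
Proof.
move=> cu.
have rc (v : nat -> R) : (forall n m, `|v n - v m| <= normc (u n - u m)) ->
    exists l : R, forall e : R, 0 < e -> exists n0, forall n, (n0 <= n)%N -> `|v n - l| <= e.
  move=> vu.
  have : cauchy (v @ \oo).
    apply/cauchy_exP => e e0.
    have [n0 n0P] := cu (e / 2) (divr_gt0 e0 (ltr0n _ 2)).
    exists (v n0); exists n0 => // n /= nn; rewrite /ball /=.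
    apply: le_lt_trans (vu _ _) _; apply: le_lt_trans (n0P _ _ (leqnn _) nn) _.
    by rewrite ltr_pdivrMr // ltr_pMr // ltr1n.
  move=> /cauchy_cvgP /cvg_ex[l lP]; exists l => e e0.
  have /lP [n0 _ n0P] : nbhs l [set y | `|y - l| <= e].
    by apply/nbhs_normP; exists e => //= y /ltW; rewrite distrC.
  by exists n0 => n nn0; apply: n0P.
have [|a aP] := rc (fun n => Re (u n)).
  by move=> n m; rewrite -raddfB; exact: normr_Re.
have [|b bP] := rc (fun n => Im (u n)).
  by move=> n m; rewrite -raddfB; exact: normr_Im.
exists (a +i* b) => e e0.
have [n1 n1P] := aP (e / 2) (divr_gt0 e0 (ltr0n _ 2)).
have [n2 n2P] := bP (e / 2) (divr_gt0 e0 (ltr0n _ 2)).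
exists (maxn n1 n2) => n; rewrite geq_max => /andP[/n1P h1 /n2P h2].
apply: le_trans (ler_normc_ReIm _) _; rewrite (splitr e).
by move: h1 h2; case: (u n) => x y /= h1 h2; exact: lerD.
Qed.

(** [hol_lipschitz] for the differences [F k - F n] turns uniform closeness into closeness of
    increments relative to [nr h]. The differentials at [p] are therefore Cauchy, and their limit
    [A] is the differential of [f]. *)
Lemma weierstrass (V : normedModType R[i]) (F : nat -> V -> R[i]) (f : V -> R[i])
    (p : V) (rho : R) : 0 < rho ->
  (forall n z, nr (z - p) < rho -> differentiable (F n) z) ->
  (forall e : R, 0 < e -> exists n0, forall n, (n0 <= n)%N ->
     forall z, nr (z - p) < rho -> normc (F n z - f z) <= e) ->
  differentiable f p.
Proof.
move=> rho0 dF Ff.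
have rho20 : 0 < rho / 2 by rewrite divr_gt0.
have pp : nr (p - p) < rho / 2 by rewrite subrr nr0.
have cF e : 0 < e -> exists n0, forall n k, (n0 <= n)%N -> (n0 <= k)%N ->
    forall z, nr (z - p) < rho -> normc (F k z - F n z) <= e.
  move=> e0; have [n0 n0P] := Ff (e / 2) (divr_gt0 e0 (ltr0n _ 2)).
  exists n0 => n k nn kn z zr; apply: le_trans (ler_normc_dist _ (f z) _) _.
  by rewrite (splitr e) lerD // ?(normcBC (f z)) n0P.
have lipF e : 0 < e -> exists n0, forall n k, (n0 <= n)%N -> (n0 <= k)%N ->
    forall h, nr h < rho / 2 ->
    normc (F k (p + h) - F n (p + h) - (F k p - F n p)) <= e * nr h.
  move=> e0; have er : 0 < e * rho / 8 by rewrite !mulr_gt0.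
  have [n0 n0P] := cF _ er; exists n0 => n k nn kn h hr.
  have := @hol_lipschitz R V (fun z => F k z - F n z) p rho _
    (fun z zr => differentiable_subv (dF k z zr) (dF n z zr)) (n0P n k nn kn) p (p + h) pp.
  rewrite (addrC p) addrK => /(_ hr); rewrite (addrC h).
  by rewrite (_ : 8 * (e * rho / 8) * nr h = rho * (e * nr h)) ?ler_pM2l //; field.
have lipf e : 0 < e -> exists n0, forall n, (n0 <= n)%N -> forall h, nr h < rho / 2 ->
    normc (f (p + h) - F n (p + h) - (f p - F n p)) <= e * nr h.
  move=> e0; have [n0 n0P] := lipF e e0; exists n0 => n nn h hr.
  apply/ler_addgt0Pr => e' e'0.
  have [n1 n1P] := Ff (e' / 2) (divr_gt0 e'0 (ltr0n _ 2)).
  pose k := maxn n0 n1.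
  have h0 := n0P n k nn (leq_maxl _ _) h hr.
  have h1 : normc (F k p - f p) <= e' / 2.
    by apply: n1P; [exact: leq_maxr|rewrite subrr nr0].
  have h2 : normc (F k (p + h) - f (p + h)) <= e' / 2.
    apply: n1P; [exact: leq_maxr|rewrite (addrC p) addrK].
    by apply: lt_trans hr _; rewrite ltr_pdivrMr // ltr_pMr // ltr1n.
  have -> : f (p + h) - F n (p + h) - (f p - F n p) =
    F k (p + h) - F n (p + h) - (F k p - F n p) +
    (F k p - f p - (F k (p + h) - f (p + h))) by ring.
  apply: le_trans (ler_normcD _ _) _; apply: lerD => //.
  by apply: le_trans (ler_normcB _ _) _; rewrite (splitr e') lerD.
have pr : nr (p - p) < rho by rewrite subrr nr0.
have diffF e : 0 < e -> exists n0, forall n k, (n0 <= n)%N -> (n0 <= k)%N ->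
    forall v, normc ('d (F k) p v - 'd (F n) p v) <= e * nr v.
  move=> e0; have [n0 n0P] := lipF e e0; exists n0 => n k nn kn v.
  have dk := dF k p pr; have dn := dF n p pr.
  have bd : exists2 d : R, 0 < d & forall h, nr h < d ->
     nr (F k (p + h) - F n (p + h) - (F k p - F n p)) <= e * nr h.
    by exists (rho / 2) => // h hr; exact: n0P.
  exact: (diff_subv_nr_le (ltW e0) dk dn bd v).
have [A AP] : exists A : V -> R[i], forall e, 0 < e -> exists n0, forall n, (n0 <= n)%N ->
    forall v, normc (A v - 'd (F n) p v) <= e * nr v.
  have cv v : exists l, forall e : R, 0 < e -> exists n0, forall n, (n0 <= n)%N ->
      normc ('d (F n) p v - l) <= e.
    apply: complex_cauchy_cvg => e e0.
    have v1 : 0 < nr v + 1 by rewrite ltr_wpDl ?nr_ge0.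
    have [n0 n0P] := diffF _ (divr_gt0 e0 v1); exists n0 => n m nn mn.
    apply: le_trans (n0P m n mn nn v) _; rewrite mulrAC ler_pdivrMr //.
    by rewrite ler_pM2l // lerDl.
  exists (fun v => sval (cid (cv v))) => e e0.
  have [n0 n0P] := diffF e e0; exists n0 => n nn v; case: cid => l /= lP.
  apply/ler_addgt0Pr => e' e'0; have [n1 n1P] := lP e' e'0.
  have := n1P (maxn n0 n1) (leq_maxr _ _); rewrite normcBC => h1.
  have h2 := n0P n (maxn n0 n1) nn (leq_maxl _ _) v.
  apply: le_trans (ler_normc_dist _ ('d (F (maxn n0 n1)) p v) _) _.
  by rewrite addrC; exact: lerD.
have [n1 n1P] := AP 1 ltr01.
have [C C0 CP] := diff_bounded (dF n1 p pr).
apply: (@bounded_linear_differentiable R V R[i] f A p (1 + C) _ _ _).1.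
- move=> a u v; apply/eqP; rewrite -subr_eq0 -normc_eq0; apply/eqP.
  apply: le_anti; rewrite normc_ge0 andbT; apply/ler_addgt0Pr => e e0; rewrite add0r.
  pose K := nr (a *: u + v) + normc a * nr u + nr v + 1.
  have K0 : 0 < K by rewrite ltr_wpDl // !addr_ge0 ?mulr_ge0 ?nr_ge0 ?normc_ge0.
  have [n nP] := AP _ (divr_gt0 e0 K0); have {}nP := nP n (leqnn _).
  have -> : A (a *: u + v) - (a *: A u + A v) =
    A (a *: u + v) - 'd (F n) p (a *: u + v) -
    (a * (A u - 'd (F n) p u) + (A v - 'd (F n) p v)).
    have -> : 'd (F n) p (a *: u + v) = a * 'd (F n) p u + 'd (F n) p v.
      exact: diff_linear.
    have -> : a *: A u = a * A u :> R[i] by [].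
    by ring.
  apply: le_trans (ler_normcB _ _) _.
  apply: (@le_trans _ _ (e / K * K)); last by rewrite divfK // gt_eqF.
  have h1 := nP (a *: u + v).
  have h2 : normc (a * (A u - 'd (F n) p u)) <= e / K * (normc a * nr u).
    by rewrite normcM mulrCA ler_wpM2l ?normc_ge0.
  have h3 := nP v; have h4 := ler_normcD (a * (A u - 'd (F n) p u)) (A v - 'd (F n) p v).
  have eK : 0 < e / K by rewrite divr_gt0.
  apply: (@le_trans _ _ (e / K * (nr (a *: u + v) + (normc a * nr u + nr v)))).
    by apply: (le_trans (lerD h1 (le_trans h4 (lerD h2 h3)))); rewrite -!mulrDr.
  by rewrite ler_pM2l // /K addrA lerDl.
- move=> v; rewrite nr_normc -[A v](subrK ('d (F n1) p v)).
  apply: le_trans (ler_normcD _ _) _; rewrite mulrDl; apply: lerD.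
    exact: n1P.
  exact: CP.
- move=> e e0; have e30 : 0 < e / 3 by rewrite divr_gt0.
  have [n2 n2P] := AP _ e30; have [n3 n3P] := lipf _ e30.
  pose n := maxn n2 n3.
  have [d d0 dP] := differentiable_nrP (dF n p pr) e30.
  exists (Num.min d (rho / 2)); first by rewrite lt_min d0.
  move=> h; rewrite lt_min => /andP[hd hr].
  have h1 := dP h hd; have h2 := n2P n (leq_maxl _ _) h.
  have h3 := n3P n (leq_maxr _ _) h hr; rewrite nr_normc in h1 *.
  have -> : f (p + h) - f p - A h = f (p + h) - F n (p + h) - (f p - F n p) +
    (F n (p + h) - F n p - 'd (F n) p h) - (A h - 'd (F n) p h) by ring.
  apply: le_trans (ler_normcB _ _) _.
  apply: le_trans (lerD (ler_normcD _ _) (lexx _)) _.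
  by have -> : e * nr h = e / 3 * nr h + e / 3 * nr h + e / 3 * nr h; [field|rewrite !lerD].
Qed.

End weierstrass.

(** * Strict differentiability *)

Section strict_differentiability.
Context {R : realType}.
Implicit Types (V W : normedModType R[i]).

(** The estimate of [hol_lipschitz] as a property of the target space, so that
    [strict_differentiability] covers scalar functions and row vectors at once. *)
Definition cauchy_lipschitz W := forall V (f : V -> W) (p : V) (rho M : R),
  (forall z, nr (z - p) < rho -> differentiable f z) ->
  (forall z, nr (z - p) < rho -> nr (f z) <= M) ->
  forall x y, nr (x - p) < rho / 2 -> nr (y - p) < rho / 2 ->
  rho * nr (f y - f x) <= 8 * M * nr (y - x).

Lemma cauchy_lipschitz_complex : cauchy_lipschitz R[i].
Proof. by move=> V f p rho M; exact: hol_lipschitz. Qed.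

Lemma cauchy_lipschitz_rV n : cauchy_lipschitz 'rV[R[i]]_n.
Proof.
move=> V f p rho M df bf x y xp yp.
have rho0 : 0 < rho by have := nr_ge0 (x - p); lra.
have M0 : 0 <= M by apply: le_trans (nr_ge0 _) (bf x _); lra.
rewrite -ler_pdivlMl //; apply: nr_rV_le => [|j].
  by rewrite !mulr_ge0 ?invr_ge0 ?nr_ge0 // ltW.
rewrite ler_pdivlMl // !mxE.
apply: (@hol_lipschitz R V (fun z => f z 0 j) p rho M) => // z zr.
  by have [] := differentiable_coordv j (df z zr).
exact: le_trans (nr_coord _ _) (bf z zr).
Qed.

(** Differentiability at [p] alone bounds [f] minus its affine part by [e / 8 * r] on a ball of
    radius [r]; the Cauchy estimate turns this size bound into the Lipschitz constant [e]. *)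
Lemma strict_differentiability V W (f : V -> W) (p : V) (rho : R) :
  cauchy_lipschitz W -> 0 < rho ->
  (forall z, nr (z - p) < rho -> differentiable f z) ->
  forall e : R, 0 < e -> exists2 d : R, 0 < d & d <= rho /\ forall x y,
    nr (x - p) < d -> nr (y - p) < d ->
    nr (f y - f x - 'd f p (y - x)) <= e * nr (y - x).
Proof.
move=> lipW rho0 df e e0; have pp : nr (p - p) < rho by rewrite subrr nr0.
have e8 : 0 < e / 8 by rewrite divr_gt0.
have dp := df p pp.
have [d d0 dP] := differentiable_nrP dp e8.
pose r := Num.min rho d.
have r0 : 0 < r by rewrite lt_min rho0.
have rr : r <= rho by rewrite ge_min lexx.
have rd : r <= d by rewrite ge_min lexx orbT.
exists (r / 2); first by rewrite divr_gt0.
split; first by apply: le_trans rr; rewrite ler_pdivrMr // ler_pMr // ler1n.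
have key (A : V -> W) : linear A -> (forall x, differentiable A x) ->
   (forall h, nr h < d -> nr (f (p + h) - f p - A h) <= e / 8 * nr h) ->
   forall x y, nr (x - p) < r / 2 -> nr (y - p) < r / 2 ->
    nr (f y - f x - A (y - x)) <= e * nr (y - x).
  move=> lA dA hA x y xp yp.
  have AB u w : A (u - w) = A u - A w by rewrite -scaleN1r addrC lA scaleN1r addrC.
  pose g z := f z - A z - (f p - A p).
  have dg z : nr (z - p) < r -> differentiable g z.
    move=> zr; apply: differentiable_subv; last exact: differentiable_cstv.
    by apply: differentiable_subv => //; apply: df; exact: lt_le_trans rr.
  have bg z : nr (z - p) < r -> nr (g z) <= e / 8 * r.
    move=> zr; have := hA (z - p) (lt_le_trans zr rd).
    rewrite (addrC p) subrK AB subrACA => h; apply: le_trans h _.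
    by rewrite ler_pM2l // ltW.
  have := lipW V g p r _ dg bg x y xp yp.
  have -> : g y - g x = f y - f x - A (y - x).
    by rewrite /g subrACA subrr subr0 AB subrACA.
  by rewrite (_ : 8 * (e / 8 * r) = r * e) -?mulrA ?ler_pM2l //; field.
apply: (key _ (diff_linear f p)) => [x|]; last exact: dP.
have [cf _] := (diff_locallyP p f).1 dp.
exact: linear_differentiable cf.
Qed.

End strict_differentiability.

Section derivative.
Context {R : realType}.
Implicit Types (V W : normedModType R[i]).

Lemma differentiable_shiftv V W (f : V -> W) (x w : V) :
  differentiable f (x + w) -> differentiable (fun z => f (z + w)) x.
Proof.
move=> df; by apply: (@differentiable_comp _ _ _ _ (fun z => z + w) f).
Qed.

(** Two Cauchy estimates bound second differences quadratically, so the remainder satisfies [E (k +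
    k) <= 2 * E k + a * nr (k + k) ^+ 2] in norm. Halving the step again and again sums a geometric
    series, and [2 ^+ m] times the remainder at [2^-m h] tends to [0] by differentiability. *)
Lemma taylor2 V (f : V -> R[i]) (p : V) (r M : R) :
  (forall z, nr (z - p) < r -> differentiable f z) ->
  (forall z, nr (z - p) < r -> normc (f z) <= M) ->
  forall x h, nr (x - p) < r / 16 -> nr h < r / 16 ->
  normc (f (x + h) - f x - 'd f x h) <= 128 * M / r ^+ 2 * nr h ^+ 2.
Proof.
move=> df bf x h xp hr.
have r0 : 0 < r by have := nr_ge0 h; lra.
(* The two estimates give [256 * M / r ^+ 2 * nr k ^+ 2], here expressed through [nr (k + k)]. *)
pose a := 64 * M / r ^+ 2.
have M0 : 0 <= M by apply: le_trans (normc_ge0 _) (bf x _); lra.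
have a0 : 0 <= a by rewrite divr_ge0 ?mulr_ge0 ?exprn_ge0 // ltW.
have xr : nr (x - p) < r by lra.
have dfx := df x xr.
have two k : nr k < r / 16 -> normc (f (x + k + k) - f (x + k) - (f (x + k) - f x)) <= a * nr (k + k) ^+ 2.
  move=> kr; pose H z := f (z + k) - f z.
  have nk u (s : R) : nr (u - p) < s -> nr (u + k - p) < s + r / 16.
    by move=> us; rewrite addrAC; apply: le_lt_trans (ler_nrD _ _) _; lra.
  have dH z : nr (z - p) < r / 4 -> differentiable H z.
    move=> zr; apply: differentiable_subv; last by apply: df; lra.
    by apply: differentiable_shiftv; apply: df; apply: lt_trans (nk _ _ zr) _; lra.
  have bH z : nr (z - p) < r / 4 -> normc (H z) <= 8 * M * nr k / r.
    move=> zr; rewrite ler_pdivlMr // mulrC.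
    have := hol_lipschitz df bf (x := z) (y := z + k).
    have -> : z + k - z = k by rewrite addrAC subrr add0r.
    apply; first by lra.
    by apply: lt_trans (nk _ _ zr) _; lra.
  have := hol_lipschitz dH bH (x := x) (y := x + k).
  have -> : x + k - x = k by rewrite addrAC subrr add0r.
  move=> hh.
  have {}hh := hh ltac:(lra) ltac:(by apply: lt_le_trans (nk _ _ xp) _; lra).
  rewrite -mulr2n -scaler_nat nrZ -(natr1 1) -[(1 + 1)%R]/(2 : R[i]).
  have -> : normc (2 : R[i]) = 2.
    by rewrite (_ : 2 = (2 : R)%:C) ?normc_real ?ger0_norm // rmorph_nat.
  rewrite /H in hh; rewrite -(ler_pM2l r0) -(ler_pM2l (_ : 0 < 4^-1)) ?invr_gt0 //.
  have e1 : 4^-1 * (r * (a * (2 * nr k) ^+ 2)) = 8 * (8 * M * nr k / r) * nr k.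
    by rewrite /a; field; rewrite gt_eqF.
  by rewrite e1; apply: le_trans hh; rewrite mulrA (mulrC _ r).
pose E k := f (x + k) - f x - 'd f x k.
have E2 k : nr (k + k) < r / 16 -> normc (E (k + k)) <= 2 * normc (E k) + a * nr (k + k) ^+ 2.
  move=> kr; have kr' : nr k < r / 16.
    have : nr (k + k) = 2 * nr k.
      rewrite -mulr2n -scaler_nat nrZ; congr (_ * _).
      by rewrite (_ : 2%:R = (2 : R)%:C) ?normc_real ?ger0_norm // rmorph_nat.
    by have := nr_ge0 k; lra.
  have -> : E (k + k) = f (x + k + k) - f (x + k) - (f (x + k) - f x) + (E k + E k).
    rewrite /E; have -> : 'd f x (k + k) = 'd f x k + 'd f x k by rewrite linearD.
    by rewrite addrA; ring.
  apply: le_trans (ler_normcD _ _) _; rewrite addrC; apply: lerD; last exact: two.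
  by apply: le_trans (ler_normcD _ _) _; rewrite mulr_natl mulr2n.
have nhalf m : nr ((2^-1 ^+ m)%:C *: h) = 2^-1 ^+ m * nr h.
  by rewrite nrZ normc_real ger0_norm // exprn_ge0 // invr_ge0.
have iter m : normc (E h) <= 2 ^+ m * normc (E ((2^-1 ^+ m)%:C *: h)) + 2 * a * nr h ^+ 2 * (1 - 2^-1 ^+ m).
  elim: m => [|m ih].
    by rewrite expr0 subrr mulr0 addr0 mul1r scale1r.
  apply: le_trans ih _.
  have hh : (2^-1 ^+ m)%:C *: h = (2^-1 ^+ m.+1)%:C *: h + (2^-1 ^+ m.+1)%:C *: h.
    by rewrite -scalerDl -rmorphD /=; congr (_%:C *: _); rewrite exprS; field.
  have sm : nr ((2^-1 ^+ m)%:C *: h) < r / 16.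
    apply: le_lt_trans hr; rewrite nhalf ler_piMl ?nr_ge0 //.
    by rewrite exprn_ile1 // ?invr_ge0 // invf_le1 // ler1n.
  rewrite hh in sm; have := E2 _ sm; rewrite -hh nhalf => h1.
  have p0 : 0 < (2 : R) ^+ m by rewrite exprn_gt0.
  have {h1} := ler_wpM2l (ltW p0) h1.
  set e1 := normc (E ((2^-1 ^+ m)%:C *: h)); set e2 := normc (E ((2^-1 ^+ m.+1)%:C *: h)).
  have -> : 2 ^+ m * (2 * e2 + a * (2^-1 ^+ m * nr h) ^+ 2) =
    2 ^+ m.+1 * e2 + a * nr h ^+ 2 * 2^-1 ^+ m.
    by rewrite !exprVn (exprS 2 m); field; rewrite gt_eqF.
  rewrite (exprS 2^-1 m) (exprS 2 m); set b := nr h ^+ 2; set i := 2^-1 ^+ m.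
  set P := 2 ^+ m; clear - a0; move: e1 e2 => x1 x2 h1; nra.
apply/ler_addgt0Pr => e e0.
have h1 : 0 < nr h + 1 by rewrite ltr_wpDl ?nr_ge0.
have [d d0 dP] := differentiable_nrP dfx (divr_gt0 e0 h1).
have [m mP] := expr2V_small (nr h) d0.
have small : nr ((2^-1 ^+ m)%:C *: h) < d by rewrite nhalf exprVn mulrC.
have := iter m; have := dP _ small; rewrite -/(E _) nr_normc nhalf => h2 h3.
have p0 : 0 < (2 : R) ^+ m by rewrite exprn_gt0.
have {h2} := ler_wpM2l (ltW p0) h2.
have -> : 2 ^+ m * (e / (nr h + 1) * (2^-1 ^+ m * nr h)) = e / (nr h + 1) * nr h.
  by rewrite exprVn; field; rewrite !gt_eqF.
have e1 : e / (nr h + 1) * nr h <= e.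
  by rewrite mulrAC ler_pdivrMr // ler_pM2l // lerDl.
have i0 : 0 <= 2^-1 ^+ m :> R by rewrite exprn_ge0 // invr_ge0.
have -> : 128 * M / r ^+ 2 = 2 * a by rewrite /a; field; rewrite gt_eqF.
have b0 : 0 <= 2 * a * nr h ^+ 2 := mulr_ge0 (mulr_ge0 (ler0n R 2) a0) (exprn_ge0 2 (nr_ge0 h)).
have : 2 * a * nr h ^+ 2 * (1 - 2^-1 ^+ m) <= 2 * a * nr h ^+ 2.
  by rewrite ler_piMr // gerBl.
rewrite -/(E h) => h4 h5; apply: le_trans h3 _; rewrite addrC; apply: lerD => //.
exact: le_trans h5 e1.
Qed.

Lemma locally_bounded V W (f : V -> W) (p : V) : differentiable f p ->
  exists2 d : R, 0 < d & forall z, nr (z - p) < d -> nr (f z) <= nr (f p) + 1.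
Proof.
move=> /differentiable_continuous cf.
have [d d0 dP] := (continuous_nrP f p).1 cf 1 ltr01; exists d => // z /dP.
by have := lerB_nr (f z) (f p); lra.
Qed.

(** By [taylor2] the difference quotients in the direction [v] converge uniformly near [p], so
    Weierstrass' theorem applies to them. *)
Lemma diff_holomorphic V (f : V -> R[i]) (p v : V) (rho : R) : 0 < rho ->
  (forall z, nr (z - p) < rho -> differentiable f z) ->
  differentiable (fun z => 'd f z v) p.
Proof.
move=> rho0 df; have pp : nr (p - p) < rho by rewrite subrr nr0.
have [d d0 dP] := locally_bounded (df p pp).
pose r := Num.min rho d; pose M := normc (f p) + 1.
have r0 : 0 < r by rewrite lt_min rho0.
have rr : r <= rho by rewrite ge_min lexx.
have rd : r <= d by rewrite ge_min lexx orbT.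
have df' z : nr (z - p) < r -> differentiable f z by move=> zr; apply: df; exact: lt_le_trans rr.
have bf z : nr (z - p) < r -> normc (f z) <= M by move=> zr; apply: dP; exact: lt_le_trans rd.
have v1 : 0 < nr v + 1 by rewrite ltr_wpDl ?nr_ge0.
(* Keeps every increment [(t n)%:C *: v] within the range [r / 16] of [taylor2]. *)
pose tau := r / 16 / (nr v + 1).
have tau0 : 0 < tau by rewrite !divr_gt0.
pose t n : R := tau / n.+1%:R.
have t0 n : 0 < t n by rewrite divr_gt0.
have tn n : t n <= tau by rewrite ler_pdivrMr // ler_pMr // ler1n.
have tv n : nr ((t n)%:C *: v) < r / 16.
  rewrite nrZ normc_real gtr0_norm //; apply: (@lt_le_trans _ _ (tau * (nr v + 1))).
    apply: (@lt_le_trans _ _ (t n * (nr v + 1))); first by rewrite ltr_pM2l // ltrDl.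
    by rewrite ler_pM2r.
  by rewrite /tau divfK // gt_eqF.
pose F n z := (f (z + (t n)%:C *: v) - f z) / (t n)%:C.
have tC n : (t n)%:C != 0 by rewrite (inj_eq (@complexI R)) gt_eqF.
pose K := 128 * M / r ^+ 2 * nr v ^+ 2.
apply: (@weierstrass _ _ F _ _ (r / 16)); first by rewrite divr_gt0.
  move=> n z zr; apply: differentiable_mulc; last exact: differentiable_cstv.
  apply: differentiable_subv; last by apply: df'; lra.
  apply: differentiable_shiftv; apply: df'; rewrite addrAC.
  by apply: le_lt_trans (ler_nrD _ _) _; have := tv n; lra.
move=> e e0.
have [n0 n0P] : exists n0, forall n, (n0 <= n)%N -> K * t n <= e.
  have K1 : 0 < `|K| * tau + 1 by rewrite ltr_wpDl // mulr_ge0 // ltW.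
  exists (Num.bound (`|K| * tau / e)) => n nn.
  have h := archi_boundP (divr_ge0 (mulr_ge0 (normr_ge0 K) (ltW tau0)) (ltW e0)).
  rewrite /t mulrA ler_pdivrMr //; apply: (@le_trans _ _ (`|K| * tau)).
    by rewrite ler_wpM2r ?ler_norm // ltW.
  rewrite (mulrC e) -ler_pdivrMr //; apply: le_trans (ltW h) _.
  by rewrite ler_nat (leq_trans nn).
exists n0 => n nn z zr; apply: le_trans (n0P n nn).
have := taylor2 df' bf zr (tv n).
have -> : 'd f z ((t n)%:C *: v) = (t n)%:C * 'd f z v by rewrite linearZ.
have -> : F n z - 'd f z v = (f (z + (t n)%:C *: v) - f z - (t n)%:C * 'd f z v) / (t n)%:C.
  by rewrite /F [in RHS]mulrBl mulrAC mulfV // mul1r.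
rewrite nrZ normcM normcV normc_real gtr0_norm // exprMn => h.
rewrite ler_pdivrMr //; apply: le_trans h _; rewrite /K.
by rewrite le_eqVlt; apply/orP; left; apply/eqP; ring.
Qed.

End derivative.

(** * The inverse function theorem *)

Section inverse_function.
Context {R : realType} {n : nat}.
Local Notation V := 'rV[R[i]]_n.

Lemma compact_closed_ball_rV (p : V) (r : R) : 0 <= r ->
  compact [set x : V | nr (x - p) <= r].
Proof.
move=> r0; have := @rV_compact R[i] n (fun j => [set z | normc (z - p 0 j) <= r])
  (fun j => @compact_closed_disc R (p 0 j) r).
congr compact; apply/seteqP; split=> x /= h.
  by apply: nr_rV_le => // j; have := h j; rewrite !mxE.
by move=> j; apply: le_trans h; have := nr_coord (x - p) j; rewrite !mxE.
Qed.

Lemma rV_linear_bounded (W : normedModType R[i]) (L : V -> W) : linear L ->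
  exists2 C : R, 0 < C & forall v, nr (L v) <= C * nr v.
Proof.
move=> lL; pose C := \sum_j nr (L (delta_mx 0 j)) + 1.
have S0 : 0 <= \sum_j nr (L (delta_mx 0 j)) by rewrite sumr_ge0 // => j _; exact: nr_ge0.
exists C; first by rewrite ltr_wpDl.
move=> v; pose L' : {linear V -> W} := HB.pack L (GRing.isLinear.Build _ _ _ _ L lL).
have -> : L v = \sum_j v 0 j *: L (delta_mx 0 j).
  rewrite {1}(row_sum_delta v) -[L]/(L' : V -> W) linear_sum.
  by apply: eq_bigr => j _; rewrite linearZ.
apply: (@le_trans _ _ (\sum_j nr v * nr (L (delta_mx 0 j)))).
  elim/big_ind2: _ => [|a b c d h1 h2|j _]; first by rewrite nr0.
    by apply: le_trans (ler_nrD _ _) _; exact: lerD.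
  by rewrite nrZ ler_wpM2r ?nr_ge0 // nr_coord.
by rewrite -mulr_sumr mulrC ler_wpM2r ?nr_ge0 // lerDl.
Qed.

Lemma rV_linear_inverse (L : V -> V) : linear L -> (forall v, L v = 0 -> v = 0) ->
  exists B : V -> V, [/\ linear B, cancel L B & cancel B L].
Proof.
move=> lL iL; pose L' : {linear V -> V} := HB.pack L (GRing.isLinear.Build _ _ _ _ L lL).
have LE v : L v = v *m lin1_mx L' by rewrite mul_rV_lin1.
have uL : lin1_mx L' \in unitmx.
  rewrite -row_free_unit; apply: inj_row_free => v; rewrite -LE; exact: iL.
exists (fun v => v *m invmx (lin1_mx L')); split.
- by move=> a u v; rewrite mulmxDl -scalemxAl.
- by move=> v; rewrite LE mulmxK.
- by move=> v; rewrite LE mulmxKV.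
Qed.

Lemma rV_linear_differentiable (W : normedModType R[i]) (L : V -> W) x : linear L ->
  differentiable L x /\ forall v, 'd L x v = L v.
Proof.
move=> lL; have [C C0 CP] := rV_linear_bounded lL.
apply: (bounded_linear_differentiable lL CP) => e e0; exists 1 => // h _.
have -> : L (x + h) - L x - L h = 0.
  have -> : L (x + h) = L x + L h by have := lL 1 x h; rewrite !scale1r.
  by rewrite (addrC (L x)) addrK subrr.
by rewrite nr0 mulr_ge0 ?nr_ge0 // ltW.
Qed.

Lemma linear_subr (U W : lmodType R[i]) (L : U -> W) : linear L ->
  forall u w, L (u - w) = L u - L w.
Proof. by move=> lL u w; rewrite -scaleN1r addrC lL scaleN1r addrC. Qed.

Lemma diff_linear_nr_le (W : normedModType R[i]) (f A : V -> W) (x : V) (C : R) :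
  0 <= C -> differentiable f x -> linear A ->
  (exists2 d : R, 0 < d & forall h, nr h < d -> nr (f (x + h) - f x - A h) <= C * nr h) ->
  forall v, nr ('d f x v - A v) <= C * nr v.
Proof.
move=> C0 df lA [d d0 dP] v; have [dA AE] := rV_linear_differentiable x lA.
rewrite -AE; apply: (diff_subv_nr_le C0 df dA); exists d => // h /dP.
have -> : A h = A (x + h) - A x by rewrite -(linear_subr lA) (addrC x) addrK.
by rewrite subrACA.
Qed.

(** The identity [k - B h = - B (h - A k)] carries the remainder of [f] at [x] over to [g] at [y];
    the Lipschitz bound on [g] makes it small relative to [h]. *)
Lemma inverse_differentiable (f g : V -> V) (A B : V -> V) (x y : V) (C d : R) :
  linear B -> cancel A B -> 0 < C -> 0 < d ->
  (forall e : R, 0 < e -> exists2 d : R, 0 < d &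
    forall h, nr h < d -> nr (f (x + h) - f x - A h) <= e * nr h) ->
  g y = x -> f x = y ->
  (forall h, nr h < d -> f (g (y + h)) = y + h /\ nr (g (y + h) - x) <= C * nr h) ->
  differentiable g y /\ forall v, 'd g y v = B v.
Proof.
move=> lB AK C0 d0 fA gy fx gP.
have [b b0 bB] := rV_linear_bounded lB.
apply: (bounded_linear_differentiable lB bB) => e e1.
have bb : 0 < b * C by rewrite mulr_gt0.
have [d2 d20 d2P] := fA _ (divr_gt0 e1 bb).
exists (Num.min d (d2 / C)); first by rewrite lt_min d0 divr_gt0.
move=> h; rewrite lt_min => /andP[h1 h2].
have [fxh kh] := gP h h1; rewrite gy; set k := g (y + h) - x in kh *.
have kd2 : nr k < d2 by apply: le_lt_trans kh _; rewrite mulrC -ltr_pdivlMr.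
have := d2P k kd2; rewrite /k (addrC x) subrK -/k fxh fx.
have -> : y + h - y = h by rewrite addrAC subrr add0r.
move=> hk; have -> : k - B h = - B (h - A k).
  by rewrite (linear_subr lB) AK opprB.
rewrite nrN; apply: le_trans (bB _) _; apply: le_trans (ler_wpM2l (ltW b0) hk) _.
apply: (@le_trans _ _ (b * (e / (b * C) * (C * nr h)))).
  by rewrite ler_pM2l // ler_pM2l // divr_gt0.
by rewrite le_eqVlt; apply/orP; left; apply/eqP; field; rewrite !gt_eqF.
Qed.

Section strict.
Variables (f A B : V -> V) (p : V) (alpha beta d : R).
Hypotheses (lA : linear A) (lB : linear B) (AK : cancel A B) (BK : cancel B A).
Hypotheses (alpha0 : 0 < alpha) (beta0 : 0 < beta) (d0 : 0 < d).
Hypotheses (bA : forall v, nr (A v) <= alpha * nr v) (bB : forall v, nr (B v) <= beta * nr v).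
(** After composition with [B] the error is [1/2]-Lipschitz, the usual contraction constant. *)
Hypothesis strict : forall x y, nr (x - p) < d -> nr (y - p) < d ->
  nr (f y - f x - A (y - x)) <= (2 * beta)^-1 * nr (y - x).

Lemma strict_lower_bound x y : nr (x - p) < d -> nr (y - p) < d ->
  nr (y - x) <= 2 * beta * nr (f y - f x).
Proof.
move=> xd yd; have := strict xd yd; set e := _ - A _ => he.
have E : y - x = B (f y - f x) - B e.
  by rewrite -(linear_subr lB) /e opprB addrCA addrN addr0 AK.
have h1 : nr (y - x) <= beta * nr (f y - f x) + beta * nr e.
  by rewrite {1}E; apply: le_trans (ler_nrB _ _) _; apply: lerD; exact: bB.
have h2 : beta * nr e <= nr (y - x) / 2.
  apply: le_trans (ler_wpM2l (ltW beta0) he) _.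
  by rewrite le_eqVlt; apply/orP; left; apply/eqP; field; rewrite gt_eqF.
lra.
Qed.

(** Compactness replaces a fixed point iteration: [nr (B (f x - y))] has a minimiser [x] on a closed
    ball, and the Newton step from [x] to [x - r], with [r = B (f x - y)], would at least halve this
    quantity. Hence [r = 0]. *)
Lemma strict_locally_onto : (forall x, nr (x - p) < d -> {for x, continuous f}) ->
  exists2 eta : R, 0 < eta & forall y, nr (y - f p) < eta ->
    exists2 x, nr (x - p) < d & f x = y.
Proof.
move=> cf; pose d' := d / 2.
have d'0 : 0 < d' by rewrite divr_gt0.
have d'd : d' < d by rewrite ltr_pdivrMr // ltr_pMr // ltr1n.
have ab : 0 < 1 + alpha * beta by rewrite addr_gt0 // mulr_gt0.
(* Chosen so that the minimiser lies within [d' / 4] of [p] and the Newton step has length at most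
   [d' / 8]; the step then stays in the ball. *)
pose eta := d' / (8 * (beta * (1 + alpha * beta))).
have eta0 : 0 < eta by rewrite divr_gt0 // !mulr_gt0.
have etaE : eta * (beta * (1 + alpha * beta)) = d' / 8.
  by rewrite /eta; field; rewrite !gt_eqF.
clearbody eta; exists eta => // y yeta.
pose v x := nr (B (f x - y)).
have [x /= xd' xmin] : exists2 x, nr (x - p) <= d' &
    forall z, nr (z - p) <= d' -> - v z <= - v x.
  apply: (@compact_sup_attained _ _ [set x | nr (x - p) <= d'] (fun x => - v x)).
  - exact: compact_closed_ball_rV (ltW d'0).
  - by exists p; rewrite /= subrr nr0 ltW.
  - apply: continuous_in_subspaceT => x; rewrite inE /= => xd'.
    move=> U /nbhs_normP[e /= e0 eP].
    have xd : nr (x - p) < d := le_lt_trans xd' d'd.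
    have [e1 e10 e1P] := (continuous_nrP _ _).1 (cf x xd) _ (divr_gt0 e0 beta0).
    apply/nbhs_nrP; exists e1 => // z /e1P; rewrite ltr_pdivlMr // => ze.
    apply: eP; rewrite /= opprK; apply: le_lt_trans ze; rewrite mulrC addrC.
    have bz : nr (B (f z - y) - B (f x - y)) <= beta * nr (f z - f x).
      by rewrite -(linear_subr lB) opprB addrA subrK.
    apply: le_trans bz; rewrite /v.
    have := lerB_nr (B (f z - y)) (B (f x - y)).
    have := lerB_nr (B (f x - y)) (B (f z - y)).
    by rewrite (nrBC (B (f x - y))) ler_norml; lra.
have pd : nr (p - p) < d by rewrite subrr nr0.
have xd : nr (x - p) < d := le_lt_trans xd' d'd.
have {}xmin z : nr (z - p) <= d' -> v x <= v z by move=> /xmin; rewrite lerN2.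
have vx : v x <= beta * eta.
  apply: le_trans (xmin p _) _; first by rewrite subrr nr0 ltW.
  by apply: le_trans (bB _) _; rewrite ler_pM2l // nrBC ltW.
exists x => //; set r := B (f x - y).
have fxy : f x - y = A r by rewrite /r BK.
have nfx : nr (f x - y) <= alpha * (beta * eta).
  by rewrite fxy; apply: le_trans (bA _) _; rewrite ler_pM2l.
have xp : nr (x - p) <= d' / 4.
  apply: le_trans (strict_lower_bound pd xd) _.
  have h : nr (f x - f p) <= alpha * (beta * eta) + eta.
    by apply: le_trans (ler_nr_dist _ y _) _; apply: lerD => //; exact: ltW.
  have b2 : 0 <= 2 * beta by rewrite mulr_ge0 // ltW.
  apply: le_trans (ler_wpM2l b2 h) _.
  have -> : 2 * beta * (alpha * (beta * eta) + eta) = 2 * (eta * (beta * (1 + alpha * beta))) by ring.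
  rewrite etaE; lra.
have rd : nr r <= d' / 8.
  apply: (le_trans vx); apply: (@le_trans _ _ (eta * (beta * (1 + alpha * beta)))).
    by rewrite mulrA (mulrC eta) ler_peMr ?mulr_ge0 ?(ltW beta0) ?(ltW eta0) // lerDl mulr_ge0 // ltW.
  by rewrite etaE.
have xrd' : nr (x - r - p) <= d'.
  rewrite addrAC; apply: le_trans (ler_nrB _ _) _; lra.
have xrd := le_lt_trans xrd' d'd.
have := strict xd xrd; have -> : x - r - x = - r by rewrite addrAC subrr add0r.
have -> : A (- r) = - A r.
  by have := linear_subr lA 0 r; have := linear_subr lA 0 0; rewrite !subrr sub0r => ->; rewrite sub0r.
rewrite nrN.
rewrite opprK -fxy => h.
have := xmin _ xrd'; rewrite {2}/v.
have -> : f (x - r) - y = f (x - r) - f x + (f x - y) by rewrite addrA subrK.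
move=> h2; have {h2} := le_trans h2 (bB _) => h2.
have h3 : nr r <= nr r / 2.
  apply: (le_trans h2); apply: le_trans (ler_wpM2l (ltW beta0) h) _.
  by rewrite le_eqVlt; apply/orP; left; apply/eqP; field; rewrite gt_eqF.
have r0 : r = 0 by apply/eqP; rewrite -nr_eq0; have := nr_ge0 r; lra.
apply/eqP; rewrite -subr_eq0 fxy r0.
by have := linear_subr lA 0 0; rewrite !subrr => ->.
Qed.

Lemma strict_inverse : (forall x, nr (x - p) < d -> differentiable f x) ->
  exists (eta : R) (g : V -> V), [/\ 0 < eta,
    (forall x y, nr (x - p) < d -> nr (y - p) < d -> f x = f y -> x = y),
    (forall y, nr (y - f p) < eta -> nr (g y - p) < d /\ f (g y) = y) &
    (forall y, nr (y - f p) < eta -> differentiable g y /\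
       forall w, 'd f (g y) ('d g y w) = w)].
Proof.
move=> dfd; have [|eta eta0 onto] := strict_locally_onto.
  by move=> x /dfd /differentiable_continuous.
pose g y := xget p [set x | nr (x - p) < d /\ f x = y].
have gP y : nr (y - f p) < eta -> nr (g y - p) < d /\ f (g y) = y.
  move=> /onto[x xd fx]; rewrite /g.
  by have := xgetPex p (ex_intro [set x | nr (x - p) < d /\ f x = y] x (conj xd fx)).
have b2 : 0 < 2 * beta by rewrite mulr_gt0.
exists eta, g; split=> //.
  move=> x y xd yd fxy; apply/eqP; rewrite eq_sym -subr_eq0 -nr_eq0.
  have := strict_lower_bound xd yd; rewrite fxy subrr nr0 mulr0.
  by have := nr_ge0 (y - x); lra.
move=> y0 y0eta; have [xd fx] := gP y0 y0eta.
have d1 : 0 < d - nr (g y0 - p) by rewrite subr_gt0.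
have dA0 := dfd _ xd.
(* Strict differentiability keeps the differential within [(2 * beta)^-1] of [A] on the whole ball,
   so it remains injective at [g y0]. *)
have inj0 v : 'd f (g y0) v = 0 -> v = 0.
  move=> v0; have e0 : 0 <= (2 * beta)^-1 by rewrite invr_ge0 ltW.
  have h : nr ('d f (g y0) v - A v) <= (2 * beta)^-1 * nr v.
    apply: (diff_linear_nr_le e0 dA0 lA); exists (d - nr (g y0 - p)) => // h hd.
    have xh : nr (g y0 + h - p) < d.
      by rewrite addrAC; apply: le_lt_trans (ler_nrD _ _) _; lra.
    have := strict xd xh.
    by have -> : g y0 + h - g y0 = h by rewrite addrAC subrr add0r.
  rewrite v0 sub0r nrN in h.
  have := bB (A v); rewrite AK => h2.
  have h3 : nr v <= nr v / 2.
    apply: (le_trans h2); apply: le_trans (ler_wpM2l (ltW beta0) h) _.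
    by rewrite le_eqVlt; apply/orP; left; apply/eqP; field; rewrite gt_eqF.
  by apply/eqP; rewrite -nr_eq0; have := nr_ge0 v; lra.
have [B0 [lB0 AK0 BK0]] := rV_linear_inverse (diff_linear f (g y0)) inj0.
have eta1 : 0 < eta - nr (y0 - f p) by rewrite subr_gt0.
have [|dg dgE] := inverse_differentiable lB0 AK0 b2 eta1 (differentiable_nrP dA0)
  erefl fx.
  move=> h hd; have yh : nr (y0 + h - f p) < eta.
    by rewrite addrAC; apply: le_lt_trans (ler_nrD _ _) _; lra.
  have [xh fxh] := gP _ yh; split=> //.
  have := strict_lower_bound xd xh; rewrite fxh fx.
  by have -> : y0 + h - y0 = h by rewrite addrAC subrr add0r.
by split=> // w; exact: etrans (congr1 ('d f (g y0)) (dgE w)) (BK0 w).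
Qed.

End strict.

Lemma inverse_function (f : V -> V) (p : V) (rho : R) : 0 < rho ->
  (forall z, nr (z - p) < rho -> differentiable f z) ->
  (forall v, 'd f p v = 0 -> v = 0) ->
  exists (d eta : R) (g : V -> V), [/\ 0 < d <= rho, 0 < eta,
    (forall x y, nr (x - p) < d -> nr (y - p) < d -> f x = f y -> x = y),
    (forall y, nr (y - f p) < eta -> nr (g y - p) < d /\ f (g y) = y) &
    (forall y, nr (y - f p) < eta -> differentiable g y /\
       forall w, 'd f (g y) ('d g y w) = w)].
Proof.
move=> rho0 df inj; have lA := diff_linear f p.
have [B [lB AK BK]] := rV_linear_inverse lA inj.
have [alpha alpha0 bA] := rV_linear_bounded lA.
have [beta beta0 bB] := rV_linear_bounded lB.
have e0 : 0 < (2 * beta)^-1 by rewrite invr_gt0 mulr_gt0.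
have [d d0 [drho strict]] := strict_differentiability (@cauchy_lipschitz_rV R n) rho0 df e0.
have dfd z : nr (z - p) < d -> differentiable f z by move=> zd; apply: df; exact: lt_le_trans drho.
have [eta [g [g1 g2 g3 g4]]] := strict_inverse lA lB AK BK alpha0 beta0 d0 bA bB strict dfd.
by exists d, eta, g; split=> //; rewrite d0.
Qed.

End inverse_function.

(** * Injective functions of one variable *)

Section flat.
Context {R : realType}.

Lemma diff_complexE (h : R[i] -> R[i]) z v : 'd h z v = v * 'd h z 1.
Proof. by rewrite -[in LHS](mulr1 v) -[v * 1 : R[i]]/(v *: (1 : R[i])) linearZ. Qed.

(** Bisection: a chord of slope larger than [e] leaves such a chord over one of the halves, and at
    the common point of the nested intervals this contradicts flatness. Derivatives are taken
    relative to [[a, b]], so merely Lipschitz paths are covered. *)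
Lemma flat_path (V : normedModType R[i]) (g : R -> V) (a b : R) : a <= b ->
  (forall x, a <= x <= b -> forall e : R, 0 < e -> exists2 d : R, 0 < d &
    forall y, a <= y <= b -> `|y - x| < d -> nr (g y - g x) <= e * `|y - x|) ->
  g a = g b.
Proof.
move=> ab gf; apply/eqP; rewrite eq_sym -subr_eq0 -nr_eq0; apply/eqP/le_anti.
rewrite nr_ge0 andbT; apply/ler_addgt0Pr => e0 e00; rewrite add0r.
have [->|ba] := eqVneq b a; first by rewrite subrr nr0 ltW.
have l0 : 0 < b - a by rewrite subr_gt0 lt_def ba.
rewrite -(divfK (lt0r_neq0 l0) e0).
have ep : 0 < e0 / (b - a) by rewrite divr_gt0.
move: (e0 / (b - a)) ep => {e0 e00} e ep; rewrite leNgt; apply/negP => bad.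
pose L := b - a.
have step k (x : R) : exists y, (y = x \/ y = x + L / 2 ^+ k.+1) /\
    (e * (L / 2 ^+ k) < nr (g (x + L / 2 ^+ k) - g x) ->
     e * (L / 2 ^+ k.+1) < nr (g (y + L / 2 ^+ k.+1) - g y)).
  have half : L / 2 ^+ k = L / 2 ^+ k.+1 + L / 2 ^+ k.+1.
    by rewrite exprS; field; rewrite gt_eqF // exprn_gt0.
  have [h1|h1] := ltP (e * (L / 2 ^+ k.+1)) (nr (g (x + L / 2 ^+ k.+1) - g x)).
    by exists x; split; [left|].
  exists (x + L / 2 ^+ k.+1); split; [by right|rewrite half -addrA => h2].
  have := ler_nr_dist (g (x + (L / 2 ^+ k.+1 + L / 2 ^+ k.+1))) (g (x + L / 2 ^+ k.+1)) (g x).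
  by move: h1 h2; rewrite mulrDr; move: (nr _) (nr _) (nr _) (e * _) => x1 x2 x3 x4; lra.
pose nx k x := sval (cid (step k x)).
have nxP k x : (nx k x = x \/ nx k x = x + L / 2 ^+ k.+1) /\
    (e * (L / 2 ^+ k) < nr (g (x + L / 2 ^+ k) - g x) ->
     e * (L / 2 ^+ k.+1) < nr (g (nx k x + L / 2 ^+ k.+1) - g (nx k x))).
  exact: (svalP (cid (step k x))).
pose s := fix s k := if k is k'.+1 then nx k' (s k') else a.
have sbad k : e * (L / 2 ^+ k) < nr (g (s k + L / 2 ^+ k) - g (s k)).
  elim: k => [|k ih]; last by apply: (nxP k (s k)).2.
  by rewrite /= expr0 divr1 /L (addrC a) subrK.
have k0 k : 0 < (2 : R) ^+ k by rewrite exprn_gt0.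
have Lk k : 0 <= L / 2 ^+ k by rewrite divr_ge0 // ltW.
have nest k j : s k <= s (j + k)%N /\ s (j + k)%N + L / 2 ^+ (j + k) <= s k + L / 2 ^+ k.
  elim: j => [|j [ih1 ih2]]; first by rewrite add0n.
  rewrite addSn; have [h _] := nxP (j + k)%N (s (j + k)%N).
  have : L / 2 ^+ (j + k) = L / 2 ^+ (j + k).+1 + L / 2 ^+ (j + k).+1.
    by rewrite exprS; field; rewrite gt_eqF.
  have := Lk (j + k).+1; rewrite -/s /=.
  by case: h => ->; move: (L / _) (L / _) (L / _) ih1 ih2 => x1 x2 x3; lra.
have [x xP] := nested_intervals nest Lk.
have xab : a <= x <= b.
  by have := xP 0%N; rewrite /= expr0 divr1 /L (addrC a) subrK.
have [d d0 dP] := gf x xab e ep.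
have [k kd] := expr2V_small L d0.
have sab : a <= s k /\ s k + L / 2 ^+ k <= b.
  by have := nest 0%N k; rewrite addn0 /= expr0 divr1 /L (addrC a) subrK.
have := xP k; have := sbad k; move: (Lk k) => Lk0 bk /andP[x1 x2].
have b1 := dP (s k) ltac:(move: sab; lra) ltac:(rewrite ler0_norm; lra).
have b2 := dP (s k + L / 2 ^+ k) ltac:(move: sab; lra) ltac:(rewrite ger0_norm; lra).
have := ler_nr_dist (g (s k + L / 2 ^+ k)) (g x) (g (s k)).
rewrite (nrBC (g x)); move: b1 b2 bk.
rewrite ler0_norm ?subr_le0 // ger0_norm ?subr_ge0 //.
move: (nr _) (nr _) (nr _) => n1 n2 n3; lra.
Qed.

Lemma diff0_constant (V W : normedModType R[i]) (f : V -> W) (p : V) (rho : R) :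
  (forall z, nr (z - p) < rho -> differentiable f z /\ forall v, 'd f z v = 0) ->
  forall z, nr (z - p) < rho -> f z = f p.
Proof.
move=> df z zr; pose g (t : R) := f (p + t%:C *: (z - p)).
suff : g 0 = g 1 by rewrite /g scale0r scale1r addr0 (addrC p) subrK.
apply: flat_path => // x /andP[x0 x1] e e0.
have xr : nr (p + x%:C *: (z - p) - p) < rho.
  rewrite addrC addKr nrZ normc_real ger0_norm //; apply: le_lt_trans zr.
  by rewrite ler_piMl ?nr_ge0.
have [dfx d0] := df _ xr.
have n1 : 0 < nr (z - p) + 1 by rewrite ltr_wpDl ?nr_ge0.
have [d d00 dP] := differentiable_nrP dfx (divr_gt0 e0 n1).
exists (d / (nr (z - p) + 1)); first by rewrite divr_gt0.
move=> y _; rewrite ltr_pdivlMr // => yd.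
have hn : nr ((y - x)%:C *: (z - p)) <= `|y - x| * (nr (z - p) + 1).
  by rewrite nrZ normc_real ler_wpM2l // lerDl.
have := dP _ (le_lt_trans hn yd); rewrite d0 subr0 -addrA -scalerDl -rmorphD /=.
rewrite (addrC x) subrK => h; apply: le_trans h _.
by rewrite mulrAC ler_pdivrMr // -mulrA ler_pM2l.
Qed.

End flat.

Section division.
Context {R : realType}.
Implicit Types (f g h : R[i] -> R[i]).

Definition slope h (a z : R[i]) : R[i] :=
  if z == a then 'd h a 1 else (h z - h a) / (z - a).

Lemma slopeE h a z : h z - h a = (z - a) * slope h a z.
Proof.
rewrite /slope; have [->|za] := eqVneq z a; first by rewrite !subrr mul0r.
by rewrite mulrC divfK // subr_eq0.
Qed.

Lemma differentiable_slope_neq h a z : z != a -> differentiable h z ->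
  differentiable (slope h a) z.
Proof.
move=> za dh; apply: (@near_eq_differentiable _ _ _ (fun w => (h w - h a) / (w - a))).
  apply/nbhs_nrP; exists (normc (z - a)); first by rewrite normc_gt0 subr_eq0.
  move=> y; rewrite nr_normc /slope; have [->|//] := eqVneq y a.
  by rewrite normcBC ltxx.
have za0 : z - a != 0 by rewrite subr_eq0.
apply: differentiable_mulc.
  by apply: differentiable_subv; [exact: dh|exact: differentiable_cstv].
exact: differentiable_invc.
Qed.

Lemma differentiable_bigsum (V : normedModType R[i]) (I : Type) (r : seq I)
    (F : I -> V -> R[i]) z : (forall i, differentiable (F i) z) ->
  differentiable (fun w => \sum_(i <- r) F i w) z.
Proof.
move=> dF; elim: r => [|i r ih].
  by under eq_fun do rewrite big_nil; exact: differentiable_cstv.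
by under eq_fun do rewrite big_cons; exact: differentiable_addv.
Qed.

Lemma differentiable_bigprod (V : normedModType R[i]) (I : Type) (r : seq I)
    (F : I -> V -> R[i]) z : (forall i, differentiable (F i) z) ->
  differentiable (fun w => \prod_(i <- r) F i w) z.
Proof.
move=> dF; elim: r => [|i r ih].
  by under eq_fun do rewrite big_nil; exact: differentiable_cstv.
by under eq_fun do rewrite big_cons; exact: differentiable_mulc.
Qed.

Lemma differentiable_slope h a rho : 0 < rho ->
  (forall z, normc (z - a) < rho -> differentiable h z) ->
  differentiable (slope h a) a.
Proof.
move=> rho0 dh; have aa : normc (a - a) < rho by rewrite subrr -nr_normc nr0.
have [d d0 dP] := locally_bounded (dh a aa).
pose r := Num.min rho d; pose M := normc (h a) + 1.
have r0 : 0 < r by rewrite lt_min rho0.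
have rr : r <= rho by rewrite ge_min lexx.
have rd : r <= d by rewrite ge_min lexx orbT.
have dh' z : normc (z - a) < r -> differentiable h z by move=> zr; apply: dh; exact: lt_le_trans rr.
have bh z : normc (z - a) < r -> normc (h z) <= M by move=> zr; apply: dP; exact: lt_le_trans rd.
clearbody r M; clear dP d0 rd rr.
(* The slope is the mean of the derivative along [a, z]; its Riemann sums are
   holomorphic and converge uniformly. *)
pose pt n j z : R[i] := a + (j%:R / n.+1%:R) * (z - a).
pose F n z := (n.+1%:R)^-1 * \sum_(j < n.+1) 'd h (pt n j z) 1.
have N0 n : (n.+1%:R : R[i]) != 0 by rewrite pnatr_eq0.
have normN n : normc (n.+1%:R : R[i]) = n.+1%:R.
  by rewrite (_ : n.+1%:R = (n.+1%:R : R)%:C) ?normc_real ?ger0_norm ?ler0n // rmorph_nat.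
have ptr n (j : 'I_n.+1) z : normc (pt n j z - a) <= normc (z - a).
  rewrite /pt addrC addKr normcM ler_piMl ?normc_ge0 // normcM normcV normN.
  have -> : normc (j%:R : R[i]) = j%:R.
    by rewrite (_ : j%:R = (j%:R : R)%:C) ?normc_real ?ger0_norm ?ler0n // rmorph_nat.
  by rewrite ler_pdivrMr ?ltr0n // mul1r ler_nat ltnW.
(* By [taylor2], replacing the slope of [h] over one piece of length [normc s] by the derivative at
   its start costs at most [K * normc s]; the mean over the pieces inherits this bound. *)
pose K := 128 * M / r ^+ 2.
have M0 : 0 <= M by apply: le_trans (normc_ge0 _) (bh a _); rewrite subrr -nr_normc nr0.
have K0 : 0 <= K by rewrite divr_ge0 ?mulr_ge0 ?exprn_ge0 // ltW.
apply: (@weierstrass _ _ F _ _ (r / 16)); first by rewrite divr_gt0.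
  move=> n z zr; apply: differentiable_mulc; first exact: differentiable_cstv.
  apply: differentiable_bigsum => j.
  apply: (@differentiable_comp _ _ _ _ (pt n j) (fun w => 'd h w 1)).
    apply: differentiable_addv; first exact: differentiable_cstv.
    apply: differentiable_mulc; first exact: differentiable_cstv.
    exact: differentiable_subv (differentiable_idv _) (differentiable_cstv _ _).
  have r2 : 0 < r / 2 by rewrite divr_gt0.
  apply: (@diff_holomorphic R R[i] h (pt n j z) 1 (r / 2) r2) => w; rewrite nr_normc => wr; apply: dh'.
  have := ler_normc_dist w (pt n j z) a; have := ptr n j z.
  rewrite nr_normc in zr; move: wr zr; clear - r0.
  by move: (normc _) (normc _) (normc _) (normc _) => x1 x2 x3 x4; lra.
move=> e e0; have [n0 n0P] : exists n0, forall n, (n0 <= n)%N -> K * (r / n.+1%:R) <= e.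
  exists (Num.bound (K * r / e)) => n nn.
  have h0 := archi_boundP (divr_ge0 (mulr_ge0 K0 (ltW r0)) (ltW e0)).
  rewrite mulrA ler_pdivrMr ?ltr0n // (mulrC e) -ler_pdivrMr //; apply: le_trans (ltW h0) _.
  by rewrite ler_nat (leq_trans nn).
exists n0 => n nn z zr; apply: le_trans (n0P n nn).
have [->|za] := eqVneq z a.
  rewrite /slope eqxx /F /pt.
  under eq_bigr do rewrite subrr mulr0 addr0.
  rewrite sumr_const card_ord -['d h a 1 *+ _]mulr_natl mulKf // subrr -nr_normc nr0.
  by rewrite mulr_ge0 // divr_ge0 // ltW.
pose s := (z - a) / n.+1%:R.
have s0 : s != 0 by rewrite mulf_neq0 ?invr_eq0 // subr_eq0.
have ns : normc s = normc (z - a) / n.+1%:R by rewrite normcM normcV normN.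
have ptS j : pt n j.+1 z = pt n j z + s.
  by rewrite /pt /s -natr1; field.
have tele : h z - h a = \sum_(j < n.+1) (h (pt n j z + s) - h (pt n j z)).
  transitivity (h (pt n n.+1 z) - h (pt n 0%N z)).
    by rewrite /pt mulfV // mul1r mul0r mul0r addr0 (addrC a) subrK.
  rewrite -(big_mkord xpredT (fun j => h (pt n j z + s) - h (pt n j z))) /=.
  rewrite -(@telescope_sumr _ 0%N n.+1 (fun j => h (pt n j z))) //.
  by apply: eq_bigr => j _; rewrite ptS.
have -> : F n z - slope h a z = - ((n.+1%:R)^-1 *
    \sum_(j < n.+1) ((h (pt n j z + s) - h (pt n j z) - 'd h (pt n j z) 1 * s) / s)).
  have E : slope h a z = (n.+1%:R)^-1 * \sum_(j < n.+1) ((h (pt n j z + s) - h (pt n j z)) / s).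
    by rewrite /slope (negbTE za) tele -mulr_suml {3}/s invf_div mulrCA mulKf.
  rewrite E /F -mulrBr -sumrB -mulrN -sumrN; congr (_ * _); apply: eq_bigr => j _.
  by rewrite [in RHS]mulrBl mulfK // opprB.
rewrite normcN normcM normcV normN ler_pdivrMl ?ltr0n //.
have -> : n.+1%:R * (K * (r / n.+1%:R)) = \sum_(j < n.+1) K * (r / n.+1%:R).
  by rewrite sumr_const card_ord -[RHS]mulr_natl.
have zr' : normc (z - a) < r / 16 := zr.
have sr : nr s < r / 16.
  rewrite nr_normc ns; apply: le_lt_trans zr'.
  by rewrite ler_pdivrMr ?ltr0n // ler_peMr ?normc_ge0 // ler1n.
elim/big_ind2: _ => [|x1 x2 y1 y2 h1 h2|j _]; first by rewrite -nr_normc nr0.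
  by apply: le_trans (ler_normcD _ _) _; exact: lerD.
have pr : nr (pt n j z - a) < r / 16 := le_lt_trans (ptr n j z) zr'.
have := taylor2 dh' bh pr sr.
rewrite diff_complexE (mulrC s).
rewrite normcM normcV nr_normc -/K => hs; rewrite ler_pdivrMr ?normc_gt0 //.
apply: (le_trans hs); rewrite expr2 mulrA ler_wpM2r ?normc_ge0 // ler_wpM2l //.
rewrite ns ler_pM2r ?invr_gt0 ?ltr0n //; apply: ltW; apply: (lt_trans zr').
by rewrite ltr_pdivrMr // ltr_pMr // ltr1n.
Qed.

Lemma slope_holomorphic h a p rho : normc (a - p) < rho ->
  (forall z, normc (z - p) < rho -> differentiable h z) ->
  forall z, normc (z - p) < rho -> differentiable (slope h a) z.
Proof.
move=> ar dh z zr; have [->|za] := eqVneq z a; last first.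
  by apply: differentiable_slope_neq => //; exact: dh.
apply: (@differentiable_slope _ _ (rho - normc (a - p))); first by rewrite subr_gt0.
move=> w wr; apply: dh; apply: le_lt_trans (ler_normc_dist w a p) _.
by rewrite -ltrBrDr.
Qed.

Lemma sphere_min_gt0 (g : R[i] -> R[i]) (p : R[i]) (r : R) : 0 <= r ->
  (forall z, normc (z - p) = r -> {for z, continuous g}) ->
  (forall z, normc (z - p) = r -> g z != 0) ->
  exists2 m, 0 < m & forall z, normc (z - p) = r -> m <= normc (g z).
Proof.
move=> r0 cg g0.
have cS : compact [set z : R[i] | normc (z - p) = r].
  apply: (subclosed_compact _ (@compact_closed_disc R p r)) => [|z /= ->//].
  move=> z zcl; apply/eqP/negPn/negP => zr.
  have e0 : 0 < `|normc (z - p) - r| by rewrite normr_gt0 subr_eq0.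
  have [|y [/= yr yz]] := zcl [set y | normc (y - z) < `|normc (z - p) - r|].
    by apply/nbhs_nrP; exists `|normc (z - p) - r|.
  have := lerB_normc (y - p) (z - p); have := lerB_normc (z - p) (y - p).
  have -> : y - p - (z - p) = y - z by rewrite opprB addrA subrK.
  have -> : z - p - (y - p) = z - y by rewrite opprB addrA subrK.
  rewrite (normcBC z y) yr => h1 h2; move: yz; rewrite ltNge => /negP; apply.
  by rewrite ler_norml; lra.
have S0 : [set z : R[i] | normc (z - p) = r] !=set0.
  by exists (p + r%:C); rewrite /= addrC addKr normc_real ger0_norm.
have [|c /= cr cmax] := @compact_sup_attained R R[i] [set z | normc (z - p) = r]
    (fun z => - normc (g z)) cS S0.
  apply: continuous_in_subspaceT => z; rewrite inE /= => zr U /nbhs_normP[e /= e0 eP].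
  have [d d0 dP] := (continuous_nrP g z).1 (cg z zr) e e0.
  apply/nbhs_nrP; exists d => // w /dP; rewrite nr_normc => we; apply: eP.
  rewrite /= opprK; apply: le_lt_trans we.
  have := lerB_normc (g z) (g w); have := lerB_normc (g w) (g z).
  by rewrite (normcBC (g z)) addrC ler_norml; lra.
exists (normc (g c)); first by rewrite normc_gt0; exact: g0.
by move=> z /cmax; rewrite lerN2.
Qed.

(** If the derivative at [a] is nonzero, injectivity makes [slope h a] free of zeros, and the
    maximum principle for its reciprocal bounds that derivative below by [m / (4 * d)], uniformly
    for [a] near [0]. A zero derivative at [0] would by continuity force derivatives below this
    bound, hence zero, near [0]; then [h] would be constant there. *)
Lemma complex_injective_diff_neq0 h rho : 0 < rho ->
  (forall z, normc z < rho -> differentiable h z) ->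
  (forall z w, normc z < rho -> normc w < rho -> h z = h w -> z = w) ->
  'd h 0 1 != 0.
Proof.
move=> rho0 dh ih; apply/eqP => h0.
have dh0 z : normc (z - 0) < rho -> differentiable h z by rewrite subr0; exact: dh.
pose d := rho / 2; have d0 : 0 < d by rewrite divr_gt0.
have dr : d < rho by rewrite ltr_pdivrMr // ltr_pMr // ltr1n.
have n0 : normc (0 : R[i]) = 0 by rewrite -nr_normc nr0.
have r00 : normc (0 : R[i]) < rho by rewrite n0.
have [m m0 mP] : exists2 m, 0 < m & forall z, normc (z - 0) = d -> m <= normc (h z - h 0).
  apply: (@sphere_min_gt0 (fun z => h z - h 0)); first exact: ltW.
    move=> z zd; apply: differentiable_continuous; apply: differentiable_subv.
      by apply: dh0; rewrite zd.
    exact: differentiable_cstv.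
  move=> z zd; rewrite subr_eq0; apply/eqP => hz.
  have := ih z 0 _ r00 hz; rewrite subr0 in zd; rewrite zd => /(_ dr) z0.
  by move: zd d0; rewrite z0 n0 => <-; rewrite ltxx.
have ch0 := (continuous_nrP h 0).1 (differentiable_continuous (dh 0 r00)) (m / 2) (divr_gt0 m0 (ltr0n _ 2)).
have [d1 d10 d1P] := ch0.
have [D DE dD] : exists2 D : R[i] -> R[i], (forall z, D z = 'd h z 1) & differentiable D 0.
  by exists (fun z => 'd h z 1) => //; apply: (@diff_holomorphic R R[i] h 0 1 rho rho0) => z; exact: dh0.
have D0 : D 0 = 0 by rewrite DE.
have mq : 0 < m / (4 * d) by rewrite divr_gt0 // mulr_gt0.
have [d2 d20 d2P] := (continuous_nrP _ _).1 (differentiable_continuous dD) _ mq.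
pose d3 := Num.min d (Num.min d1 d2).
have d30 : 0 < d3 by rewrite !lt_min d0 d10.
have flat a : normc a < d3 -> 'd h a 1 = 0.
  rewrite !lt_min => /and3P[ad ad1 ad2]; apply/eqP/negPn/negP => ha.
  have ar : normc a < rho := lt_trans ad dr.
  have ar0 : normc (a - 0) < rho by rewrite subr0.
  have dq := slope_holomorphic ar0 dh0.
  have q0 z : normc z < rho -> slope h a z != 0.
    move=> zr; rewrite /slope; have [//|za] := eqVneq z a.
    rewrite mulf_neq0 ?invr_eq0 ?subr_eq0 //; apply: contra_neq za; exact: ih.
  have := @max_principle R (fun z => (slope h a z)^-1) 0 d (4 * d / m) _ _ _ a.
  have dqi z : normc (z - 0) < rho -> differentiable (fun z => (slope h a z)^-1) z.
    by move=> zr; apply: differentiable_invc; [exact: dq|apply: q0; rewrite subr0 in zr].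
  move=> /(_ _ _ _ _)-mp.
  have {mp} : normc (slope h a a)^-1 <= 4 * d / m.
    apply: mp.
    - by move=> c cd; apply: differentiable_continuous; apply: dqi; exact: le_lt_trans dr.
    - move=> c cd; exists (rho - normc (c - 0)); first by rewrite subr_gt0 (lt_trans cd).
      move=> z /andP[_ zr]; apply: dqi; apply: le_lt_trans (ler_normc_dist z c 0) _.
      by rewrite -ltrBrDr.
    - move=> z zd; have zr : normc z < rho by rewrite subr0 in zd; rewrite zd.
      have := mP z zd; have := d1P a; rewrite !nr_normc subr0 => /(_ ad1) ha1 hz.
      have hza : m / 2 <= normc (h z - h a).
        have := lerB_normc (h z - h 0) (h a - h 0).
        by have -> : h z - h 0 - (h a - h 0) = h z - h a; [by rewrite opprB addrA subrK|lra].
      have zan : normc (z - a) <= 2 * d.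
        apply: le_trans (ler_normcB _ _) _; rewrite subr0 in zd; rewrite zd; lra.
      have qn := q0 z zr; rewrite normcV; have := slopeE h a z.
      move=> /(congr1 (@normc R)); rewrite normcM => e.
      have q1 : 0 < normc (slope h a z) by rewrite normc_gt0.
      rewrite -[X in X <= _]mul1r ler_pdivrMr // mulrAC ler_pdivlMr // mul1r.
      have := ler_wpM2r (ltW q1) zan; rewrite -e; lra.
    - by rewrite subr0 ltW.
  rewrite /slope eqxx; move: ha; rewrite -DE => ha.
  rewrite normcV -[X in X <= _]mul1r ler_pdivrMr ?normc_gt0 // mulrAC ler_pdivlMr // mul1r.
  have := d2P a; rewrite !nr_normc subr0 D0 subr0 => /(_ ad2).
  rewrite ltr_pdivlMr ?mulr_gt0 // (mulrC (normc _)) => /lt_le_trans/[apply].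
  by rewrite ltxx.
have [t [t0 tn]] : exists t : R[i], t != 0 /\ normc t < d3.
  exists (d3 / 2)%:C; rewrite normc_real gtr0_norm ?divr_gt0 //; split.
    by rewrite (inj_eq (@complexI R)) gt_eqF // divr_gt0.
  by rewrite ltr_pdivrMr // ltr_pMr // ltr1n.
have d3r : d3 <= rho by rewrite ge_min (ltW dr).
have tr : normc t < rho by apply: lt_le_trans tn d3r.
move/eqP: t0; apply; apply: ih => //.
apply: (@diff0_constant R R[i] R[i] h 0 d3); last by rewrite subr0.
move=> z; rewrite subr0 => zd; split; first by apply: dh; apply: lt_le_trans zd d3r.
by move=> v; rewrite diff_complexE (flat z zd) mulr0.
Qed.

End division.

(** * Vanishing order along lines *)

Section vanishing_order.
Context {R : realType}.
Implicit Types (f g h : R[i] -> R[i]).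

(* If every division by [t] succeeds, the quotients [h t / t ^ k] are bounded
   on a circle by [M / d ^ k], so [h] vanishes inside it. *)
Lemma order_exists h rho M : 0 < rho ->
  (forall t, normc t < rho -> differentiable h t) ->
  (forall t, normc t < rho -> normc (h t) <= M) ->
  (exists t, normc t < rho /\ h t != 0) ->
  exists k g, [/\ forall t, normc t < rho -> differentiable g t,
    forall t, normc t < rho -> h t = t ^+ k * g t & g 0 != 0].
Proof.
move=> rho0 dh bh [t0 [t0r ht0]]; apply: contrapT => none.
have n0 : normc (0 : R[i]) = 0 by rewrite -nr_normc nr0.
have div k : exists g, (forall t, normc t < rho -> differentiable g t) /\
    forall t, normc t < rho -> h t = t ^+ k * g t.
  elim: k => [|k [g [dg hg]]].
    by exists h; split=> // t _; rewrite expr0 mul1r.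
  exists (slope g 0); split.
    have dg0 z : normc (z - 0) < rho -> differentiable g z by rewrite subr0; exact: dg.
    have r0 : normc (0 - 0 : R[i]) < rho by rewrite subr0 n0.
    by move=> t tr; apply: (slope_holomorphic r0 dg0); rewrite subr0.
  move=> t tr; rewrite hg // exprSr -mulrA; congr (_ * _).
  have := slopeE g 0 t; rewrite subr0 => <-.
  suff -> : g 0 = 0 by rewrite subr0.
  by apply/eqP/negPn/negP => g0; apply: none; exists k, g.
have M0 : 0 <= M := le_trans (normc_ge0 _) (bh t0 t0r).
have [d [d0 td dr]] : exists d : R, [/\ 0 < d, normc t0 < d & d < rho].
  exists ((normc t0 + rho) / 2); have := normc_ge0 t0.
  by move: (normc t0) t0r => x xr x0; split; lra.
have bd k : normc (h t0) <= M * (normc t0 / d) ^+ k.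
  have [g [dg hg]] := div k.
  have : normc (g t0) <= M / d ^+ k.
    apply: (@max_principle R g 0 d); last by rewrite subr0 ltW.
    - move=> c; rewrite subr0 => cd; apply: differentiable_continuous; apply: dg.
      exact: le_lt_trans dr.
    - move=> c; rewrite subr0 => cd; exists (rho - normc c); first by rewrite subr_gt0 (lt_trans cd).
      move=> z /andP[_ zr]; apply: dg; have := ler_normc_dist z c 0; rewrite !subr0.
      by move: zr; move: (normc _) (normc _) (normc _) => x y z'; lra.
    - move=> z; rewrite subr0 => zd; have zr : normc z < rho by rewrite zd.
      have := bh z zr; rewrite hg // normcM normcX zd => h1.
      by rewrite ler_pdivlMr ?exprn_gt0 // mulrC.
  rewrite hg // normcM normcX exprMn exprVn => h1.
  rewrite mulrCA; apply: ler_wpM2l => //; exact: exprn_ge0 (normc_ge0 _).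
have q1 : `|normc t0 / d| < 1.
  by rewrite ger0_norm ?divr_ge0 ?normc_ge0 ?(ltW d0) // ltr_pdivrMr // mul1r.
have hp : 0 < normc (h t0) by rewrite normc_gt0.
have M1 : 0 < M + 1 by lra.
have [k _ /(_ k (leqnn k))] : (\forall k \near \oo, `|0 - (normc t0 / d) ^+ k| < normc (h t0) / (M + 1)).
  have := cvg_expr q1; move=> /cvgrPdist_lt; apply; exact: divr_gt0.
rewrite /= sub0r normrN ger0_norm ?exprn_ge0 ?divr_ge0 ?normc_ge0 ?(ltW d0) //.
rewrite ltr_pdivlMr // => hk; have := bd k.
have e0 : 0 <= (normc t0 / d) ^+ k by rewrite exprn_ge0 ?divr_ge0 ?normc_ge0 ?(ltW d0).
move: (_ ^+ k) e0 hk => x x0 hk; have : x * (M + 1) = M * x + x by ring.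
lra.
Qed.

Definition der f : R[i] -> R[i] := fun z => 'd f z 1.

Lemma cder_der f z a : cder f z a -> der f z = a.
Proof. by move=> /cder_differentiable[]. Qed.

Lemma der_near f g z : (\forall w \near z, f w = g w) -> differentiable f z ->
  der f z = der g z.
Proof.
move=> /nbhs_nrP[r r0 fg] /differentiable_cder dg; symmetry; apply: cder_der.
move=> e e0; have [d d0 dP] := dg e e0.
exists (Num.min r d); first by rewrite lt_min r0.
move=> h; rewrite lt_min => /andP[hr hd]; rewrite -fg; last by rewrite addrC addKr.
by rewrite -fg; [exact: dP|rewrite subrr nr0].
Qed.

Lemma cderM f g z a b : cder f z a -> cder g z b ->
  cder (fun w => f w * g w) z (a * g z + f z * b).
Proof.
move=> fa gb e e0; pose K := normc (g z) + 1 + normc (f z) + normc a + 1.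
have K0 : 0 < K by rewrite ltr_wpDl // !addr_ge0 ?normc_ge0.
have [d1 d10 d1P] := fa _ (divr_gt0 e0 K0).
have [d2 d20 d2P] := gb _ (divr_gt0 e0 K0).
have ek : 0 < Num.min 1 (e / K) by rewrite lt_min ltr01 divr_gt0.
have [d3 d30 d3P] := (continuous_nrP _ _).1 (cder_continuous gb) _ ek.
exists (Num.min d1 (Num.min d2 d3)); first by rewrite !lt_min d10 d20.
move=> h; rewrite !lt_min => /and3P[/d1P h1 /d2P h2 h3].
have zh : z + h - z = h by rewrite addrAC subrr add0r.
have := d3P (z + h); rewrite zh => /(_ h3); rewrite lt_min nr_normc => /andP[g1 g2].
have -> : f (z + h) * g (z + h) - f z * g z - (a * g z + f z * b) * h =
  (f (z + h) - f z - a * h) * g (z + h) + f z * (g (z + h) - g z - b * h) +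
  a * h * (g (z + h) - g z) by ring.
have g3 : normc (g (z + h)) <= normc (g z) + 1.
  by have := lerB_normc (g (z + h)) (g z); lra.
set eps := e / K in h1 h2 g2 *.
have b1 : normc ((f (z + h) - f z - a * h) * g (z + h)) <= eps * normc h * (normc (g z) + 1).
  by rewrite normcM ler_pM ?normc_ge0.
have b2 : normc (f z * (g (z + h) - g z - b * h)) <= eps * normc h * normc (f z).
  by rewrite normcM mulrC ler_wpM2r ?normc_ge0.
have b3 : normc (a * h * (g (z + h) - g z)) <= eps * normc h * normc a.
  rewrite !normcM (mulrC (normc a)) mulrAC; apply: ler_wpM2r; first exact: normc_ge0.
  by rewrite mulrC; apply: ler_wpM2r (ltW g2); exact: normc_ge0.
apply: le_trans (ler_normcD _ _) _; apply: le_trans (lerD (ler_normcD _ _) (lexx _)) _.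
apply: le_trans (lerD (lerD b1 b2) b3) _; rewrite -!mulrDr.
have -> : e * normc h = eps * normc h * K by rewrite /eps; field; rewrite gt_eqF.
apply: ler_wpM2l; first by rewrite mulr_ge0 ?normc_ge0 // divr_ge0 // ltW.
by rewrite /K; lra.
Qed.

(** Differentiating [t ^+ k.+1 * g t] leaves [t ^+ k] times [k.+1%:R * g t + t * der g t], whose
    value at [0] is again nonzero, as the characteristic is zero. *)
Lemma iter_der_order k g h rho : 0 < rho ->
  (forall t, normc t < rho -> differentiable g t) ->
  (forall t, normc t < rho -> h t = t ^+ k * g t) -> g 0 != 0 ->
  iter k der h 0 != 0.
Proof.
have n0 : normc (0 : R[i]) = 0 by rewrite -nr_normc nr0.
have nearB t r : normc t < r -> forall P : R[i] -> Prop, (forall w, normc w < r -> P w) ->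
    \forall w \near t, P w.
  move=> tr P HP; apply/nbhs_nrP; exists (r - normc t); first by rewrite subr_gt0.
  move=> y; rewrite nr_normc => yt; apply: HP.
  by have := ler_normc_dist y t 0; rewrite !subr0; lra.
move=> rho0; elim: k g h => [|k ih] g h dg hg g0.
  by rewrite /= hg ?n0 // expr0 mul1r.
have dg1 t : normc t < rho -> differentiable (der g) t.
  move=> tr; apply: (@diff_holomorphic R R[i] g t 1 (rho - normc t)); first by rewrite subr_gt0.
  move=> z; rewrite nr_normc => zr; apply: dg.
  by have := ler_normc_dist z t 0; rewrite !subr0; lra.
pose g' t := k.+1%:R * g t + t * der g t.
rewrite iterSr; apply: (ih g').
- move=> t tr; apply: differentiable_addv; apply: differentiable_mulc.
  + exact: differentiable_cstv.
  + exact: dg.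
  + exact: differentiable_idv.
  + exact: dg1.
- have cX m (t : R[i]) : cder (fun w => w ^+ m.+1) t (m.+1%:R * t ^+ m).
    elim: m => [|m ihm].
      move=> e e0; exists 1 => // h' _.
      have -> : (t + h') ^+ 1 - t ^+ 1 - 1 * t ^+ 0 * h' = 0 by rewrite expr0 !expr1; ring.
      by rewrite n0 mulr_ge0 ?normc_ge0 // ltW.
    have cid' : cder (fun w : R[i] => w) t 1.
      move=> e e0; exists 1 => // h' _; have -> : t + h' - t - 1 * h' = 0 by ring.
      by rewrite n0 mulr_ge0 ?normc_ge0 // ltW.
    have := cderM cid' ihm.
    have -> : 1 * t ^+ m.+1 + t * (m.+1%:R * t ^+ m) = m.+2%:R * t ^+ m.+1.
      by rewrite mul1r mulrCA -exprS -[m.+2%:R]natr1 mulrDl mul1r addrC.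
    by under eq_fun do rewrite -exprS.
  move=> t tr; have dgt := differentiable_cder (dg t tr).
  have c1 := cderM (cX k t) dgt.
  have -> : der h t = der (fun w => w ^+ k.+1 * g w) t.
    symmetry; apply: der_near; last exact: (cder_differentiable c1).1.
    by apply: nearB tr _ _ => w wr; rewrite hg.
  by rewrite (cder_der c1) /g' -/(der g t) exprS; ring.
- rewrite /g' mul0r addr0 mulf_neq0 // pnatr_eq0 //.
Qed.

Definition dirder (V : normedModType R[i]) (v : V) (F : V -> R[i]) : V -> R[i] :=
  fun z => 'd F z v.

Lemma iter_dirder_holomorphic (V : normedModType R[i]) (v p : V) F rho k :
  (forall z, nr (z - p) < rho -> differentiable F z) ->
  forall z, nr (z - p) < rho -> differentiable (iter k (dirder v) F) z.
Proof.
move=> dF; elim: k => [|k ih] z zr; first exact: dF.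
apply: (@diff_holomorphic R V (iter k (dirder v) F) z v (rho - nr (z - p))).
  by rewrite subr_gt0.
move=> w wr; apply: ih; have := ler_nr_dist w z p; lra.
Qed.

(** Links the order of vanishing on one line to an iterate of [dirder v], which still makes sense
    off that line. *)
Lemma iter_dirder_line (V : normedModType R[i]) (v p q : V) F rho k t :
  (forall z, nr (z - p) < rho -> differentiable F z) -> nr (q + t *: v - p) < rho ->
  iter k der (fun s => F (q + s *: v)) t = iter k (dirder v) F (q + t *: v).
Proof.
move=> dF; elim: k t => // k ih t tr.
have dl := differentiable_line (@iter_dirder_holomorphic V v p F rho k dF _ tr).
rewrite !iterS /dirder -dl.2; symmetry; apply: der_near; last exact: dl.1.
have cl : {for t, continuous (fun s : R[i] => q + s *: v - p)}.
  apply/continuous_nrP => e e0; have v1 : 0 < nr v + 1 by rewrite ltr_wpDl ?nr_ge0.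
  exists (e / (nr v + 1)); first by rewrite divr_gt0.
  move=> s; rewrite ltr_pdivlMr // => st.
  have -> : q + s *: v - p - (q + t *: v - p) = (s - t) *: v.
    by rewrite opprB addrA subrK opprD addrA (addrC q) addrK scalerBl.
  rewrite nrZ; apply: le_lt_trans st; rewrite nr_normc ler_wpM2l ?normc_ge0 // lerDl //.
have r1 : 0 < rho - nr (q + t *: v - p) by rewrite subr_gt0.
have [d d0 dP] := (continuous_nrP _ _).1 cl _ r1.
apply/nbhs_nrP; exists d => // s /dP sd; symmetry; apply: ih.
by have := lerB_nr (q + s *: v - p) (q + t *: v - p); lra.
Qed.

End vanishing_order.

(** * Injective holomorphic maps are immersions *)

Section osgood.
Context {R : realType}.

(** If [J (z + t *: v)] had no zero with [normc t < d], its reciprocal would be at most [2 / m] on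
    the circle and hence at [t = 0]; but [J z] is closer than [m / 2] to [J q = 0]. *)
Lemma hurwitz (V : normedModType R[i]) (J : V -> R[i]) (p q v : V) (rho M d : R) :
  (forall z, nr (z - p) < rho -> differentiable J z) ->
  (forall z, nr (z - p) < rho -> normc (J z) <= M) ->
  0 < d -> nr (q - p) + d * nr v < rho / 4 ->
  (forall t, normc t = d -> J (q + t *: v) != 0) -> J q = 0 ->
  exists2 s : R, 0 < s & forall z, nr (z - q) < s ->
    exists2 t, normc t < d & J (z + t *: v) = 0.
Proof.
move=> dJ bJ d0 qd Jc Jq.
have rho0 : 0 < rho.
  have := nr_ge0 (q - p); have : 0 <= d * nr v by rewrite mulr_ge0 ?nr_ge0 // ltW.
  by lra.
have M0 : 0 <= M.
  apply: le_trans (normc_ge0 _) (bJ q _).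
  by have : 0 <= d * nr v; [rewrite mulr_ge0 ?nr_ge0 // ltW|lra].
have tv t : normc t <= d -> nr (t *: v) <= d * nr v.
  by move=> td; rewrite nrZ ler_wpM2r ?nr_ge0.
have inB z t : nr (z - q) < rho / 4 -> normc t <= d -> nr (z + t *: v - p) < rho / 2.
  move=> zq /tv td; have -> : z + t *: v - p = (z - q) + (q - p) + t *: v.
    by rewrite addrA subrK addrAC.
  have := ler_nrD (z - q + (q - p)) (t *: v); have := ler_nrD (z - q) (q - p); lra.
have half z : nr (z - p) < rho / 2 -> nr (z - p) < rho by lra.
have dl z t : nr (z - q) < rho / 4 -> normc t <= d ->
    differentiable (fun s : R[i] => J (z + s *: v)) t.
  by move=> zq td; apply: (differentiable_line _).1; apply: dJ; apply: half; exact: inB.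
have qq : nr (q - q) < rho / 4 by rewrite subrr nr0 divr_gt0.
have [m m0 mP] : exists2 m : R, 0 < m & forall t, normc (t - 0) = d -> m <= normc (J (q + t *: v)).
  apply: (@sphere_min_gt0 R (fun t => J (q + t *: v)) 0 d (ltW d0)) => t.
    rewrite subr0 => td; apply: differentiable_continuous; apply: dl => //; rewrite td //.
  by rewrite subr0; exact: Jc.
have M1 : 0 < 16 * (M + 1) by rewrite mulr_gt0 // ltr_wpDl.
exists (Num.min (rho / 4) (m * rho / (16 * (M + 1)))).
  by rewrite lt_min !divr_gt0 // mulr_gt0.
move=> z; rewrite lt_min => /andP[zq zm]; rewrite ltr_pdivlMr // in zm.
apply: contrapT => none.
have close t : normc t <= d -> normc (J (z + t *: v) - J (q + t *: v)) < m / 2.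
  move=> td; have := hol_lipschitz dJ bJ (inB q t qq td) (inB z t zq td).
  have -> : z + t *: v - (q + t *: v) = z - q by rewrite opprD addrACA subrr addr0.
  have := mulr_ge0 M0 (nr_ge0 (z - q)); have := nr_ge0 (z - q); move: zm.
  move: (nr _) (normc _) => x y h1 h2 h3 h4.
  rewrite -(ltr_pM2l rho0); apply: le_lt_trans h4 _.
  by clear -h1 h2 h3; lra.
have nz t : normc t <= d -> J (z + t *: v) != 0.
  rewrite le_eqVlt => /predU1P[td|td].
    have := close t ltac:(by rewrite td); have := mP t; rewrite subr0 => /(_ td) h1 h2.
    apply/eqP => Jz; move: h2; rewrite Jz sub0r normcN; lra.
  by apply/eqP => Jz; apply: none; exists t.
have := @max_principle R (fun t => (J (z + t *: v))^-1) 0 d (2 / m) _ _ _ 0.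
have n0 : normc (0 : R[i]) = 0 by rewrite -nr_normc nr0.
have dinv t : normc t <= d -> differentiable (fun s : R[i] => (J (z + s *: v))^-1) t.
  by move=> td; apply: differentiable_invc; [exact: dl|exact: nz].
move=> /(_ _ _ _ _)-mp.
have {mp} : normc (J (z + 0 *: v))^-1 <= 2 / m.
  apply: mp.
  - by move=> c; rewrite subr0 => cd; apply: differentiable_continuous; exact: dinv.
  - move=> c; rewrite subr0 => cd; exists (d - normc c); first by rewrite subr_gt0.
    move=> t /andP[_ td]; apply: dinv; have := ler_normc_dist t c 0; rewrite !subr0; lra.
  - move=> t; rewrite subr0 => td.
    have := close t ltac:(by rewrite td); have := mP t; rewrite subr0 => /(_ td) h1 h2.
    have := lerB_normc (J (q + t *: v)) (J (z + t *: v)); rewrite normcBC => h3.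
    have h4 : m / 2 <= normc (J (z + t *: v)) by lra.
    have m2 : 0 < m / 2 by rewrite divr_gt0.
    rewrite normcV -[2 / m]invf_div lef_pV2 ?posrE //; exact: lt_le_trans h4.
  - by rewrite subr0 n0 ltW.
have m2 : 0 < m / 2 by rewrite divr_gt0.
have d00 : normc (0 : R[i]) <= d by rewrite n0 ltW.
have := close 0 d00; have := nz 0 d00; rewrite !scale0r !addr0 Jq subr0 => J0 h1.
rewrite normcV -[2 / m]invf_div lef_pV2 ?posrE ?normc_gt0 //.
by rewrite leNgt h1.
Qed.

Section jacobian.
Variable n : nat.
Local Notation V := 'rV[R[i]]_n.

Definition jac (f : V -> V) (z : V) : R[i] := \det (lin1_mx ('d f z)).

Lemma jac_neq0 (f : V -> V) z : jac f z != 0 -> forall v, 'd f z v = 0 -> v = 0.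
Proof.
move=> jz v; rewrite -mul_rV_lin1 => vz.
have uA : lin1_mx ('d f z) \in unitmx by rewrite unitmxE unitfE.
by rewrite -(mulmxK uA v) vz mul0mx.
Qed.

Lemma jac_eq0 (f : V -> V) z : (forall v, 'd f z v = 0 -> v = 0) -> jac f z != 0.
Proof.
move=> iz; rewrite -unitfE -unitmxE -row_free_unit; apply: inj_row_free => v.
by rewrite mul_rV_lin1; exact: iz.
Qed.

(** The entries are partial derivatives, holomorphic by [diff_holomorphic], and the determinant is a
    polynomial in them. *)
Lemma jac_holomorphic (f : V -> V) (p : V) (rho : R) :
  (forall z, nr (z - p) < rho -> differentiable f z) ->
  forall z, nr (z - p) < rho -> differentiable (jac f) z.
Proof.
move=> df z zr.
have dA i j : differentiable (fun w => lin1_mx ('d f w) i j) z.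
  apply: (@near_eq_differentiable _ _ _ (fun w => 'd (fun y => f y 0 j) w (delta_mx 0 i))).
    apply/nbhs_nrP; exists (rho - nr (z - p)); first by rewrite subr_gt0.
    move=> y yz; rewrite mxE; apply: (differentiable_coordv j (df y _)).2.
    by have := ler_nr_dist y z p; lra.
  apply: (@diff_holomorphic R V (fun y => f y 0 j) z _ (rho - nr (z - p))).
    by rewrite subr_gt0.
  move=> y yz; apply: (differentiable_coordv j (df y _)).1.
  by have := ler_nr_dist y z p; lra.
rewrite /jac /determinant; apply: differentiable_bigsum => s.
apply: differentiable_mulc; first exact: differentiable_cstv.
by apply: differentiable_bigprod => i; exact: dA.
Qed.

End jacobian.

Lemma diff_compv (U V W : normedModType R[i]) (f : U -> V) (g : V -> W) x u :
  differentiable f x -> differentiable g (f x) ->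
  'd (fun z => g (f z)) x u = 'd g (f x) ('d f x u).
Proof. by move=> df dg; exact: (congr1 (fun h : U -> W => h u) (diff_comp df dg)). Qed.

Lemma diff_compv_at (U V W : normedModType R[i]) (f : U -> V) (g : V -> W) x u y v :
  differentiable f x -> differentiable g y -> f x = y -> 'd f x u = v ->
  'd (fun z => g (f z)) x u = 'd g y v.
Proof. by move=> df dg fx fu; subst y v; exact: diff_compv. Qed.

Lemma coord_linear n (k : 'I_n) : linear (fun z : 'rV[R[i]]_n => z 0 k).
Proof. by move=> a u w; rewrite !mxE. Qed.

Definition osgood_property n := forall (f : 'rV[R[i]]_n -> 'rV[R[i]]_n) p (rho : R),
  0 < rho -> (forall z, nr (z - p) < rho -> differentiable f z) ->
  (forall z w, nr (z - p) < rho -> nr (w - p) < rho -> f z = f w -> z = w) ->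
  forall v, 'd f p v = 0 -> v = 0.

(* If some component [f_j] has a nonzero differential at [p], a chart
   straightens its level set, and the other components restrict to an
   injective map of one dimension less. *)
Lemma osgood_slice n : osgood_property n ->
  forall (f : 'rV[R[i]]_n.+1 -> 'rV[R[i]]_n.+1) p (rho : R),
  0 < rho -> (forall z, nr (z - p) < rho -> differentiable f z) ->
  (forall z w, nr (z - p) < rho -> nr (w - p) < rho -> f z = f w -> z = w) ->
  (exists w, 'd f p w != 0) -> forall v, 'd f p v = 0 -> v = 0.
Proof.
move=> IH f p rho rho0 df injf [w w0] v dv0.
have pp : nr (p - p) < rho by rewrite subrr nr0.
have [j wj] : exists j, 'd f p w 0 j != 0.
  apply: contrapT => h; move/eqP: w0; apply; apply/rowP => j; rewrite mxE.
  by apply: contrapT => /eqP wj; apply: h; exists j.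
have [i [l [dl lE li lv]]] : exists i (l : 'rV[R[i]]_n.+1 -> R[i]),
    [/\ forall z, nr (z - p) < rho -> differentiable l z, forall z, l z = f z 0 j,
        'd l p (delta_mx 0 i) != 0 & 'd l p v = 0].
  have dl z : nr (z - p) < rho -> differentiable (fun z => f z 0 j) z.
    by move=> zr; exact: (differentiable_coordv j (df z zr)).1.
  have [_ dE] := differentiable_coordv j (df p pp).
  suff [i hi] : exists i, 'd (fun z => f z 0 j) p (delta_mx 0 i) != 0.
    by exists i, (fun z => f z 0 j); split=> //; rewrite dE dv0 mxE.
  apply: contrapT => h; move/eqP: wj; apply; rewrite -dE (row_sum_delta w) linear_sum.
  apply: big1 => i _; rewrite linearZ /=; apply/eqP; rewrite mulf_eq0; apply/orP; right.
  by apply/negPn/negP => hi; apply: h; exists i.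
pose Phi (z : 'rV[R[i]]_n.+1) : 'rV[R[i]]_n.+1 := \row_k (if k == i then l z else z 0 k).
have dPhi z : nr (z - p) < rho -> differentiable Phi z.
  move=> zr; apply: differentiable_rV => k.
  under eq_fun do rewrite mxE.
  have [_|_] := eqVneq k i; first exact: dl.
  exact: (rV_linear_differentiable z (coord_linear k)).1.
have PhiE (u : 'rV[R[i]]_n.+1) k : 'd Phi p u 0 k = if k == i then 'd l p u else u 0 k.
  rewrite -(differentiable_coordv k (dPhi p pp)).2.
  under eq_fun do rewrite mxE.
  have [_|_] := eqVneq k i; first by [].
  by rewrite (rV_linear_differentiable p (coord_linear k)).2.
have dl_off (u : 'rV[R[i]]_n.+1) : (forall k, k != i -> u 0 k = 0) -> 'd l p u = 0 -> u = 0.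
  move=> uk lu; have uE : u = u 0 i *: delta_mx 0 i.
    apply/rowP => k; rewrite !mxE eqxx /=; have [->|ki] := eqVneq k i; first by rewrite mulr1.
    by rewrite mulr0 uk.
  move: lu; rewrite uE linearZ /= => /eqP; rewrite mulf_eq0 (negbTE li) orbF => /eqP ->.
  by rewrite scale0r.
have injPhi (u : 'rV[R[i]]_n.+1) : 'd Phi p u = 0 -> u = 0.
  move=> u0; apply: dl_off => [k ki|].
    by have := PhiE u k; rewrite u0 mxE (negbTE ki).
  by have := PhiE u i; rewrite u0 mxE eqxx.
have [d [eta [G [/andP[d0 drho] eta0 injd GP dG]]]] := inverse_function rho0 dPhi injPhi.
(* Inserts [c] as coordinate [i]. Thus [gam] below parametrises the level set of [l] through [p],
   and [K] is the restriction to it of the components of [f] other than [j]. *)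
pose ins (c : R[i]) (s : 'rV[R[i]]_n) : 'rV[R[i]]_n.+1 :=
  \row_k (if unlift i k is Some k' then s 0 k' else c).
pose s0 : 'rV[R[i]]_n := \row_k p 0 (lift i k).
have insP : ins (l p) s0 = Phi p.
  apply/rowP => k; rewrite !mxE; case: unliftP => [k' ->|->]; last by rewrite eqxx.
  by rewrite mxE eq_sym (negbTE (neq_lift _ _)).
have insB s : nr (s - s0) < eta -> nr (ins (l p) s - Phi p) < eta.
  apply: le_lt_trans; apply: nr_rV_le => [|k]; first exact: nr_ge0.
  rewrite -insP !mxE; case: unliftP => [k' _|_]; last by rewrite subrr -nr_normc nr0 nr_ge0.
  by have := nr_coord (s - s0) k'; rewrite !mxE.
pose gam s := G (ins (l p) s).
have gamP s : nr (s - s0) < eta -> nr (gam s - p) < rho /\ Phi (gam s) = ins (l p) s.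
  by move=> /insB /GP [h1 h2]; split=> //; exact: lt_le_trans drho.
have dins s : differentiable (ins (l p)) s.
  apply: differentiable_rV => k; under eq_fun do rewrite mxE.
  case: unliftP => [k' _|_]; last exact: differentiable_cstv.
  exact: (rV_linear_differentiable s (coord_linear k')).1.
have dgam s : nr (s - s0) < eta -> differentiable gam s.
  by move=> /insB sr; apply: (differentiable_comp (dins s)); exact: (dG _ sr).1.
have s00 : nr (s0 - s0) < eta by rewrite subrr nr0.
have gam0 : gam s0 = p.
  have [h1 h2] := GP _ (insB _ s00); apply: injd => //; first by rewrite subrr nr0.
  by rewrite -insP.
pose K s : 'rV[R[i]]_n := \row_k f (gam s) 0 (lift j k).
have dfg s : nr (s - s0) < eta -> differentiable (fun s => f (gam s)) s.
  move=> sr; apply: (differentiable_comp (dgam s sr)); apply: df; exact: (gamP s sr).1.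
have dK s : nr (s - s0) < eta -> differentiable K s.
  move=> sr; apply: differentiable_rV => k; under eq_fun do rewrite mxE.
  exact: (differentiable_coordv (lift j k) (dfg s sr)).1.
have injK s s' : nr (s - s0) < eta -> nr (s' - s0) < eta -> K s = K s' -> s = s'.
  move=> sr sr' KK; have [h1 h2] := gamP s sr; have [h1' h2'] := gamP s' sr'.
  have gg : gam s = gam s'.
    apply: injf => //; apply/rowP => k; have [->|kj] := eqVneq k j.
      rewrite -!lE; have := congr1 (fun x : 'rV[R[i]]_n.+1 => x 0 i) h2.
      have := congr1 (fun x : 'rV[R[i]]_n.+1 => x 0 i) h2'.
      by rewrite !mxE eqxx unlift_none => -> ->.
    have [k' kk] : exists k', k = lift j k'.
      by case: (unliftP j k) kj => [k' ->|->]; [exists k'|rewrite eqxx].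
    by have := congr1 (fun x : 'rV[R[i]]_n => x 0 k') KK; rewrite !mxE kk.
  apply/rowP => k; have := congr1 (fun x : 'rV[R[i]]_n.+1 => x 0 (lift i k)) (etrans (esym h2) (etrans (congr1 Phi gg) h2')).
  by rewrite !mxE liftK.
have IHK := IH K s0 eta eta0 dK injK.
(* As ['d l p v = 0], the vector [v] is tangent to the level set, and [u] is its preimage under
   ['d gam s0]. The induction hypothesis gives [u = 0], and [dl_off] recovers the remaining
   coordinate. *)
pose u : 'rV[R[i]]_n := \row_k v 0 (lift i k).
have dinsE : 'd (ins (l p)) s0 u = 'd Phi p v.
  apply/rowP => k; rewrite PhiE lv -(differentiable_coordv k (dins s0)).2.
  under eq_fun do rewrite mxE.
  case: unliftP => [k' ->|->].
    rewrite (rV_linear_differentiable s0 (coord_linear k')).2 mxE.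
    by rewrite eq_sym (negbTE (neq_lift _ _)).
  by rewrite eqxx; exact: (congr1 (fun h : 'rV[R[i]]_n -> R[i] => h u) (diff_cst _ _)).
have dgamE : 'd gam s0 u = v.
  have [dG0 dGE] := dG _ (insB _ s00).
  have e1 : 'd gam s0 u = 'd G (ins (l p) s0) ('d (ins (l p)) s0 u).
    exact: diff_compv.
  have e2 : 'd Phi p ('d gam s0 u) = 'd Phi p v.
    have := dGE ('d Phi p v); rewrite -/(gam s0) gam0 => e3.
    by apply: etrans e3; congr ('d Phi p _); rewrite e1; congr ('d G _ _).
  apply/eqP; rewrite -subr_eq0; apply/eqP; apply: injPhi.
  by rewrite (linear_subr (diff_linear Phi p)) e2 subrr.
have u0 : u = 0.
  apply: IHK; apply/rowP => k; rewrite -(differentiable_coordv k (dK s0 s00)).2 mxE.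
  under eq_fun do rewrite mxE.
  rewrite (differentiable_coordv (lift j k) (dfg s0 s00)).2.
  have -> : 'd (fun s => f (gam s)) s0 u = 'd f p v.
    exact: diff_compv_at (dgam _ s00) (df p pp) gam0 dgamE.
  by rewrite dv0 mxE.
apply: dl_off => // k ki; have [k' ->] : exists k', k = lift i k'.
  by case: (unliftP i k) ki => [k' ->|->]; [exists k'|rewrite eqxx].
by have := congr1 (fun x : 'rV[R[i]]_n => x 0 k') u0; rewrite !mxE.
Qed.

End osgood.

Section osgood_theorem.
Context {R : realType}.

(* The zero set of [J] near [q] is a graph in the direction [v] wherever some
   [h] vanishing on it has nonzero derivative along [v]; no multiplicity of [J]
   matters. *)
Lemma zero_set_path (V : normedModType R[i]) (J h A : V -> R[i]) (p q v w : V)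
    (rho M eps : R) :
  (forall z, nr (z - p) < rho -> differentiable J z) ->
  (forall z, nr (z - p) < rho -> normc (J z) <= M) ->
  nr (q - p) < rho / 8 -> J q = 0 -> 0 < eps ->
  (forall z, nr (z - q) < eps -> J z = 0 -> h z = 0) ->
  linear A -> A v != 0 ->
  (forall e : R, 0 < e -> exists2 d : R, 0 < d & forall x y,
    nr (x - q) < d -> nr (y - q) < d ->
    normc (h y - h x - A (y - x)) <= e * nr (y - x)) ->
  exists (s C : R) (t : R -> R[i]), [/\ 0 < s,
    forall x, 0 <= x <= s ->
      nr (q + x%:C *: w + t x *: v - q) < eps /\ J (q + x%:C *: w + t x *: v) = 0 &
    forall x y, 0 <= x <= s -> 0 <= y <= s ->
      nr (q + y%:C *: w + t y *: v - (q + x%:C *: w + t x *: v)) <= C * `|y - x|].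
Proof.
move=> dJ bJ qp Jq eps0 Jh lA Av hA.
have A0 : A 0 = 0 by have := lA (-1) 0 0; rewrite scaler0 addr0 scaleN1r addNr.
have AZ c u : A (c *: u) = c * A u by have := lA c u 0; rewrite !addr0 A0 addr0.
have AD u u' : A (u + u') = A u + A u' by have := lA 1 u u'; rewrite !scale1r.
have v0 : 0 < nr v.
  by rewrite nr_gt0; apply: contraNneq Av => ->; rewrite A0.
have arith (C b c V1 V2 X T E N1 N2 : R) : C * b = 2 * (c + E * V2) ->
    E * V1 = b / 2 -> 0 < b -> 0 < V1 -> 0 < E -> 0 <= V2 -> 0 <= c -> 0 <= X -> 0 <= T ->
    T * b - X * c <= N2 -> N1 <= X * V2 + T * V1 -> N2 <= E * N1 ->
    N1 <= (V2 + C * V1) * X.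
  clear=> h1 h2 b0 V0 E0 p1 p2 p3 p4 h3 h4 h5.
  have h6 : E * N1 <= E * (X * V2 + T * V1) by rewrite ler_pM2l.
  have h7 : E * (X * V2 + T * V1) = E * X * V2 + T * (b / 2) by rewrite -h2; ring.
  have h8 : T * b <= X * (2 * (c + E * V2)) by lra.
  have h9 : T <= C * X.
    by rewrite -(ler_pM2r b0) mulrAC h1 [_ * X]mulrC.
  have : T * V1 <= C * X * V1 by rewrite ler_pM2r.
  by lra.
have a0 : 0 < normc (A v) by rewrite normc_gt0.
(* With this error level, [A] dominates the remainder of [h] in the direction [v] by a factor of
   two. *)
pose e := normc (A v) / (2 * nr v).
have e0 : 0 < e by rewrite divr_gt0 // mulr_gt0.
have ev : e * nr v = normc (A v) / 2 by rewrite /e; field; rewrite gt_eqF.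
have [d d0 dP] := hA e e0.
have rho0 : 0 < rho by have := nr_ge0 (q - p); lra.
have [m [m0 md me mr]] : exists m : R, [/\ 0 < m, m <= d, m <= eps & m <= rho / 8].
  exists (Num.min d (Num.min eps (rho / 8))).
  by rewrite !lt_min d0 eps0 divr_gt0 // !ge_min !lexx !orbT.
pose d' := m / (4 * nr v).
have d'0 : 0 < d' by rewrite divr_gt0 // mulr_gt0.
have d'v : d' * nr v = m / 4 by rewrite /d'; field; rewrite gt_eqF.
have hq : h q = 0 by apply: Jh => //; rewrite subrr nr0.
have qq : nr (q - q) < d by rewrite subrr nr0.
have [s s0 sP] : exists2 s : R, 0 < s & forall z, nr (z - q) < s ->
    exists2 t, normc t < d' & J (z + t *: v) = 0.
  apply: (hurwitz dJ bJ d'0 _ _ Jq); first by rewrite d'v; lra.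
  (* A zero of [J] on the circle would be a zero of [h], and the strict estimate between it and [q]
     would give [normc (A v) <= normc (A v) / 2]. *)
  move=> t td; apply/eqP => Jt.
  have tm : nr (q + t *: v - q) = m / 4 by rewrite addrC addKr nrZ td.
  have ht : h (q + t *: v) = 0 by apply: Jh; rewrite ?tm //; lra.
  have := dP q (q + t *: v) qq; rewrite tm => /(_ ltac:(lra)).
  rewrite ht hq subrr sub0r normcN [q + _]addrC addrK AZ normcM td.
  have -> : e * (m / 4) = d' * (e * nr v) by rewrite -d'v; exact: mulrCA.
  by rewrite ev ler_pM2l // => h1; have := a0; lra.
pose W := nr w + 1; have W0 : 0 < W by rewrite ltr_wpDl ?nr_ge0.
have [s1 [s10 s1s s1m]] : exists s1 : R, [/\ 0 < s1, s1 * nr w < s & s1 * nr w < m / 2].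
  exists (Num.min s (m / 2) / W).
  have mm : 0 < Num.min s (m / 2) by rewrite lt_min s0 divr_gt0.
  have : Num.min s (m / 2) / W * nr w < Num.min s (m / 2).
    by rewrite mulrAC ltr_pdivrMr // ltr_pM2l // /W ltrDl.
  by rewrite lt_min => /andP[h1 h2]; rewrite divr_gt0.
(* The zeros are chosen arbitrarily; the Lipschitz property comes from [h] vanishing at all of
   them. *)
have [t tP] : {t : R -> R[i] & forall x, 0 <= x <= s1 ->
    normc (t x) < d' /\ J (q + x%:C *: w + t x *: v) = 0}.
  apply: (@choice R R[i] (fun x t => 0 <= x <= s1 -> normc t < d' /\ J (q + x%:C *: w + t *: v) = 0)).
  move=> x; have [xs|] := boolP (0 <= x <= s1); last by exists 0.
  have [|t t1 t2] := sP (q + x%:C *: w); last by exists t.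
  move: xs => /andP[x0 xs]; rewrite addrC addKr nrZ normc_real ger0_norm //.
  by apply: le_lt_trans s1s; rewrite ler_wpM2r ?nr_ge0.
have gB x : 0 <= x <= s1 -> nr (q + x%:C *: w + t x *: v - q) < m.
  move=> xs; have [t1 _] := tP x xs; move: xs => /andP[x0 xs].
  rewrite -(addrA q) (addrC q) addrK; apply: le_lt_trans (ler_nrD _ _) _.
  rewrite !nrZ normc_real ger0_norm //.
  have : x * nr w <= s1 * nr w by rewrite ler_wpM2r ?nr_ge0.
  have : normc (t x) * nr v <= d' * nr v by rewrite ler_wpM2r ?nr_ge0 // ltW.
  by rewrite d'v; have := m0; lra.
have gh x : 0 <= x <= s1 -> h (q + x%:C *: w + t x *: v) = 0.
  move=> xs; apply: Jh; last exact: (tP x xs).2.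
  exact: lt_le_trans (gB x xs) me.
have gE x y : q + y%:C *: w + t y *: v - (q + x%:C *: w + t x *: v) =
    (y - x)%:C *: w + (t y - t x) *: v.
  by rewrite opprD addrACA (opprD q) (addrACA q) subrr add0r -!scalerBl rmorphB.
pose C1 := 2 * (normc (A w) + e * nr w) / normc (A v).
exists s1, (nr w + C1 * nr v), t; split=> // [x xs|x y xs ys].
  by split; [exact: lt_le_trans (gB x xs) me|exact: (tP x xs).2].
have := dP _ _ (lt_le_trans (gB x xs) md) (lt_le_trans (gB y ys) md).
rewrite !gh // subrr sub0r normcN gE AD !AZ.
have := ler_nrD ((y - x)%:C *: w) ((t y - t x) *: v); rewrite !nrZ normc_real.
have := lerB_normc ((t y - t x) * A v) (- ((y - x)%:C * A w)).
rewrite opprK normcN !normcM normc_real (addrC (_ * A v)).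
have := normc_ge0 (t y - t x); have := normr_ge0 (y - x).
have := normc_ge0 (A w); have := nr_ge0 w.
have C1v : C1 * normc (A v) = 2 * (normc (A w) + e * nr w).
  by rewrite /C1 divfK // gt_eqF.
move=> p1 p2 p3 p4 h3 h4 h5; exact: arith C1v ev a0 v0 e0 p1 p2 p3 p4 h3 h4 h5.
Qed.

Lemma osgood_dim1 : @osgood_property R 1.
Proof.
move=> f p rho rho0 df injf v dv0; apply: contrapT => /eqP v0.
have nv : 0 < nr v by rewrite nr_gt0.
have r0 : 0 < rho / nr v by rewrite divr_gt0.
have inB t : normc t < rho / nr v -> nr (p + t *: v - p) < rho.
  by rewrite addrC addKr nrZ ltr_pdivlMr.
have dl t : normc t < rho / nr v -> differentiable (fun t : R[i] => f (p + t *: v)) t.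
  by move=> /inB /df /differentiable_line[].
have z0 : normc (0 : R[i]) < rho / nr v by rewrite -nr_normc nr0.
suff /eqP : 'd (fun t : R[i] => f (p + t *: v) 0 0) 0 1 != 0.
  apply; rewrite (differentiable_coordv 0 (dl 0 z0)).2.
  have dfp : differentiable f (p + 0 *: v) by apply: df; exact: inB.
  have := (differentiable_line dfp).2 => e.
  apply: etrans (congr1 (fun u : 'rV[R[i]]_1 => u 0 0) e) _.
  by rewrite scale0r addr0 dv0 mxE.
apply: (complex_injective_diff_neq0 r0).
- by move=> t tr; exact: (differentiable_coordv 0 (dl t tr)).1.
- move=> t t' tr tr' ff; apply/eqP; rewrite -subr_eq0; apply/eqP.
  have /(_ (inB t tr) (inB t' tr')) := injf (p + t *: v) (p + t' *: v).
  have -> : f (p + t *: v) = f (p + t' *: v) by apply/rowP => i; rewrite ord1.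
  move=> /(_ erefl) /addrI /eqP; rewrite -subr_eq0 -scalerBl scaler_eq0 (negbTE v0) orbF.
  by move/eqP.
Qed.

(** At a zero of the Jacobian the whole differential vanishes. Taking a zero [q] and a direction [v]
    of least vanishing order yields a function [h] that vanishes on nearby zeros and has ['d h q v]
    nonzero, so [zero_set_path] applies; [f] is constant along the path, although the path has
    distinct ends. *)
Lemma osgood_step n : @osgood_property R n.+1 -> @osgood_property R n.+2.
Proof.
move=> IH f p rho rho0 df injf v0 dv0; apply: contrapT => /eqP v00.
(* A nonzero differential would be injective by [osgood_slice], so the Jacobian would not vanish. *)
have Zd z : nr (z - p) < rho -> jac f z = 0 -> forall u, 'd f z u = 0.
  move=> zr Jz u; apply: contrapT => /eqP dzu; move/eqP: Jz; apply/negP.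
  have tri y : nr (y - z) < rho - nr (z - p) -> nr (y - p) < rho.
    by have := ler_nr_dist y z p; lra.
  apply: jac_eq0; apply: (osgood_slice IH (rho := rho - nr (z - p))).
  - by rewrite subr_gt0.
  - by move=> y /tri /df.
  - by move=> y y' /tri h /tri; exact: injf.
  - by exists u.
have pp : nr (p - p) < rho by rewrite subrr nr0.
have Jp : jac f p = 0.
  by apply: contrapT => /eqP Jp; move/eqP: v00; apply; exact: jac_neq0 Jp _ dv0.
have dJ := jac_holomorphic df.
have [d1 d10 d1P] := locally_bounded (dJ p pp).
have [r0 [r00 r0d r0r]] : exists r : R, [/\ 0 < r, r <= d1 & r <= rho].
  by exists (Num.min d1 rho); rewrite lt_min d10 rho0 !ge_min !lexx orbT.
pose M := nr (jac f p) + 1.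
have bJ z : nr (z - p) < r0 -> normc (jac f z) <= M.
  by move=> zr; rewrite -nr_normc; apply: d1P; exact: lt_le_trans r0d.
have dJ0 z : nr (z - p) < r0 -> differentiable (jac f) z.
  by move=> zr; apply: dJ; exact: lt_le_trans r0r.
(* A Jacobian vanishing identically near [p] would make [f] locally constant. *)
have [a [ar Ja]] : exists a, nr (a - p) < r0 / 8 /\ jac f a != 0.
  apply: contrapT => none; move/eqP: (v00); apply.
  have cst z : nr (z - p) < r0 / 8 -> f z = f p.
    apply: diff0_constant => y yr; have yrho : nr (y - p) < rho by lra.
    split; first exact: df.
    apply: (Zd _ yrho); apply: contrapT => /eqP Jy; apply: none; by exists y.
  have nv : 0 < nr v0 by rewrite nr_gt0.
  pose c := r0 / (16 * nr v0).
  have c0 : 0 < c by rewrite divr_gt0 // mulr_gt0.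
  have cn : nr (p + c%:C *: v0 - p) = r0 / 16.
    by rewrite addrC addKr nrZ normc_real gtr0_norm // /c; field; rewrite gt_eqF.
  have : p + c%:C *: v0 = p.
    apply: injf => //; first by rewrite cn; lra.
    by apply: cst; rewrite cn; lra.
  move/eqP; rewrite -subr_eq0 addrC addKr scaler_eq0 => /orP[|/eqP//].
  by rewrite -normc_eq0 normc_real gtr0_norm // gt_eqF.
(* The order is minimised over all zeros near [p] and all directions together: were [h] nonzero at
   another zero [z] near [q], then [z] and the same [v] would realise a smaller order. *)
pose P k := exists q v, [/\ nr (q - p) < r0 / 8, jac f q = 0 &
  iter k (dirder v) (jac f) q != 0].
have exP : exists k, `[<P k>].
  pose v := a - p.
  have inB t : normc t < 2 -> nr (p + t *: v - p) < r0.
    move=> t2; rewrite addrC addKr nrZ.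
    have : normc t * nr v <= 2 * nr v by rewrite ler_wpM2r ?nr_ge0 // ltW.
    by have := ar; rewrite -/v; lra.
  have dh t : normc t < 2 -> differentiable (fun t : R[i] => jac f (p + t *: v)) t.
    by move=> /inB /dJ0 /differentiable_line[].
  have [||k [g [dg hg g0]]] := @order_exists R (fun t : R[i] => jac f (p + t *: v)) 2 M (ltr0Sn _ 1) dh.
  - by move=> t /inB; exact: bJ.
  - exists 1; rewrite scale1r /v addrC subrK; split=> //.
    by rewrite -[1]/(1%:C) normc_real normr1 ltr1n.
  exists k; apply/asboolP; exists p, v; split=> //; first by rewrite subrr nr0 divr_gt0.
  have := @iter_der_order R k g _ 2 (ltr0Sn _ 1) dg hg g0.
  have z2 : normc (0 : R[i]) < 2 by rewrite -nr_normc nr0.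
  by rewrite (@iter_dirder_line R _ v p p _ r0 k 0 dJ0 (inB 0 z2)) scale0r addr0.
have [k /asboolP[q [v [qr Jq kq]]] kmin] := ex_minnP exP.
case: k kq kmin => [|m kq kmin]; first by rewrite /= Jq eqxx.
pose h := iter m (dirder v) (jac f).
have dh z : nr (z - p) < r0 -> differentiable h z.
  exact: (@iter_dirder_holomorphic R _ v p (jac f) r0 m dJ0).
have hv : 'd h q v != 0 by [].
have hJ z : nr (z - q) < r0 / 8 - nr (q - p) -> jac f z = 0 -> h z = 0.
  move=> zq Jz; apply: contrapT => /eqP hz.
  have : (m.+1 <= m)%N; last by rewrite ltnn.
  apply: kmin; apply/asboolP; exists z, v; split=> //.
  by have := ler_nr_dist z q p; lra.
have v1 : v != 0.
  by apply: contraNneq hv => ->; rewrite linear0.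
have [i vi] : exists i, v 0 i != 0.
  apply: contrapT => none; move/eqP: v1; apply; apply/rowP => i; rewrite mxE.
  by apply: contrapT => /eqP vi; apply: none; exists i.
(* Here the dimension is at least two. Moving along the basis vector [j] while [v] has a nonzero
   coordinate [i] makes [w] independent of [v], so the path cannot close up. *)
have [j ji] : exists j : 'I_n.+2, j != i by exists (lift i ord0); rewrite eq_sym neq_lift.
pose w : 'rV[R[i]]_n.+2 := delta_mx 0 j.
have eps0 : 0 < r0 / 8 - nr (q - p) by rewrite subr_gt0.
have strict (e : R) : 0 < e -> exists2 d : R, 0 < d & forall x y,
    nr (x - q) < d -> nr (y - q) < d ->
    normc (h y - h x - 'd h q (y - x)) <= e * nr (y - x).
  move=> e0; have [|z zq|d d0 [_ dP]] := @strict_differentiability R _ _ h q (r0 / 2)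
    (@cauchy_lipschitz_complex R) _ _ e e0; first by rewrite divr_gt0.
    by apply: dh; have := ler_nr_dist z q p; lra.
  by exists d => // x y xq yq; rewrite -nr_normc; exact: dP.
have [s [C [t [s0 gP gC]]]] := @zero_set_path _ _ h ('d h q) p q v w r0 M _
  dJ0 bJ qr Jq eps0 hJ (diff_linear h q) hv strict.
pose g x := q + x%:C *: w + t x *: v.
have gB x : 0 <= x <= s -> nr (g x - p) < rho.
  by move=> /gP[]; rewrite -/(g x) => h1 _; have := ler_nr_dist (g x) q p; lra.
have : f (g 0) = f (g s).
  apply: (flat_path (g := fun x => f (g x)) (ltW s0)) => x xs e e0.
  pose C1 := `|C| + 1; have C10 : 0 < C1 by rewrite ltr_wpDl.
  have eC : 0 < e / C1 by rewrite divr_gt0.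
  have [d d0 dP] := differentiable_nrP (df _ (gB x xs)) eC.
  exists (d / C1); first by rewrite divr_gt0.
  move=> y ys yx; have gyx : nr (g y - g x) <= C * `|y - x| := gC x y xs ys.
  have gyx' : nr (g y - g x) <= C1 * `|y - x|.
    apply: le_trans gyx _; rewrite ler_wpM2r //.
    by rewrite /C1; have := ler_norm C; lra.
  have gd : nr (g y - g x) < d.
    by apply: le_lt_trans gyx' _; rewrite mulrC -ltr_pdivlMr.
  have := dP (g y - g x) gd.
  rewrite (Zd _ (gB x xs) (gP x xs).2) (addrC (g x)) subrK subr0 => h1.
  apply: le_trans h1 _.
  by rewrite mulrAC ler_pdivrMr // -mulrA ler_pM2l // mulrC.
have s0s : (0 : R) <= 0 <= s by apply/andP; split; [exact: lexx|exact: ltW].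
have sss : 0 <= s <= s by apply/andP; split; [exact: ltW|exact: lexx].
move=> /(injf _ _ (gB 0 s0s) (gB s sss)).
rewrite /g -!addrA => /addrI; rewrite scale0r add0r => e1.
have ij : (i == j) = false by apply/negbTE; rewrite eq_sym.
have := congr1 (fun u : 'rV[R[i]]_n.+2 => u 0 i) e1; rewrite /w !mxE ij.
rewrite andbF mulr0 add0r => /(mulIf vi) t0s; move: e1; rewrite t0s -{1}[_ *: v]add0r => /addIr /esym/eqP.
rewrite scaler_eq0 => /orP[|].
  by rewrite -normc_eq0 normc_real gtr0_norm // gt_eqF.
move/eqP/(congr1 (fun u : 'rV[R[i]]_n.+2 => u 0 j))/eqP; rewrite !mxE !eqxx /=.
by rewrite oner_eq0.
Qed.

Theorem osgood n : @osgood_property R n.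
Proof.
case: n => [|n]; first by move=> f p rho _ _ _ v _; rewrite thinmx0.
by elim: n => [|n IH]; [exact: osgood_dim1|exact: osgood_step].
Qed.

End osgood_theorem.

(** * Holomorphic functions on manifolds *)

Section charts.
Context {R : realType} {V W : normedModType R[i]}.
Variable M : complex_manifold V.
Implicit Types (c : chart V M) (f : M -> model W).

Lemma chart_ball c x (U : set M) : chart_dom c x -> nbhs x U ->
  exists2 rho : R, 0 < rho & forall z, nr (z - c x) < rho ->
    [/\ chart_dom c (chart_inv c z), c (chart_inv c z) = z & U (chart_inv c z)].
Proof.
move=> cx xU.
have nI : nbhs (c x) (c @` chart_dom c).
  by apply: open_nbhs_nbhs; split; [exact: chart_img_open|exists x].
have nU : nbhs (c x) (chart_inv c @^-1` U).
  by apply: (chart_inv_cont cx); rewrite chart_funK.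
have /nbhs_nrP[r r0 rP] : nbhs (c x) (c @` chart_dom c `&` chart_inv c @^-1` U).
  exact: filterI.
exists r => // z /rP[[y cy <-] Uz]; split=> //; by rewrite chart_funK.
Qed.

Lemma chart_nbhs c x (rho : R) : chart_dom c x -> 0 < rho ->
  nbhs x [set y | chart_dom c y /\ nr (c y - c x) < rho].
Proof.
move=> cx r0; apply: filterI.
  by apply: open_nbhs_nbhs; split=> //; exact: chart_dom_open.
have h : nbhs (c x) [set z | nr (z - c x) < rho] by apply/nbhs_nrP; exists rho.
exact: chart_fun_cont cx _ h.
Qed.

(** Compatibility of the atlas reduces the test to one chart of [M], and the model has only the
    identity chart. *)
Lemma holomorphic_chartP f x c : atlas c -> chart_dom c x ->
  cdifferentiable_at f x <-> differentiable (f \o chart_inv c : V -> W) (c x).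
Proof.
move=> Ac cx; split=> [[_]|df].
  by move=> /(_ c (id_chart W) Ac erefl cx I).
have nearc (c' : chart V M) : chart_dom c' x -> nbhs (c' x) [set z | chart_dom c (chart_inv c' z)].
  move=> c'x; apply: (chart_inv_cont c'x); rewrite chart_funK //.
  by apply: open_nbhs_nbhs; split=> //; exact: chart_dom_open.
split.
  move=> U fU; have nU : nbhs (c x) ((f \o chart_inv c) @^-1` U).
    by apply: (differentiable_continuous df); rewrite /= chart_funK.
  have h : nbhs x (c @^-1` ((f \o chart_inv c) @^-1` U)) by exact: (chart_fun_cont cx) nU.
  have h' : nbhs x (chart_dom c).
    by apply: open_nbhs_nbhs; split=> //; exact: chart_dom_open.
  by apply: filterS (filterI h h') => y [/= Uy cy]; rewrite chart_funK in Uy.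
move=> c' d Ac' -> c'x _.
apply: (@near_eq_differentiable _ _ _ ((f \o chart_inv c : V -> W) \o (c \o chart_inv c'))).
  by apply: filterS (nearc c' c'x) => z /= cz; rewrite chart_funK.
apply: differentiable_comp; first exact: atlas_compat.
by rewrite /= chart_funK.
Qed.

Lemma chart_differentiable f c z : atlas c -> chart_dom c (chart_inv c z) ->
  c (chart_inv c z) = z -> cdifferentiable_at f (chart_inv c z) ->
  differentiable (f \o chart_inv c : V -> W) z.
Proof. by move=> Ac cz czE /(holomorphic_chartP _ Ac cz); rewrite czE. Qed.

End charts.

Lemma entourage_nrP (R : realType) (W : normedModType R[i]) (E : set (W * W)) :
  entourage E -> exists2 e : R, 0 < e & forall a b, nr (b - a) < e -> E (a, b).
Proof.
rewrite -entourage_from_ballE => -[e /= e0 eP].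
have eE : e = (Re e)%:C by rewrite RRe_real // gtr0_real.
exists (Re e); first by rewrite eE ltcR in e0.
by move=> a b ab; apply: eP; rewrite /= -ball_normE /= nrE -nrBC eE ltcR.
Qed.

Lemma entourage_nr (R : realType) (W : normedModType R[i]) (e : R) : 0 < e ->
  entourage [set ab : W * W | nr (ab.2 - ab.1) < e].
Proof.
move=> e0; rewrite -entourage_from_ballE; exists e%:C; first by rewrite /= ltcR.
by move=> [a b] /=; rewrite -ball_normE /= nrE ltcR nrBC.
Qed.

Section function_space.
Context {R : realType} {N : nat}.
Variable Omega : complex_manifold 'rV[R[i]]_N.
Implicit Types (f g : OO Omega) (K L : set Omega).

Lemma holomorphic_of_charts (f : Omega -> CC R) :
  (forall x c, atlas c -> chart_dom c x ->
    differentiable (f \o chart_inv c : _ -> R[i]) (c x)) ->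
  holomorphic_on setT f.
Proof.
move=> h x _; have [c Ac cx] := atlas_cover x.
exact: (holomorphic_chartP _ Ac cx).2 (h x c Ac cx).
Qed.

Lemma OO_chart f x c : atlas c -> chart_dom c x ->
  differentiable (f \o chart_inv c : _ -> R[i]) (c x).
Proof. by move=> Ac cx; exact: (holomorphic_chartP _ Ac cx).1 (hol_funP f I). Qed.

Lemma OO_cst_holomorphic (a : R[i]) : holomorphic_on setT (fun _ : Omega => a : CC R).
Proof. by apply: holomorphic_of_charts => x c _ _; exact: differentiable_cstv. Qed.

Lemma OO_add_holomorphic f g :
  holomorphic_on setT (fun x => (f x : R[i]) + (g x : R[i]) : CC R).
Proof.
apply: holomorphic_of_charts => x c Ac cx.
exact: differentiable_addv (OO_chart f Ac cx) (OO_chart g Ac cx).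
Qed.

Lemma OO_mul_holomorphic f g :
  holomorphic_on setT (fun x => (f x : R[i]) * (g x : R[i]) : CC R).
Proof.
apply: holomorphic_of_charts => x c Ac cx.
exact: differentiable_mulc (OO_chart f Ac cx) (OO_chart g Ac cx).
Qed.

Definition OO_cst a : OO Omega := Hol (@OO_cst_holomorphic a).
Definition OO_add f g : OO Omega := Hol (@OO_add_holomorphic f g).
Definition OO_mul f g : OO Omega := Hol (@OO_mul_holomorphic f g).
Definition OO_exp f n : OO Omega := iter n (OO_mul f) (OO_cst 1).

Lemma OO_expE f n x : OO_exp f n x = (f x : R[i]) ^+ n.
Proof. by elim: n => [|n IH]; rewrite ?expr0 // exprS -IH. Qed.

Lemma OO_near f x (e : R) : 0 < e ->
  \forall y \near x, normc ((f y : R[i]) - f x) < e.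
Proof.
move=> e0; have [fc _] := hol_funP f I (x := x).
have h : nbhs (f x : R[i]) [set z | normc (z - f x) < e].
  by apply/nbhs_nrP; exists e => // y; rewrite nr_normc.
exact: fc _ h.
Qed.

Lemma OO_bounded f K : compact K ->
  exists2 M : R, 0 < M & forall x, K x -> normc (f x) <= M.
Proof.
move=> /compact_near_coveringP /(_ nat \oo (fun n y => normc (f y) <= n%:R)) cK.
have [|n _ nP] := cK _.
  move=> x Kx; exists ([set y | normc ((f y : R[i]) - f x) < 1],
      [set n : nat | normc (f x) + 1 <= n%:R]) => /=.
    split; first exact: OO_near.
    exists (Num.bound (normc (f x) + 1)) => // n /= nb.
    have h0 : 0 <= normc (f x) + 1 by rewrite addr_ge0 ?normc_ge0.
    by apply: le_trans (ltW (archi_boundP h0)) _; rewrite ler_nat.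
  move=> [y n] /= [yx nx]; apply: le_trans nx.
  by have := lerB_normc (f y) (f x); lra.
exists (n%:R + 1); first by rewrite ltr_wpDl.
by move=> x Kx; have := nP n (leqnn n) x Kx; lra.
Qed.

(** The sets of functions [e]-close to [f] on [K] form a filter base, by unions of compact sets and
    minima of radii, and this filter converges to [f] in the compact-open sense. *)
Lemma OO_open_ball (O : set (OO Omega)) f : open O -> O f ->
  exists K (e : R), [/\ compact K, 0 < e &
    forall g, (forall x, K x -> normc ((g x : R[i]) - f x) < e) -> O g].
Proof.
move=> [/= U oU <-] Uf.
pose B (Ke : set Omega * R) : set {family compact, Omega -> R[i]} :=
  [set h | forall x, Ke.1 x -> normc (h x - f x) < Ke.2].
pose D := [set Ke : set Omega * R | compact Ke.1 /\ 0 < Ke.2].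
have FF : Filter (filter_from D B).
  apply: filter_from_filter; first by exists (set0, 1); split=> //; exact: compact0.
  move=> [K1 e1] [K2 e2] [/= cK1 e10] [/= cK2 e20].
  exists (K1 `|` K2, Num.min e1 e2); first by split; [exact: compactU|rewrite /= lt_min e10].
  by move=> h hP; split=> x Kx; have := hP x; rewrite /= lt_min => /(_ _)/andP[] //; [left|right].
have : filter_from D B --> (OO_fun f).
  apply/(@fam_cvgP _ _ _ _ _ FF) => K cK P /uniform_nbhs [E [entE EP]].
  have [e e0 eP] := entourage_nrP entE; exists (K, e) => // h hP; apply: EP => y Ky /=.
  by apply: eP; rewrite nr_normc; exact: hP.
move=> /(_ U); rewrite nbhsE /= => /(_ _)[]; first by exists U.
by move=> [K e] [/= cK e0] KU; exists K, e; split=> // g /KU.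
Qed.

Lemma OO_ball_nbhs f K (e : R) : compact K -> 0 < e ->
  nbhs f [set g : OO Omega | forall x, K x -> normc ((g x : R[i]) - f x) < e].
Proof.
move=> cK e0; have := @fam_nbhs _ _ compact K _ (OO_fun f) (@entourage_nr R R[i]^o e e0) cK.
move=> /(@initial_continuous (OO Omega) _ (@OO_fun R _ Omega) f).
move=> H; apply: (@filterS _ _ (@nbhs_filter (OO Omega) f)) H => g gP x Kx.
by rewrite -nr_normc; exact: gP.
Qed.

Lemma dense_OO (S : set (OO Omega)) : dense S <->
  forall f K (e : R), compact K -> 0 < e ->
    exists2 g, S g & forall x, K x -> normc ((g x : R[i]) - f x) < e.
Proof.
split=> [dS f K e cK e0|dS A [f Af] oA].
  have := OO_ball_nbhs f cK e0; rewrite nbhsE => -[A [oA Af] AP].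
  by have [g [Ag Sg]] := dS A (ex_intro _ f Af) oA; exists g => //; exact: AP.
have [K [e [cK e0 KP]]] := OO_open_ball oA Af.
by have [g Sg gf] := dS f K e cK e0; exists g; split=> //; exact: KP.
Qed.

Lemma compact_chart_ball (c : chart 'rV[R[i]]_N Omega) x (U : set Omega) : chart_dom c x -> nbhs x U ->
  exists (rho : R) (K : set Omega), [/\ 0 < rho, compact K, nbhs x K, K `<=` U &
    forall z, nr (z - c x) < rho ->
      [/\ chart_dom c (chart_inv c z), c (chart_inv c z) = z & K (chart_inv c z)]].
Proof.
move=> cx xU; have [rho rho0 rhoP] := chart_ball cx xU.
pose B := [set z : 'rV[R[i]]_N | nr (z - c x) <= rho / 2].
have Br z : B z -> nr (z - c x) < rho by rewrite /B /=; lra.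
exists (rho / 2), (chart_inv c @` B); split=> [||||z zr].
- by rewrite divr_gt0.
- apply: continuous_compact; last by apply: compact_closed_ball_rV; rewrite divr_ge0 // ltW.
  apply: continuous_in_subspaceT => z /set_mem/Br/rhoP[h1 h2 _].
  by have := chart_inv_cont h1; rewrite h2.
- have r2 : 0 < rho / 2 by rewrite divr_gt0.
  apply: filterS (chart_nbhs cx r2) => y [cy yr]; exists (c y); first exact: ltW.
  by rewrite chart_funK.
- by move=> _ [z /Br/rhoP[_ _ Uz] <-].
have [h1 h2 _] := rhoP z (Br z (ltW zr)).
by split=> //; exists z => //; exact: ltW.
Qed.

Lemma OO_limit (u : nat -> OO Omega) :
  (forall K (e : R), compact K -> 0 < e -> exists n0, forall n m,
     (n0 <= n)%N -> (n0 <= m)%N ->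
     forall x, K x -> normc ((u n x : R[i]) - u m x) <= e) ->
  exists f : OO Omega, forall K (e : R), compact K -> 0 < e -> exists n0, forall n,
    (n0 <= n)%N -> forall x, K x -> normc ((u n x : R[i]) - f x) <= e.
Proof.
move=> cu.
have [f fP] : {f : Omega -> R[i] & forall x (e : R), 0 < e -> exists n0, forall n,
    (n0 <= n)%N -> normc ((u n x : R[i]) - f x) <= e}.
  apply: (@choice Omega R[i] (fun x l => forall e : R, 0 < e -> exists n0, forall n,
    (n0 <= n)%N -> normc ((u n x : R[i]) - l) <= e)) => x.
  apply: (@complex_cauchy_cvg R (fun n => u n x)) => e e0.
  have [n0 n0P] := cu _ e (@compact_set1 Omega x) e0.
  by exists n0 => n m hn hm; exact: n0P.
have fU K (e : R) : compact K -> 0 < e -> exists n0, forall n, (n0 <= n)%N ->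
    forall x, K x -> normc ((u n x : R[i]) - f x) <= e.
  move=> cK e0; have [n0 n0P] := cu K e cK e0; exists n0 => n hn x Kx.
  apply/ler_addgt0Pr => d d0; have [n1 n1P] := fP x d d0.
  have h1 := n0P n (maxn n0 n1) hn (leq_maxl _ _) x Kx.
  have h2 := n1P (maxn n0 n1) (leq_maxr _ _).
  have := ler_normcD ((u n x : R[i]) - u (maxn n0 n1) x) ((u (maxn n0 n1) x : R[i]) - f x).
  by rewrite addrA subrK; lra.
suff hf : holomorphic_on setT (f : Omega -> CC R) by exists (Hol hf).
apply: holomorphic_of_charts => x c Ac cx.
have [rho [K [rho0 cK _ _ KP]]] := compact_chart_ball cx (@filterT _ (nbhs x) _).
apply: (@weierstrass R _ (fun n => u n \o chart_inv c) (f \o chart_inv c) (c x) rho rho0).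
  move=> n z /KP[h1 h2 _]; apply: (chart_differentiable (f := hol_fun (u n)) Ac h1 h2).
  exact: hol_funP.
move=> e e0; have [n0 n0P] := fU K e cK e0.
by exists n0 => n hn z /KP[_ _ Kz]; exact: n0P.
Qed.

Lemma compact_sub_exhaustion (Q : nat -> set Omega) K :
  (forall l, Q l `<=` interior (Q l.+1)) -> \bigcup_l Q l = setT -> compact K ->
  exists l, forall m, (l <= m)%N -> K `<=` Q m.
Proof.
move=> QS QT /compact_near_coveringP /(_ nat \oo (fun n y => Q n y)) cK.
have Qmono l m : (l <= m)%N -> Q l `<=` Q m.
  move=> /subnKC <-; elim: (m - l)%N => [|k IH]; first by rewrite addn0.
  by rewrite addnS; apply: subset_trans IH _; exact: subset_trans (QS _) (@interior_subset _ _).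
have [|l _ lP] := cK _; last by exists l => m /lP.
move=> x _; have [l _ Ql] : (\bigcup_l Q l) x by rewrite QT.
exists (Q l.+1, [set n | (l.+1 <= n)%N]) => /=.
  by split; [exact: QS|exists l.+1].
by move=> [y n] /= [Qy ln]; exact: Qmono ln _ Qy.
Qed.

End function_space.

(** * The Caratheodory pseudodistance *)

Section pseudodistance.
Context {R : realType}.

Lemma normc_conj (z : R[i]) : normc (conjc z) = normc z.
Proof. by case: z => a b /=; rewrite sqrrN. Qed.

Lemma mul_conjc (z : R[i]) : conjc z * z = (normc z ^+ 2)%:C.
Proof.
case: z => a b; rewrite /= sqr_sqrtr ?addr_ge0 ?sqr_ge0 //.
by apply/eqP; rewrite eq_complex /=; apply/andP; split; apply/eqP; ring.
Qed.

(** The squares of the two sides differ by [(1 - |a|^2) (1 - |b|^2)]. *)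
Lemma mobius_denominator_ge (a b : R[i]) : normc a <= 1 -> normc b <= 1 ->
  normc (a - b) <= normc (1 - conjc b * a).
Proof.
have sq (z : R[i]) : normc z <= 1 -> Re z ^+ 2 + Im z ^+ 2 <= 1.
  by case: z => x y /= h; rewrite -(@ler_sqrt _ _ 1) ?sqrtr1.
move=> /sq + /sq; case: a => a1 a2; case: b => b1 b2 /= ha hb.
apply: ler_wsqrtr; rewrite -subr_ge0.
have := mulr_ge0 (_ : 0 <= 1 - (a1 ^+ 2 + a2 ^+ 2)) (_ : 0 <= 1 - (b1 ^+ 2 + b2 ^+ 2)).
rewrite !subr_ge0 => /(_ ha hb) h; rewrite -subr_ge0; apply: le_trans h _.
by rewrite le_eqVlt; apply/orP; left; apply/eqP; ring.
Qed.

Lemma mobius_denominator_le (a b : R[i]) : normc b <= 1 ->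
  normc (1 - conjc b * a) <= 2 * (1 - normc b) + normc (a - b).
Proof.
move=> b1; have -> : 1 - conjc b * a = (1 - conjc b * b) + conjc b * (b - a) by ring.
apply: le_trans (ler_normcD _ _) _.
rewrite mul_conjc -[1]/(1%:C) -rmorphB normc_real normcM normc_conj (normcBC b).
have b0 := normc_ge0 b; have ab0 := normc_ge0 (a - b).
have h1 : normc b * normc (a - b) <= normc (a - b) by rewrite ler_piMl.
have h2 : normc b ^+ 2 <= 1 by rewrite expr_le1.
have h3 : 2 * normc b <= 1 + normc b ^+ 2.
  by have := sqr_ge0 (normc b - 1); rewrite sqrrB1 -mulr_natl; lra.
by rewrite ger0_norm ?subr_ge0 //; lra.
Qed.

(** A Mobius map sends [g p] to [0], and [hol_lipschitz] bounds the composition at [y] by [1/4]: the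
    [32] is [4] times the Lipschitz factor [8]. Undoing the Mobius map leaves enough room for the
    constant [1]. *)
Lemma schwarz_pick (V : normedModType R[i]) (g : V -> R[i]) (p y : V) (rho : R) :
  (forall z, nr (z - p) < rho -> differentiable g z) ->
  (forall z, nr (z - p) < rho -> normc (g z) < 1) ->
  32 * nr (y - p) < rho ->
  normc (g p - g y) <= 1 - normc (g p) /\ normc (g p - g y) <= 1 - normc (g y).
Proof.
move=> dg bg yp; have n0 := nr_ge0 (y - p).
have rho0 : 0 < rho by lra.
have pp : nr (p - p) < rho by rewrite subrr nr0.
have yr : nr (y - p) < rho by lra.
pose D z := 1 - conjc (g p) * g z; pose h z := (g z - g p) * (D z)^-1.
have D0 z : nr (z - p) < rho -> D z != 0.
  move=> zr; rewrite subr_eq0; apply/eqP => /(congr1 (@normc R)).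
  rewrite normcM normc_conj -[1]/(1%:C) normc_real normr1 => e1.
  have : normc (g p) * normc (g z) < 1.
    apply: le_lt_trans (bg z zr).
    by rewrite ler_piMl ?normc_ge0 // ltW // bg.
  by rewrite -e1 ltxx.
have dh z : nr (z - p) < rho -> differentiable h z.
  move=> zr; apply: differentiable_mulc.
    by apply: differentiable_subv; [exact: dg|exact: differentiable_cstv].
  apply: differentiable_invc; last exact: D0.
  apply: differentiable_subv; first exact: differentiable_cstv.
  by apply: differentiable_mulc; [exact: differentiable_cstv|exact: dg].
have bh z : nr (z - p) < rho -> normc (h z) <= 1.
  move=> zr; rewrite normcM normcV ler_pdivrMr ?normc_gt0 ?D0 // mul1r.
  by apply: mobius_denominator_ge; apply: ltW; exact: bg.
have := hol_lipschitz dh bh (_ : nr (p - p) < rho / 2) (_ : nr (y - p) < rho / 2).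
rewrite subrr nr0 => /(_ ltac:(lra) ltac:(lra)).
have -> : h p = 0 by rewrite /h subrr mul0r.
rewrite subr0 mulr1 => hy.
have h4 : normc (h y) <= 1 / 4 by rewrite -(ler_pM2l rho0); lra.
have h5 : normc (g y - g p) <= 1 / 4 * normc (D y).
  have -> : g y - g p = h y * D y by rewrite /h divfK // D0.
  by rewrite normcM ler_wpM2r ?normc_ge0.
have bp := ltW (bg p pp); have by_ := ltW (bg y yr).
rewrite (normcBC (g p)); split.
  have := mobius_denominator_le (g y) bp; rewrite -/(D y) => h6; lra.
have := mobius_denominator_le (g p) by_.
have -> : normc (1 - conjc (g y) * g p) = normc (D y).
  by rewrite -normc_conj rmorphB rmorph1 rmorphM /= conjcK mulrC.
rewrite (normcBC (g p)) => h6; lra.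
Qed.

(* [hyp_close F C x y] says that the Caratheodory distance of [x] and [y],
   computed with the functions of the class [F], is at most about
   [ln (1 + C)]; in this form the triangle inequality is elementary. *)
Definition hyp_close (T : Type) (F : set (T -> R[i])) (C : R) (x y : T) :=
  forall G, F G -> normc (G x - G y) <= C * (1 - normc (G x)) /\
                   normc (G x - G y) <= C * (1 - normc (G y)).

Section hyp_close_theory.
Variables (T : Type) (F : set (T -> R[i])).
Hypothesis F1 : forall G x, F G -> normc (G x) <= 1.

Lemma hyp_close_sym C x y : hyp_close F C x y -> hyp_close F C y x.
Proof. by move=> h G FG; rewrite normcBC; have [h1 h2] := h G FG. Qed.

Lemma hyp_close_le C C' x y : C <= C' -> hyp_close F C x y -> hyp_close F C' x y.
Proof.
move=> CC h G FG; have [h1 h2] := h G FG.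
by split; [apply: le_trans h1 _|apply: le_trans h2 _]; rewrite ler_wpM2r // subr_ge0 F1.
Qed.

Lemma hyp_close_refl C x : 0 <= C -> hyp_close F C x x.
Proof.
move=> C0 G FG; rewrite subrr -nr_normc nr0.
by split; rewrite mulr_ge0 // subr_ge0 F1.
Qed.

(** The new constant is [(1 + C1) * (1 + C2) - 1], so [ln (1 + C)] adds up along chains. *)
Lemma hyp_close_trans C1 C2 x y z : 0 <= C1 -> 0 <= C2 ->
  hyp_close F C1 x y -> hyp_close F C2 y z -> hyp_close F (C1 + C2 + C1 * C2) x z.
Proof.
move=> C10 C20 h1 h2 G FG; have [a1 a2] := h1 G FG; have [b1 b2] := h2 G FG.
have := ler_normcD (G x - G y) (G y - G z); rewrite addrA subrK => t.
have := lerB_normc (G x) (G y); have := lerB_normc (G z) (G y).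
rewrite (normcBC (G z)) => t1 t2.
move: (normc (G x)) (normc (G y)) (normc (G z)) (normc (G x - G y))
  (normc (G y - G z)) (normc (G x - G z)) a1 a2 b1 b2 t t1 t2.
clear -C10 C20 => X Y Z XY YZ XZ a1 a2 b1 b2 t t1 t2.
have e1 : C2 * (1 - Y) <= C2 * ((1 + C1) * (1 - X)) by rewrite ler_wpM2l //; lra.
have e2 : C1 * (1 - Y) <= C1 * ((1 + C2) * (1 - Z)) by rewrite ler_wpM2l //; lra.
by split; lra.
Qed.

End hyp_close_theory.
End pseudodistance.

Section caratheodory.
Context {R : realType} {N : nat}.
Variable Omega : complex_manifold 'rV[R[i]]_N.
Implicit Types (f g : OO Omega) (K L : set Omega).

Definition OO_disc : set (Omega -> R[i]) :=
  [set G : Omega -> R[i] | exists2 g : OO Omega, forall x, normc (g x) < 1 & G = g].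

Lemma OO_disc_hol g : (forall x, normc (g x) < 1) -> OO_disc (g : Omega -> R[i]).
Proof. by move=> g1; exists g. Qed.

Local Notation close := (hyp_close OO_disc).

Lemma OO_disc_le1 (G : Omega -> R[i]) x : OO_disc G -> normc (G x) <= 1.
Proof. by move=> [g g1 ->]; exact: ltW. Qed.

Lemma close_hol (phi : hol Omega Omega) C x y : close C x y -> close C (phi x) (phi y).
Proof. by move=> h _ [g g1 ->]; apply: (h (hol_comp g phi)); apply: OO_disc_hol => z; exact: g1. Qed.

Lemma close_near x : \forall y \near x, close 1 x y.
Proof.
have [c Ac cx] := atlas_cover x.
have [rho rho0 rhoP] := chart_ball cx (@filterT _ (nbhs x) _).
have r32 : 0 < rho / 32 by rewrite divr_gt0.
apply: filterS (chart_nbhs cx r32) => y [cy yr] _ [g g1 ->].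
have := @schwarz_pick R _ (g \o chart_inv c) (c x) (c y) rho.
rewrite /= !chart_funK // !mul1r; apply; last by lra.
  move=> z /rhoP[h1 h2 _]; apply: (chart_differentiable (f := hol_fun g) Ac h1 h2).
  exact: hol_funP.
by move=> z _; exact: g1.
Qed.

Lemma close_connected z0 : connected [set: Omega] ->
  forall x, exists2 C, 0 <= C & close C x z0.
Proof.
move=> cO x; pose B := [set x | exists2 C, 0 <= C & close C x z0].
suff BT : B = setT by have : B x by rewrite BT.
have step x' y : close 1 x' y -> B x' <-> B y.
  move=> xy; have yx := hyp_close_sym xy.
  by split=> -[C C0 h]; exists (1 + C + 1 * C); rewrite ?addr_ge0 ?mul1r //;
    have := hyp_close_trans ler01 C0 _ h; rewrite mul1r; apply.
apply: cO.
- by exists z0, 0 => //; exact: hyp_close_refl OO_disc_le1 _ _ _.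
- exists B; last by rewrite setTI.
  rewrite openE => y By; apply: filterS (close_near y) => y' /step h; exact/h.
- exists B; last by rewrite setTI.
  move=> y /(_ _ (close_near y))[y' [By' /step h]]; exact/h.
Qed.

Lemma close_compact z0 K : connected [set: Omega] -> compact K ->
  exists2 C, 0 <= C & forall x, K x -> close C x z0.
Proof.
move=> cO /compact_near_coveringP /(_ nat \oo (fun n y => close n%:R y z0)) cK.
have [|n _ nP] := cK _; last by exists n%:R => // x; exact: (nP n (leqnn n)).
move=> x _; have [C C0 Cx] := close_connected z0 cO x.
exists ([set y | close 1 x y], [set n : nat | 1 + C + 1 * C <= n%:R]) => /=.
  split; first exact: close_near.
  exists (Num.bound (1 + C + 1 * C)) => // n /= nb.
  have h0 : 0 <= 1 + C + 1 * C by rewrite mul1r !addr_ge0.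
  by apply: le_trans (ltW (archi_boundP h0)) _; rewrite ler_nat.
move=> [y n] /= [xy Cn]; apply: (hyp_close_le OO_disc_le1 Cn).
exact: hyp_close_trans ler01 C0 (hyp_close_sym xy) Cx.
Qed.

Lemma escape_function z0 (d : R) : caratheodory_tends_to_infinity z0 -> 0 < d < 1 ->
  exists2 L : set Omega, compact L & forall z, ~ L z -> exists g : OO Omega,
    [/\ forall x, normc (g x) < 1, g z0 = 0 & 1 - d < normc (g z)].
Proof.
move=> tz /andP[d0 d1].
(* [2^-1 * ln ((2 - d) / d)] is the value of [caratheodory] when [caratheodory_star] equals
   [1 - d]. *)
have z1 : 0 < `|2^-1 * ln ((2 - d) / d)| + 1 by rewrite ltr_wpDl.
have [L cL LP] := tz _ z1; exists L => // z /LP h.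
have n0 x : normc (@OO_cst R N Omega 0 x) = 0.
  by apply: (@etrans _ _ (normc (0 : R[i]))) => //; rewrite -nr_normc nr0.
have ds : 1 - d < caratheodory_star z z0.
  rewrite ltNge; apply/negP => sd; move: h; apply/negP; rewrite -leNgt.
  have s0 : 0 <= caratheodory_star z z0.
    apply: ub_le_sup.
      by exists 1 => _ [F [F1 _] <-]; exact: ltW.
    by exists (@OO_cst R N Omega 0); [split=> // x; rewrite n0|exact: n0].
  rewrite /caratheodory; move: (caratheodory_star z z0) s0 sd => s s0 sd.
  have s1 : 0 < 1 - s by lra.
  apply: (@le_trans _ _ (2^-1 * ln ((2 - d) / d))); last first.
    by apply: le_trans (ler_norm _) _; rewrite lerDl.
  rewrite ler_pM2l ?invr_gt0 // ler_ln ?posrE ?divr_gt0 //; [|lra..].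
  rewrite ler_pdivrMr // mulrAC ler_pdivlMr //.
  by rewrite -subr_ge0; have := mulr_ge0 (ltW d0) s0; lra.
have [|_ [g [g1 g0] <-] gz] := sup_gt _ ds; last by exists g.
by exists 0; exists (@OO_cst R N Omega 0); [split=> // x; rewrite n0|exact: n0].
Qed.

(** Closeness and [g z0 = 0] force [|g x| <= C / (1 + C)], whereas outside [L] some [g] has
    [|g x| > 1 - (C + 2)^-1], which is larger. *)
Lemma close_relatively_compact z0 C : caratheodory_tends_to_infinity z0 -> 0 <= C ->
  exists2 L : set Omega, compact L & forall x, close C x z0 -> L x.
Proof.
move=> tz C0; have C2 : 0 < C + 2 by rewrite ltr_wpDl.
have [|L cL LP] := @escape_function z0 (C + 2)^-1 tz.
  by rewrite invr_gt0 C2 invf_lt1 //; lra.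
exists L => // x Cx; apply: contrapT => /LP[g [g1 g0 gx]].
have [h _] := Cx g (OO_disc_hol g1).
rewrite g0 subr0 in h.
have e1 : C * (1 - normc (g x)) <= C * (C + 2)^-1 by rewrite ler_wpM2l //; lra.
have e2 : (C + 2)^-1 * (C + 2) = 1 by rewrite mulVf // gt_eqF.
have e3 : 0 < (C + 2)^-1 by rewrite invr_gt0.
by lra.
Qed.

End caratheodory.

(** * Separation and transitivity *)

Section separation.
Context {R : realType} {N : nat}.
Variable Omega : complex_manifold 'rV[R[i]]_N.
Implicit Types (f g chi : OO Omega) (K L : set Omega).

Local Notation close := (hyp_close (@OO_disc R N Omega)).

Lemma expr_small (r e : R) : 0 <= r < 1 -> 0 < e -> exists m, r ^+ m < e.
Proof.
move=> /andP[r0 r1] e0.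
have rn : `|r| < 1 by rewrite ger0_norm.
have /cvgr0_norm_lt /(_ e e0) [m _ mP] := cvg_expr rn.
by exists m; have := mP m (leqnn m); rewrite /= ger0_norm // exprn_ge0.
Qed.

Lemma normc_sub1_exp (w : R[i]) n : normc w <= 1 ->
  normc (1 - w ^+ n) <= n%:R * normc (1 - w).
Proof.
move=> w1; elim: n => [|n IH]; first by rewrite expr0 subrr -nr_normc nr0 mul0r.
have -> : 1 - w ^+ n.+1 = (1 - w ^+ n) + w ^+ n * (1 - w) by rewrite exprSr; ring.
apply: le_trans (ler_normcD _ _) _; rewrite -natr1 mulrDl mul1r lerD // normcM.
by rewrite ler_piMl ?normc_ge0 // normcX exprn_ile1 // normc_ge0.
Qed.

(* [3 x ^ 2 - 2 x ^ 3] contracts neighbourhoods of both [0] and [1]. *)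
Lemma boost_contraction (z : R[i]) (t : R) : t <= 1 / 10 -> normc z <= t ->
  normc (3 * z ^+ 2 + (- 2) * z ^+ 3) <= t / 2.
Proof.
move=> t1 zt; have z0 := normc_ge0 z.
apply: le_trans (ler_normcD _ _) _.
rewrite (normcM 3) (normcM (- 2)) !normcX normcN.
have nn n : normc (n%:R : R[i]) = n%:R.
  by rewrite -(rmorph_nat (real_complex R)) normc_real normr_nat.
rewrite !nn; set a := normc z in zt z0 *.
have h1 : a ^+ 2 <= a * (1 / 10) by rewrite expr2 ler_wpM2l //; lra.
have h2 : a ^+ 3 <= a ^+ 2 * (1 / 10) by rewrite exprSr ler_wpM2l ?sqr_ge0 //; lra.
by lra.
Qed.

(** The polynomial commutes with [z -> 1 - z], so one contraction estimate serves for [X] and for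
    [Y]. *)
Lemma boost chi (X Y : set Omega) :
  (forall x, X x -> normc (chi x) <= 1 / 10) ->
  (forall x, Y x -> normc (1 - (chi x : R[i])) <= 1 / 10) ->
  forall e : R, 0 < e -> exists chi' : OO Omega,
    (forall x, X x -> normc (chi' x) < e) /\
    (forall x, Y x -> normc (1 - (chi' x : R[i])) < e).
Proof.
move=> X1 Y1 e e0.
suff step j : exists chi' : OO Omega,
    (forall x, X x -> normc (chi' x) <= 1 / 10 / 2 ^+ j) /\
    (forall x, Y x -> normc (1 - (chi' x : R[i])) <= 1 / 10 / 2 ^+ j).
  have [n nP] := expr2V_small 1 e0; rewrite div1r in nP.
  have [chi' [h1 h2]] := step n; exists chi'.
  have h3 : 1 / 10 / 2 ^+ n < e.
    have : 0 < (2 ^+ n)^-1 :> R by rewrite invr_gt0 exprn_gt0.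
    by lra.
  by split=> x hx; apply: le_lt_trans h3; [exact: h1|exact: h2].
elim: j => [|j [c [h1 h2]]]; first by exists chi; rewrite expr0 divr1.
have tj : 1 / 10 / 2 ^+ j <= 1 / 10 :> R.
  by rewrite ler_pdivrMr ?exprn_gt0 // ler_peMr // exprn_ege1 // ler1n.
have tS : 1 / 10 / 2 ^+ j.+1 = 1 / 10 / 2 ^+ j / 2 :> R by rewrite exprSr invfM mulrA.
exists (OO_add (OO_mul (@OO_cst _ _ Omega 3) (OO_exp c 2))
               (OO_mul (@OO_cst _ _ Omega (- 2)) (OO_exp c 3))).
have E x : OO_add (OO_mul (@OO_cst _ _ Omega 3) (OO_exp c 2))
    (OO_mul (@OO_cst _ _ Omega (- 2)) (OO_exp c 3)) x =
    3 * (c x : R[i]) ^+ 2 + (- 2) * (c x : R[i]) ^+ 3 :> R[i].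
  by rewrite -!OO_expE.
split=> x hx; rewrite E tS; first exact: boost_contraction (h1 x hx).
have -> : 1 - (3 * (c x : R[i]) ^+ 2 + (- 2) * (c x : R[i]) ^+ 3) =
    3 * (1 - (c x : R[i])) ^+ 2 + (- 2) * (1 - (c x : R[i])) ^+ 3 by ring.
exact: boost_contraction (h2 x hx).
Qed.

(** [L] comes before [psi] and [e]: the exponent [m] and the margin [d] depend only on the closeness
    constants of [K], and [boost] supplies the precision afterwards. One compact set thus serves all
    iterates of a map. *)
Lemma separation (z0 z1 : Omega) K : connected [set: Omega] ->
  caratheodory_tends_to_infinity z0 -> compact K ->
  exists2 L : set Omega, compact L & forall psi : Omega -> Omega,
    (forall C x y, close C x y -> close C (psi x) (psi y)) -> ~ L (psi z1) ->
    forall e : R, 0 < e -> exists chi : OO Omega,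
      (forall x, K x -> normc (chi x) < e) /\
      (forall x, K x -> normc (1 - (chi (psi x) : R[i])) < e).
Proof.
move=> cO tz cK.
have [C0 C00 C0P] := close_compact z0 cO cK.
have [C1 C10 C1P] := close_compact z1 cO cK.
have C01 : 0 < 1 + C0 by rewrite ltr_pwDl.
have r01 : 0 <= C0 / (1 + C0) < 1.
  by rewrite divr_ge0 ?(ltW C01) //= ltr_pdivrMr // mul1r; lra.
have [|m mP] := expr_small r01 (_ : 0 < 1 / 10); first by rewrite divr_gt0.
(* On the image of [K], [1 - G] is at most [d * (1 + C1)]; after the power [m] it is still below
   [1 / 10]. *)
pose d := (10 * (m%:R + 1) * (1 + C1))^-1.
have C11 : 0 < 1 + C1 by lra.
have m1 : 0 < m%:R + 1 :> R by rewrite ltr_wpDl // ler0n.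
have D0 : 0 < 10 * (m%:R + 1) * (1 + C1) by rewrite !mulr_gt0.
have d0 : 0 < d by rewrite invr_gt0.
have dE : d * (1 + C1) * (10 * (m%:R + 1)) = 1.
  by rewrite -mulrA (mulrC (1 + C1)) /d mulVf // gt_eqF.
have m0 : 0 <= m%:R :> R by rewrite ler0n.
have dC0 : 0 <= d * C1 by rewrite mulr_ge0 // ltW.
have md : 0 <= m%:R * (d * (1 + C1)) by rewrite !mulr_ge0 // ?(ltW d0) // addr_ge0.
have d1 : d < 1 by lra.
have [|L cL LP] := @escape_function R N Omega z0 d tz; first by rewrite d0.
exists L => // psi cpsi /LP[F [F1 F0 Fa]] e e0.
pose a : R[i] := F (psi z1).
have a0 : 0 < normc a by apply: le_lt_trans Fa; lra.
(* Rotates [F (psi z1)] to its modulus, so that almost constant of modulus almost [1] becomes almost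
   equal to [1]. *)
pose u : R[i] := conjc a * ((normc a)^-1)%:C.
have nu : normc u = 1.
  by rewrite normcM normc_conj normc_real ger0_norm ?invr_ge0 ?ltW // mulfV // gt_eqF.
have ua : u * a = (normc a)%:C.
  rewrite /u mulrAC mul_conjc -rmorphM /=; congr (_%:C).
  by rewrite expr2 -mulrA mulfV ?mulr1 // gt_eqF.
pose G := OO_mul (@OO_cst _ _ Omega u) F.
have GE x : G x = u * (F x : R[i]) :> R[i] by [].
have G1 x : normc (G x) <= 1 by rewrite GE normcM nu mul1r ltW.
have [||chi' chiP] := @boost (OO_exp G m) K [set y | exists2 x, K x & y = psi x] _ _ e e0.
- move=> x Kx; rewrite OO_expE normcX; apply: le_trans (ltW mP).
  apply: lerXn2r; rewrite ?nnegrE ?normc_ge0 //; first by case/andP: r01.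
  rewrite GE normcM nu mul1r ler_pdivlMr //.
  have [h _] := C0P x Kx _ (OO_disc_hol F1); rewrite F0 subr0 in h.
  by rewrite mulrDr mulr1; lra.
- move=> _ [x Kx ->]; rewrite OO_expE; apply: le_trans (normc_sub1_exp _ (G1 _)) _.
  have [_ h] := cpsi _ _ _ (C1P x Kx) _ (OO_disc_hol F1).
  have h1 : normc (1 - (G (psi x) : R[i])) <= (1 - normc a) + C1 * (1 - normc a).
    have -> : 1 - (G (psi x) : R[i]) = (1 - u * a) + u * (a - F (psi x)) by rewrite GE; ring.
    apply: le_trans (ler_normcD _ _) _; rewrite normcM nu mul1r ua -[1]/(1%:C) -rmorphB normc_real.
    by rewrite ger0_norm ?subr_ge0 ?(ltW (F1 _)) // lerD2l normcBC.
  have h2 : normc (1 - (G (psi x) : R[i])) <= d * (1 + C1).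
    have : (1 - normc a) * (1 + C1) <= d * (1 + C1).
      by rewrite ler_wpM2r ?addr_ge0 //; move: Fa; rewrite -/a; lra.
    by lra.
  have : m%:R * normc (1 - (G (psi x) : R[i])) <= m%:R * (d * (1 + C1)) by rewrite ler_wpM2l.
  by have := mulr_ge0 (ltW d0) C10; lra.
by exists chi'; split=> x Kx; [exact: chiP.1|apply: chiP.2; exists x].
Qed.

Lemma iter_close (phi : hol Omega Omega) n C x y :
  close C x y -> close C (iter n phi x) (iter n phi y).
Proof. by move=> h; elim: n => // n IH; exact: close_hol. Qed.

Lemma iter_hol_continuous (phi : hol Omega Omega) n : continuous (iter n phi).
Proof.
elim: n => [|n IH] x; first exact: cvg_id.
by apply: continuous_comp; [exact: IH|exact: (hol_funP phi I).1].
Qed.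

Lemma compact_iter_hol (phi : hol Omega Omega) n K : compact K ->
  compact (iter n phi @` K).
Proof.
by apply: continuous_compact; apply: continuous_subspaceT; exact: iter_hol_continuous.
Qed.

(** For a holomorphic self-map this is density of the range of its composition operator; plain
    functions are allowed so that it applies to iterates. *)
Definition dense_range (phi : Omega -> Omega) := forall g K (e : R),
  compact K -> 0 < e ->
  exists G : OO Omega, forall x, K x -> normc ((G (phi x) : R[i]) - g x) < e.

Lemma dense_range_iter (phi : hol Omega Omega) n : dense_range phi ->
  dense_range (iter n phi).
Proof.
move=> dr; elim: n => [|n IH] g K e cK e0.
  by exists g => x _; rewrite /= subrr -nr_normc nr0.
have e2 : 0 < e / 2 by rewrite divr_gt0.
have [G1 G1P] := IH g K _ cK e2.
have [G2 G2P] := dr G1 _ _ (compact_iter_hol (phi := phi) (n := n) cK) e2.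
exists G2 => x Kx; have h1 := G1P x Kx.
have h2 := G2P (iter n phi x) (ex_intro2 _ _ x Kx erefl).
have := ler_normcD ((G2 (phi (iter n phi x)) : R[i]) - G1 (iter n phi x))
   ((G1 (iter n phi x) : R[i]) - g x).
by rewrite addrA subrK /=; lra.
Qed.

(** [h = f + chi * (G - f)], where [G] composed with the [n]-th iterate approximates [g]: [chi] near
    [0] on [K] gives [h] near [f], and [chi] near [1] on the image of [K] gives [h] near [G]
    there. *)
Lemma transitivity (z0 z1 : Omega) (phi : hol Omega Omega) K f g (e : R) :
  connected [set: Omega] -> caratheodory_tends_to_infinity z0 ->
  dense_range phi -> compact K -> 0 < e ->
  exists2 L : set Omega, compact L & forall n, ~ L (iter n phi z1) ->
    exists h : OO Omega, forall x, K x -> normc ((h x : R[i]) - f x) < e /\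
      normc ((h (iter n phi x) : R[i]) - g x) < e.
Proof.
move=> cO tz dr cK e0; have [L cL LP] := separation z1 cO tz cK.
exists L => // n /(LP _ (fun C x y => @iter_close phi n C x y)) chiP.
have e2 : 0 < e / 2 by rewrite divr_gt0.
have [G GP] := dense_range_iter n dr g cK e2.
pose D := OO_add G (OO_mul (@OO_cst _ _ Omega (- 1)) f).
have DE x : D x = (G x : R[i]) - f x :> R[i].
  by apply: (@etrans _ _ ((G x : R[i]) + (- 1) * (f x : R[i]))) => //; ring.
have [M M0 MP] := OO_bounded D (compactU cK (compact_iter_hol (phi := phi) (n := n) cK)).
have [chi [c1 c2]] := chiP _ (divr_gt0 e2 M0).
exists (OO_add f (OO_mul chi D)) => x Kx.
have hE y : OO_add f (OO_mul chi D) y = (f y : R[i]) + (chi y : R[i]) * D y :> R[i] by [].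
have eM : e / 2 / M * M = e / 2 by rewrite divfK // gt_eqF.
have bd (c : R[i]) y : (K `|` iter n phi @` K) y -> normc c < e / 2 / M ->
    normc (c * D y) <= e / 2.
  move=> /MP Dy cM; rewrite normcM -eM; apply: ler_pM; rewrite ?normc_ge0 //; exact: ltW.
have h1 := bd (chi x) x (or_introl Kx) (c1 x Kx).
have h2 := bd _ (iter n phi x) (or_intror (ex_intro2 _ _ x Kx erefl)) (c2 x Kx).
rewrite !hE; split.
  by rewrite (addrC (f x : R[i])) addrK; lra.
have h3 := GP x Kx; set y := iter n phi x in h2 h3 *.
have -> : (f y : R[i]) + (chi y : R[i]) * D y - g x =
    ((G y : R[i]) - g x) - (1 - (chi y : R[i])) * D y by rewrite DE; ring.
by apply: le_lt_trans (ler_normcB _ _) _; lra.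
Qed.

End separation.

(** * Universal vectors *)

Section universality.
Context {R : realType} {N : nat}.
Variable Omega : complex_manifold 'rV[R[i]]_N.
Implicit Types (f g h : OO Omega) (K L : set Omega).

(** The core of Montel's theorem: [hol_lipschitz] in a chart gives a modulus of continuity that
    depends on [f] only through the bound [M]. *)
Lemma OO_equicontinuous (p : Omega) (U : set Omega) (M e : R) : nbhs p U -> 0 < e ->
  \forall y \near p, forall f, (forall x, U x -> normc (f x) <= M) ->
    normc ((f y : R[i]) - f p) < e.
Proof.
move=> pU e0; have [c Ac cp] := atlas_cover p.
have [rho rho0 rhoP] := chart_ball cp pU.
pose M1 := 8 * (`|M| + 1); have M10 : 0 < M1 by rewrite mulr_gt0 // ltr_wpDl.
pose d := Num.min (rho / 2) (e * rho / M1).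
have d0 : 0 < d by rewrite lt_min !divr_gt0 // mulr_gt0.
apply: filterS (chart_nbhs cp d0) => y [cy]; rewrite lt_min => /andP[yr ye] f fM.
have := @hol_lipschitz R _ (f \o chart_inv c) (c p) rho M.
move=> /(_ _ _ (c p) (c y)); rewrite subrr nr0 /= !chart_funK // => lip.
have h : rho * normc ((f y : R[i]) - f p) <= 8 * M * nr (c y - c p).
  apply: lip => //; last by rewrite divr_gt0.
  - move=> z /rhoP[h1 h2 _]; apply: (chart_differentiable (f := hol_fun f) Ac h1 h2).
    exact: hol_funP.
  - by move=> z /rhoP[_ _ Uz]; exact: fM.
rewrite -(ltr_pM2l rho0); apply: le_lt_trans h _.
rewrite ltr_pdivlMr // in ye; rewrite (mulrC rho).
apply: le_lt_trans ye; rewrite (mulrC (nr _)); apply: ler_wpM2r; first exact: nr_ge0.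
by rewrite /M1; have := ler_norm M; lra.
Qed.

Lemma OO_finite_net K (U : set Omega) (M e : R) : compact K -> K `<=` interior U -> 0 < e ->
  exists s : seq Omega, forall f g,
    (forall x, U x -> normc (f x) <= M) -> (forall x, U x -> normc (g x) <= M) ->
    (forall p, p \in s -> normc ((f p : R[i]) - g p) < 2 * e) ->
    forall x, K x -> normc ((f x : R[i]) - g x) < 4 * e.
Proof.
move=> cK KU e0.
pose W p := [set y | forall f, (forall x, U x -> normc (f x) <= M) ->
  normc ((f y : R[i]) - f p) < e].
(* Eventually along this filter a finite sequence contains any given one; near-covering compactness
   then produces a finite net. *)
pose F := filter_from [set: seq Omega] (fun s0 => [set s : seq Omega | {subset s0 <= s}]).
have FF : Filter F.
  apply: filter_from_filter; first by exists [::].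
  move=> s1 s2 _ _; exists (s1 ++ s2) => // s hs.
  by split=> p ps; apply: hs; rewrite mem_cat ps ?orbT.
move: cK => /compact_near_coveringP /(_ _ F (fun s y => exists2 p, p \in s & W p y) FF).
case=> [p Kp|s0 _ /(_ s0 (fun _ => id)) KW].
  exists (W p, [set s : seq Omega | p \in s]) => /=.
    split; first exact: OO_equicontinuous (KU p Kp) e0.
    by exists [:: p] => // s; apply; rewrite mem_head.
  by move=> [y s] /= [Wy ps]; exists p.
exists s0 => f g fM gM fg x Kx; have [p ps pW] := KW x Kx.
have h1 := pW f fM; have h2 := pW g gM; have h3 := fg p ps.
have -> : (f x : R[i]) - g x = ((f x : R[i]) - f p) + ((f p : R[i]) - g p) - ((g x : R[i]) - g p).
  by ring.
have := ler_normcB (((f x : R[i]) - f p) + ((f p : R[i]) - g p)) ((g x : R[i]) - g p).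
have := ler_normcD ((f x : R[i]) - f p) ((f p : R[i]) - g p).
by lra.
Qed.

Lemma floor_eq_dist (x y : R) : Num.floor x = Num.floor y -> `|x - y| < 1.
Proof.
move=> xy; have := floor_itv x; have := floor_itv y; rewrite xy intrD1.
move=> /andP[h1 h2] /andP[h3 h4]; rewrite ltr_norml; apply/andP; split; lra.
Qed.

(* A holomorphic function bounded on a neighbourhood of [K] is determined up to
   [4 * e] on [K] by finitely many integers, the rounded values of [f / e] on a
   finite net. *)
Lemma OO_separable (Q : nat -> set Omega) :
  (forall l, compact (Q l)) -> (forall l, Q l `<=` interior (Q l.+1)) ->
  \bigcup_l Q l = setT ->
  exists d : nat -> OO Omega, forall g K (e : R), compact K -> 0 < e ->
    exists j, forall x, K x -> normc ((d j x : R[i]) - g x) < e.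
Proof.
move=> cQ QS QT.
pose eps (k : nat) : R := k.+1%:R^-1.
have eps0 k : 0 < eps k by rewrite invr_gt0.
have [s sP] : {s : nat * nat * nat -> seq Omega & forall a f g,
    (forall x, Q a.1.1.+1 x -> normc (f x) <= a.1.2%:R) ->
    (forall x, Q a.1.1.+1 x -> normc (g x) <= a.1.2%:R) ->
    (forall p, p \in s a -> normc ((f p : R[i]) - g p) < 2 * eps a.2) ->
    forall x, Q a.1.1 x -> normc ((f x : R[i]) - g x) < 4 * eps a.2}.
  apply: (@choice (nat * nat * nat)%type (seq Omega)
    (fun a s => forall f g, (forall x, Q a.1.1.+1 x -> normc (f x) <= a.1.2%:R) ->
    (forall x, Q a.1.1.+1 x -> normc (g x) <= a.1.2%:R) ->
    (forall p, p \in s -> normc ((f p : R[i]) - g p) < 2 * eps a.2) ->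
    forall x, Q a.1.1 x -> normc ((f x : R[i]) - g x) < 4 * eps a.2)).
  by move=> [[l i] k]; exact: OO_finite_net (cQ l) (QS l) (eps0 k).
pose code a f : seq (int * int) :=
  [seq (Num.floor (Re (f p : R[i]) / eps a.2), Num.floor (Im (f p : R[i]) / eps a.2)) | p <- s a].
have codeP a f g : code a f = code a g -> forall p, p \in s a ->
    normc ((f p : R[i]) - g p) < 2 * eps a.2.
  move=> /eq_in_map fg p /fg[/floor_eq_dist h1 /floor_eq_dist h2].
  have e0 := eps0 a.2; set e := eps a.2 in h1 h2 e0 *.
  have sc (x y : R) : `|x / e - y / e| < 1 -> `|x - y| < e.
    by rewrite -mulrBl normrM (gtr0_norm (_ : 0 < e^-1)) ?invr_gt0 // ltr_pdivrMr // mul1r.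
  apply: le_lt_trans (ler_normc_ReIm _) _.
  by rewrite !raddfB /=; have := sc _ _ h1; have := sc _ _ h2; lra.
pose P (b : nat * nat * nat * seq (int * int)) f :=
  (forall x, Q b.1.1.1.+1 x -> normc (f x) <= b.1.1.2%:R) /\ code b.1 f = b.2.
(* One representative for each realised code and [0] for the others; codes form a countable type,
   enumerated through [unpickle]. *)
pose D b := if pselect (exists f, P b f) is left h then projT1 (cid h) else @OO_cst R N Omega 0.
have DP b f : P b f -> P b (D b).
  by move=> Pf; rewrite /D; case: pselect => [h|[]]; [exact: projT2 (cid h)|exists f].
exists (fun j => if unpickle j is Some b then D b else @OO_cst R N Omega 0) => g K e cK e0.
have [l lP] := compact_sub_exhaustion QS QT cK.
have [M M0 MP] := OO_bounded g (cQ l.+1).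
pose i := Num.bound M; pose k := Num.bound (4 / e).
have ek : 4 * eps k < e.
  have h : 4 / e < k%:R by apply: archi_boundP; rewrite divr_ge0 // ltW.
  rewrite /eps ltr_pdivrMr // mulrC -ltr_pdivrMr //; apply: lt_trans h _.
  by rewrite ltr_nat.
pose a := (l, i, k); pose b := (a, code a g).
have Pg : P b g.
  split=> // x /MP gx; apply: le_trans gx _; apply: ltW; apply: archi_boundP; exact: ltW.
have [h1 h2] := DP b g Pg.
exists (pickle b) => x Kx; rewrite pickleK; apply: lt_trans ek.
by apply: (sP a) => //; [exact: Pg.1|exact: codeP|exact: (lP l)].
Qed.

Lemma universal_vector (Q : nat -> set Omega) (psi : nat -> Omega -> Omega) :
  (forall l, compact (Q l)) -> (forall l, Q l `<=` interior (Q l.+1)) ->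
  \bigcup_l Q l = setT -> (forall l, continuous (psi l)) ->
  (forall K f g (e : R), compact K -> 0 < e -> exists l h, forall x, K x ->
     normc ((h x : R[i]) - f x) < e /\ normc ((h (psi l x) : R[i]) - g x) < e) ->
  exists h, forall g K (e : R), compact K -> 0 < e ->
    exists l, forall x, K x -> normc ((h (psi l x) : R[i]) - g x) < e.
Proof.
move=> cQ QS QT cpsi trans.
have Qmono l m : (l <= m)%N -> Q l `<=` Q m.
  move=> /subnKC <-; elim: (m - l)%N => [|k IH]; first by rewrite addn0.
  by rewrite addnS; apply: subset_trans IH _; exact: subset_trans (QS _) (@interior_subset _ _).
have [d dP] := OO_separable cQ QS QT.
pose e j : R := (2 ^+ j)^-1; have e0 j : 0 < e j by rewrite invr_gt0 exprn_gt0.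
have eS j : e j.+1 = e j / 2 by rewrite /e exprSr invfM.
(* The target at stage [j] is [d (logn 2 j)]: the [2]-adic valuation takes every value infinitely
   often, so each [d i] is approximated at arbitrarily late stages. *)
pose step j (s t : OO Omega * set Omega) := [/\ compact t.2, s.2 `<=` t.2, Q j `<=` t.2,
  forall x, s.2 x -> normc ((t.1 x : R[i]) - s.1 x) < e j &
  exists l, psi l @` Q j `<=` t.2 /\
    forall x, Q j x -> normc ((t.1 (psi l x) : R[i]) - d (logn 2 j) x) < e j].
have [next nextP] : {next : nat * (OO Omega * set Omega) -> OO Omega * set Omega &
    forall a, compact a.2.2 -> step a.1 a.2 (next a)}.
  apply: (@choice _ _ (fun a t => compact a.2.2 -> step a.1 a.2 t)) => -[j [f P]] /=.
  have [cP|nP] := pselect (compact P); last by exists (f, P).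
  have [l [h hP]] := trans _ f (d (logn 2 j)) _ (compactU cP (cQ j)) (e0 j).
  exists (h, P `|` Q j `|` psi l @` Q j) => _; split=> /=.
  - apply: compactU; first exact: compactU.
    apply: continuous_compact => //; apply: continuous_subspaceT; exact: cpsi.
  - by move=> x Px; left; left.
  - by move=> x Qx; left; right.
  - by move=> x Px; have [] := hP x (or_introl Px).
  - exists l; split; first by move=> x; right.
    by move=> x Qx; have [] := hP x (or_intror Qx).
pose s := fix s n := if n is m.+1 then next (m, s m) else (@OO_cst R N Omega 0, set0).
have cs n : compact (s n).2.
  by elim: n => [|n IH]; [exact: compact0|have [] := nextP (n, s n) IH].
have sP n : step n (s n) (s n.+1) by exact: nextP (n, s n) (cs n).
have smono n m : (n <= m)%N -> (s n).2 `<=` (s m).2.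
  move=> /subnKC <-; elim: (m - n)%N => [|k IH]; first by rewrite addn0.
  by rewrite addnS; apply: subset_trans IH _; have [] := sP (n + k)%N.
have scauchy n m x : (n <= m)%N -> (s n).2 x ->
    normc (((s m).1 x : R[i]) - (s n).1 x) <= 2 * e n - 2 * e m.
  move=> /subnKC <- sx; elim: (m - n)%N => [|k IH].
    by rewrite addn0 !subrr -nr_normc nr0.
  have [_ _ _ h _] := sP (n + k)%N; have := h x (smono _ _ (leq_addr k n) x sx).
  rewrite addnS eS => h1.
  have := ler_normcD (((s (n + k).+1).1 x : R[i]) - (s (n + k)%N).1 x)
    (((s (n + k)%N).1 x : R[i]) - (s n).1 x).
  by rewrite addrA subrK; lra.
have Qs l n : (l < n)%N -> Q l `<=` (s n).2.
  by move=> ln; apply: subset_trans (smono _ _ ln); have [] := sP l.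
have small (t : R) : 0 < t -> exists n, 2 * e n < t by move=> t0; exact: expr2V_small.
have emono n m : (n <= m)%N -> e m <= e n.
  by move=> nm; rewrite lef_pV2 ?posrE ?exprn_gt0 // ler_eXn2l // ltr1n.
have [h hP] : exists h, forall K (t : R), compact K -> 0 < t -> exists n0, forall n,
    (n0 <= n)%N -> forall x, K x -> normc (((s n).1 x : R[i]) - h x) <= t.
  apply: OO_limit => K t cK t0.
  have [l lP] := compact_sub_exhaustion QS QT cK; have [n0 n0P] := small t t0.
  have main n m x : (maxn l.+1 n0 <= n)%N -> (n <= m)%N -> K x ->
      normc (((s m).1 x : R[i]) - (s n).1 x) <= t.
    rewrite geq_max => /andP[ln nn] nm /(lP l (leqnn l)) /(Qs _ _ ln) /(scauchy _ _ _ nm).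
    by have := emono _ _ nn; have := e0 m; lra.
  exists (maxn l.+1 n0) => n m hn hm x Kx; case/orP: (leq_total n m) => nm; last exact: main.
  by rewrite normcBC; exact: main.
have hlim n x : (s n).2 x -> normc ((h x : R[i]) - (s n).1 x) <= 2 * e n.
  move=> sx; apply/ler_addgt0Pr => t t0.
  have [n0 n0P] := hP _ t (cs n) t0.
  have := n0P (maxn n n0) (leq_maxr _ _) x sx; have := scauchy n (maxn n n0) x (leq_maxl _ _) sx.
  have := e0 (maxn n n0); set m := maxn n n0; rewrite (normcBC _ (h x : R[i])) => h1 h2 h3.
  have := ler_normcD ((h x : R[i]) - (s m).1 x) (((s m).1 x : R[i]) - (s n).1 x).
  by rewrite addrA subrK; lra.
exists h => g K t cK t0.
have t2 : 0 < t / 2 by rewrite divr_gt0.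
have [i iP] := dP g K _ cK t2.
have [l lP] := compact_sub_exhaustion QS QT cK.
have t4 : 0 < t / 2 by rewrite divr_gt0.
have [n nP] := small _ t2.
(* A stage of valuation [i], late enough that [Q j] contains [K] and the accumulated error is
   small. *)
pose j := (2 ^ i * 3 ^ maxn l n)%N.
have lj : (maxn l n <= j)%N.
  apply: leq_trans (ltnW (ltn_expl (maxn l n) (isT : (1 < 3)%N))) _.
  by rewrite leq_pmull // expn_gt0.
have ji : logn 2 j = i.
  by rewrite lognM ?expn_gt0 // pfactorK // lognX (_ : logn 2 3 = 0)%N // muln0 addn0.
have [_ _ _ _ [m [mP dm]]] := sP j.
exists m => x Kx; have Qx : Q j x by apply: (lP j) => //; exact: leq_trans (leq_maxl _ _) lj.
have h1 := hlim j.+1 (psi m x) (mP _ (ex_intro2 _ _ x Qx erefl)).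
have h2 := dm x Qx; rewrite ji in h2; have h3 := iP x Kx.
have h4 := emono n j (leq_trans (leq_maxr _ _) lj).
rewrite eS in h1.
have := ler_normcD ((h (psi m x) : R[i]) - (s j.+1).1 (psi m x))
  (((s j.+1).1 (psi m x) : R[i]) - d i x).
have := ler_normcD ((h (psi m x) : R[i]) - d i x) ((d i x : R[i]) - g x).
rewrite !addrA !subrK; lra.
Qed.

End universality.

(** * Runge images *)

Section runge.
Context {R : realType} {N : nat}.
Variable Omega : complex_manifold 'rV[R[i]]_N.

Lemma dense_range_of_runge (phi : hol Omega Omega) :
  injective phi -> runge_domain (range phi) -> dense_range (phi : Omega -> Omega).
Proof.
move=> injphi [_ _ _ runge] g K e cK e0.
pose f (y : Omega) : CC R :=
  if pselect (exists x, phi x = y) is left h then g (projT1 (cid h)) else (0 : R[i]).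
have fphi x : f (phi x) = g x.
  rewrite /f; case: pselect => [h|[]]; last by exists x.
  by congr (g _); apply: injphi; exact: projT2 (cid h).
suff hf : holomorphic_on (range phi) f.
  have cphiK : compact (phi @` K) by exact: (@compact_iter_hol R N Omega phi 1 K).
  have [|G GP] := runge f hf _ cphiK _ e e0; first by move=> _ [x _ <-]; exists x.
  exists G => x Kx; have := GP (phi x) (ex_intro2 _ _ x Kx erefl).
  by rewrite fphi normcBC.
move=> _ [x0 _ <-].
have [c Ac cx] := atlas_cover x0; have [d Ad dy] := atlas_cover (phi x0).
apply/(holomorphic_chartP f Ad dy).
have phinb : nbhs x0 (phi @^-1` chart_dom d).
  apply: (hol_funP phi I).1; apply: open_nbhs_nbhs.
  by split=> //; exact: chart_dom_open.
have [rho rho0 rhoP] := chart_ball cx phinb.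
pose F : 'rV[R[i]]_N -> 'rV[R[i]]_N := d \o phi \o chart_inv c.
have dF z : nr (z - c x0) < rho -> differentiable F z.
  move=> /rhoP[h1 h2 h3]; rewrite -[z in differentiable _ z]h2.
  exact: (hol_funP phi I).2.
have injF z w : nr (z - c x0) < rho -> nr (w - c x0) < rho -> F z = F w -> z = w.
  move=> /rhoP[h1 h2 h3] /rhoP[k1 k2 k3] /(congr1 (chart_inv d)).
  rewrite /F /= !chart_funK // => /injphi zw.
  by rewrite -h2 zw k2.
have [delta [eta [G [/andP[_ delta0] eta0 _ GP dG]]]] :=
  inverse_function rho0 dF (osgood rho0 dF injF).
have FE : F (c x0) = d (phi x0) by rewrite /F /= chart_funK.
rewrite FE in GP dG.
have Grho w : nr (w - d (phi x0)) < eta -> nr (G w - c x0) < rho.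
  by move=> /GP[h _]; exact: lt_le_trans delta0.
(* Near [d (phi x0)], the local inverse [G] reads [phi^-1] in charts, so there [f] is [g] composed
   with a holomorphic map. *)
have inv w : nr (w - d (phi x0)) < eta -> phi (chart_inv c (G w)) = chart_inv d w.
  move=> wr; have [_ h] := GP w wr; have [_ _ h3] := rhoP _ (Grho w wr).
  by rewrite -[in RHS]h /F /= chart_funK.
have y0 : nr (d (phi x0) - d (phi x0)) < eta by rewrite subrr nr0.
apply: (@near_eq_differentiable _ _ _ ((g \o chart_inv c : _ -> R[i]) \o G)).
  by apply/nbhs_nrP; exists eta => // w wr; rewrite /= -inv // fphi.
apply: differentiable_comp; first exact: (dG _ y0).1.
have [h1 h2 _] := rhoP _ (Grho _ y0).
by apply: (chart_differentiable (f := hol_fun g) Ac h1 h2); exact: hol_funP.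
Qed.

End runge.

(** * Tautness *)

Section disc.
Context {R : realType}.

(** The bound is imposed on the whole plane, where composites [g \o u] with a map [u] representing a
    disc are defined. *)
Definition disc_class : set (R[i] -> R[i]) :=
  [set g | (forall z, normc z < 1 -> differentiable g z) /\ forall z, normc (g z) < 1].

Lemma disc_class_le1 g z : disc_class g -> normc (g z) <= 1.
Proof. by move=> [_ h]; exact: ltW. Qed.

(** A segment from [0] is cut into [n] steps short enough for [schwarz_pick]; each step doubles
    [1 + C], whence [2 ^+ k - 1]. *)
Lemma disc_close (r : R) : 0 <= r < 1 -> exists2 C : R, 0 <= C & forall z w,
  normc z <= r -> normc w <= r -> hyp_close disc_class C z w.
Proof.
move=> /andP[r0 r1]; have s0 : 0 < 1 - r by rewrite subr_gt0.
have step z w : normc z <= r -> 32 * normc (w - z) < 1 - r -> hyp_close disc_class 1 z w.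
  move=> zr wz g [dg g1]; rewrite !mul1r; apply: (schwarz_pick (rho := 1 - r)).
  - move=> y; rewrite nr_normc => yz; apply: dg.
    by have := ler_normc_dist y z 0; rewrite !subr0; lra.
  - by move=> y _; exact: g1.
  - by rewrite nr_normc.
pose n := (Num.bound (32 / (1 - r))).+1.
have n0 : 0 < n%:R :> R by rewrite ltr0n.
have nr1 : 32 * (n%:R)^-1 < 1 - r.
  have h : 32 / (1 - r) < n%:R.
    apply: lt_trans (archi_boundP _) _; last by rewrite ltr_nat.
    by rewrite divr_ge0 // ltW.
  by rewrite ltr_pdivrMr // mulrC -ltr_pdivrMr.
have C0 k : 0 <= 2 ^+ k - 1 :> R by rewrite subr_ge0 exprn_ege1 // ler1n.
have chain z k : normc z <= r -> (k <= n)%N ->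
    hyp_close disc_class (2 ^+ k - 1) 0 ((k%:R / n%:R)%:C * z).
  move=> zr; elim: k => [_|k IH kn].
    by rewrite mul0r mul0r; exact: (hyp_close_refl disc_class_le1).
  have E : 2 ^+ k.+1 - 1 = (2 ^+ k - 1) + 1 + (2 ^+ k - 1) * 1 :> R by rewrite exprS; ring.
  rewrite E; apply: (hyp_close_trans (C0 k) ler01 (IH (ltnW kn))).
  have kn1 : k%:R / n%:R <= 1 :> R by rewrite ler_pdivrMr // mul1r ler_nat ltnW.
  have kn0 : 0 <= k%:R / n%:R :> R by rewrite divr_ge0 // ler0n.
  apply: step.
    rewrite normcM normc_real ger0_norm //; apply: le_trans zr.
    by rewrite ler_piMl ?normc_ge0.
  rewrite -mulrBl -rmorphB /= -mulrBl -natrB // subSnn mul1r normcM normc_real.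
  rewrite ger0_norm ?invr_ge0 ?(ltW n0) //; apply: le_lt_trans nr1.
  rewrite ler_wpM2l // ler_piMr ?invr_ge0 ?(ltW n0) //; exact: le_trans zr (ltW r1).
have full z : normc z <= r -> hyp_close disc_class (2 ^+ n - 1) 0 z.
  by move=> zr; have := chain z n zr (leqnn n); rewrite divff ?gt_eqF // mul1r.
exists ((2 ^+ n - 1) + (2 ^+ n - 1) + (2 ^+ n - 1) * (2 ^+ n - 1)).
  by have := mulr_ge0 (C0 n) (C0 n); have := C0 n; lra.
move=> z w zr wr; apply: (hyp_close_trans (C0 n) (C0 n) _ (full w wr)).
exact: hyp_close_sym (full z zr).
Qed.

Lemma compact_in_disc (K : set R[i]) : compact K -> (forall z, K z -> normc z < 1) ->
  exists2 r : R, 0 <= r < 1 & forall z, K z -> normc z <= r.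
Proof.
move=> cK K1; have [K0|] := pselect (K !=set0); last first.
  by move=> h; exists 0; [rewrite lexx ltr01|move=> z Kz; case: h; exists z].
have [|c Kc cP] := compact_sup_attained cK K0 (v := fun z => normc z).
  apply: continuous_subspaceT => z U /nbhs_normP[e /= e0 eP].
  apply/nbhs_nrP; exists e => // y; rewrite nr_normc => yz; apply: eP => /=.
  have := lerB_normc y z; have := lerB_normc z y; rewrite (normcBC z) => h1 h2.
  by rewrite ltr_norml; apply/andP; split; lra.
by exists (normc c) => //; rewrite normc_ge0 K1.
Qed.

Lemma lipschitz_modulus m (M rho e : R) : 0 < rho -> 0 < e -> exists2 d : R, 0 < d &
  forall (g : R[i] -> 'rV[R[i]]_m) (p : R[i]),
    (forall z, nr (z - p) < rho -> differentiable g z) ->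
    (forall z, nr (z - p) < rho -> nr (g z) <= M) ->
    forall z, nr (z - p) < d -> nr (g z - g p) <= e.
Proof.
move=> rho0 e0; pose M1 := 8 * (`|M| + 1).
have M10 : 0 < M1 by rewrite mulr_gt0 // ltr_wpDl.
exists (Num.min (rho / 2) (e * rho / M1)).
  by rewrite lt_min !divr_gt0 // mulr_gt0.
move=> g p dg bg z; rewrite lt_min => /andP[zr ze].
have pp : nr (p - p) < rho / 2 by rewrite subrr nr0 divr_gt0.
have := cauchy_lipschitz_rV dg bg pp zr.
rewrite ltr_pdivlMr // in ze; move=> h; rewrite -(ler_pM2l rho0); apply: le_trans h _.
rewrite (mulrC rho); apply: le_trans (ltW ze); rewrite mulrC ler_wpM2l ?nr_ge0 //.
by rewrite /M1; have := ler_norm M; lra.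
Qed.

(** An index [k] close to the limit at both [x] and [x'] transfers the common modulus of continuity
    to [y]; the open set [B] guarantees pointwise convergence at the neighbours [x'] as well. *)
Lemma filter_uniform_limit (X : topologicalType) (W : normedModType R[i])
    (F : set_system nat) (Y : nat -> X -> W) (y : X -> W) (K B : set X) (S : set nat) :
  ProperFilter F -> F S -> compact K -> open B -> K `<=` B ->
  (forall x (e : R), K x -> 0 < e ->
     \forall x' \near x, forall n, S n -> nr (Y n x' - Y n x) <= e) ->
  (forall x (e : R), B x -> 0 < e -> F [set n | nr (Y n x - y x) < e]) ->
  forall e : R, 0 < e -> F [set n | forall x, K x -> nr (Y n x - y x) < e].
Proof.
move=> PF FS /compact_near_coveringP cK oB KB eqc ptw e e0.
apply: (cK nat F (fun n x => nr (Y n x - y x) < e)) => x Kx.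
have e8 : 0 < e / 8 by rewrite divr_gt0.
have h1 := eqc x _ Kx e8.
have h2 : nbhs x B by apply: open_nbhs_nbhs; split=> //; exact: KB.
have h3 := ptw x _ (KB x Kx) e8.
exists ([set x' | B x' /\ forall n, S n -> nr (Y n x' - Y n x) <= e / 8],
        [set n | S n /\ nr (Y n x - y x) < e / 8]) => /=.
  by split; [apply: filterI|apply: filterI].
move=> [x' n] /= [[Bx' cx'] [Sn nx]].
have [k [Sk kx kx']] : exists k, [/\ S k, nr (Y k x - y x) < e / 8 & nr (Y k x' - y x') < e / 8].
  have [k [[h4 h5] h6]] := filter_ex (filterI (filterI FS h3) (ptw x' _ Bx' e8)).
  by exists k.
have a1 := cx' n Sn; have a2 := cx' k Sk.
have := ler_nr_dist (Y n x') (Y n x) (y x'); have := ler_nr_dist (Y n x) (y x) (y x').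
have := ler_nr_dist (y x) (Y k x) (y x'); have := ler_nr_dist (Y k x) (Y k x') (y x').
by rewrite (nrBC (y x) (Y k x)) (nrBC (Y k x) (Y k x')); lra.
Qed.

Lemma ultra_limit (X : topologicalType) (F : set_system nat) (v : nat -> X) (K : set X) :
  UltraFilter F -> compact K -> F [set n | K (v n)] ->
  exists2 p, K p & forall A, nbhs p A -> F [set n | A (v n)].
Proof.
move=> UF cK FK; have PF : ProperFilter F := ultra_proper.
have [p [Kp clp]] := cK (v @ F) _ FK.
exists p => // A pA; have [//|FA] := in_ultra_setVsetC [set n | A (v n)] UF.
by have [q [nA Aq]] := clp (~` A) A FA pA.
Qed.

End disc.

Section tautness.
Context {R : realType} {N : nat}.
Variable Omega : complex_manifold 'rV[R[i]]_N.

Local Notation close := (hyp_close (@OO_disc R N Omega)).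

Lemma hol_near (W : normedModType R[i]) (F : hol Omega (model W)) x (e : R) : 0 < e ->
  \forall y \near x, nr ((F y : W) - F x) < e.
Proof.
move=> e0; have h : nbhs (F x : W) [set z | nr (z - F x) < e] by apply/nbhs_nrP; exists e.
exact: (hol_funP F I).1 _ h.
Qed.

Lemma hol_compact_bounded (W : normedModType R[i]) (F : hol Omega (model W)) (K : set Omega) :
  compact K -> exists M : R, forall x, K x -> nr (F x : W) <= M.
Proof.
move=> /compact_near_coveringP /(_ nat \oo (fun n y => nr (F y : W) <= n%:R)) cK.
have [|n _ nP] := cK _; last by exists n%:R; exact: nP n (leqnn n).
move=> x Kx; exists ([set y | nr ((F y : W) - F x) < 1],
    [set n : nat | nr (F x : W) + 1 <= n%:R]) => /=.
  split; first exact: hol_near.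
  exists (Num.bound (nr (F x : W) + 1)) => // n /= nb.
  have h0 : 0 <= nr (F x : W) + 1 by rewrite addr_ge0 ?nr_ge0.
  by apply: le_trans (ltW (archi_boundP h0)) _; rewrite ler_nat.
move=> [y n] /= [yx nx]; apply: le_trans nx.
by have := lerB_nr (F y : W) (F x); lra.
Qed.

Lemma hol_compact_gap (W : normedModType R[i]) (F : hol Omega (model W)) (K : set Omega) a :
  compact K -> (forall x, K x -> F x <> a) ->
  exists2 d : R, 0 < d & forall x, K x -> d <= nr ((F x : W) - a).
Proof.
move=> /compact_near_coveringP /(_ nat \oo (fun n y => n.+1%:R^-1 <= nr ((F y : W) - a))) cK Fa.
have [|n _ nP] := cK _; last first.
  by exists (n.+1%:R^-1); [rewrite invr_gt0|exact: nP n (leqnn n)].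
move=> x Kx; have xa : 0 < nr ((F x : W) - a).
  by rewrite nr_gt0 subr_eq0; apply/eqP; exact: Fa.
have h2 : 0 < nr ((F x : W) - a) / 2 by rewrite divr_gt0.
exists ([set y | nr ((F y : W) - F x) < nr ((F x : W) - a) / 2],
    [set n : nat | n.+1%:R^-1 <= nr ((F x : W) - a) / 2]) => /=.
  split; first exact: hol_near.
  exists (Num.bound (nr ((F x : W) - a) / 2)^-1) => // n /= nb.
  rewrite -[leRHS]invrK lef_pV2 ?posrE ?invr_gt0 //.
  apply: le_trans (ltW (archi_boundP _)) _; first by rewrite invr_ge0 ltW.
  by rewrite ler_nat ltnW.
move=> [y n] /= [yx nx]; apply: le_trans nx _.
have := ler_nr_dist (F x : W) (F y) a; rewrite (nrBC (F x : W) (F y)); lra.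
Qed.

Lemma disc_hol_chart (u : CC R -> Omega) (c : chart 'rV[R[i]]_N Omega) (z : R[i]) :
  holomorphic_on unit_disc u -> normc z < 1 -> atlas c -> chart_dom c (u z) ->
  differentiable (fun w : R[i] => c (u w)) z.
Proof. by move=> hu z1 Ac cz; exact: (hu z z1).2 (id_chart R[i]) c erefl Ac I cz. Qed.

Lemma disc_hol_comp (W : normedModType R[i]) (G : hol Omega (model W))
    (u : CC R -> Omega) (z : R[i]) : holomorphic_on unit_disc u -> normc z < 1 ->
  differentiable (fun w : R[i] => G (u w) : W) z.
Proof.
move=> hu z1; have := cdifferentiable_at_comp (hol_funP G I) (hu z z1).
by move=> [_ /(_ (id_chart R[i]) (id_chart W) erefl erefl I I)].
Qed.

Lemma close_of_disc (u : CC R -> Omega) C (z w : R[i]) : holomorphic_on unit_disc u ->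
  hyp_close (@disc_class R) C z w -> close C (u z) (u w).
Proof.
move=> hu zw _ [g g1 ->]; apply: (zw (fun y : R[i] => g (u y) : R[i])); split=> // y y1.
exact: disc_hol_comp.
Qed.

(* Along an ultrafilter the maps converge pointwise in [Omega]; the embedding
   [F] only serves to see that the convergence is locally uniform. *)
Lemma taut_of_caratheodory (z0 : Omega) : connected [set: Omega] ->
  caratheodory_tends_to_infinity z0 -> taut Omega.
Proof.
move=> cO tz F [injF _ _] u hu.
have [|ncd] := pselect (compactly_divergent u); [by left|right].
have [K0 [L0 [cK0 K01 cL0 inf]]] : exists (K0 : set R[i]) (L0 : set Omega),
    [/\ compact K0, forall z, K0 z -> normc z < 1, compact L0 &
      forall n0, exists2 n, (n0 <= n)%N & exists2 z, K0 z & L0 (u n z)].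
  apply: contrapT => none; apply: ncd => K L cK K1 cL.
  apply: contrapT => none2; apply: none; exists K, L; split=> // n0.
  apply: contrapT => none3; apply: none2; exists n0 => n n0n.
  apply/seteqP; split=> // _ [[z Kz <-] Lz]; apply: none3.
  by exists n => //; exists z.
(* Failure of compact divergence makes [S] infinite; the ultrafilter [U] refines the filter of its
   tails, so each member of [U] contains arbitrarily large indices from [S]. *)
pose S := [set n | exists2 z, K0 z & L0 (u n z)].
pose F0 := filter_from setT (fun n0 => [set n | (n0 <= n)%N /\ S n]).
have PF0 : ProperFilter F0.
  apply: filter_from_proper; last by move=> n0 _; have [n h1 h2] := inf n0; exists n.
  apply: filter_from_filter; first by exists 0%N.
  move=> i j _ _; exists (maxn i j) => // n [/=].
  by rewrite geq_max => /andP[h1 h2] Sn; split.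
have [U [UU F0U]] := ultraFilterLemma PF0.
have PU : ProperFilter U := @ultra_proper _ _ UU.
have US : U S by apply: F0U; exists 0%N => // n [].
have Ularge n0 : U [set n | (n0 <= n)%N] by apply: F0U; exists n0 => // n [].
have [r0 /andP[r00 r01] r0P] := compact_in_disc cK0 K01.
have [C0 C00 C0P] := close_compact z0 cO cL0.
have bnd (r : R) : 0 <= r < 1 -> exists2 L : set Omega, compact L &
    forall n z, S n -> normc z <= r -> L (u n z).
  move=> /andP[rr0 rr1].
  have [|C C0' CP] := @disc_close R (Num.max r r0).
    by rewrite le_max rr0 gt_max rr1.
  have [|L cL LP] := close_relatively_compact tz (_ : 0 <= C + C0 + C * C0).
    by rewrite !addr_ge0 ?mulr_ge0.
  exists L => // n z [w K0w L0w] zr; apply: LP.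
  apply: (hyp_close_trans C0' C00 _ (C0P _ L0w)); apply: close_of_disc => //.
  by apply: CP; rewrite le_max ?zr // r0P // orbT.
have [f fP] : {f : R[i] -> Omega & forall z, normc z < 1 ->
    forall A, nbhs (f z) A -> U [set n | A (u n z)]}.
  apply: (@choice R[i] Omega (fun z p => normc z < 1 -> forall A, nbhs p A -> U [set n | A (u n z)])).
  move=> z; have [z1|] := boolP (normc z < 1); last by exists (u 0%N z).
  have [|L cL LP] := bnd (normc z); first by rewrite normc_ge0.
  have [|p Lp pP] := @ultra_limit _ U (fun n => u n z) L UU cL; last by exists p.
  by apply: filterS US => n Sn; exact: LP.
have dFu n z : normc z < 1 -> differentiable (fun w : R[i] => F (u n w) : 'rV[R[i]]_(2 * N).+1) z.
  by move=> z1; exact: disc_hol_comp.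
have nearp z (rho : R) w : nr (w - z) < rho -> normc z + rho <= 1 -> normc w < 1.
  by rewrite nr_normc => h1 h2; have := lerB_normc w z; lra.
have equi z (e : R) : normc z < 1 -> 0 < e -> exists d : R, [/\ 0 < d, normc z + d <= 1 &
    forall n, S n -> forall w, nr (w - z) < d -> nr ((F (u n w) : 'rV[R[i]]_(2 * N).+1) - F (u n z)) <= e].
  move=> z1 e0; pose rho := (1 - normc z) / 2.
  have z0' := normc_ge0 z; have rho0 : 0 < rho by rewrite divr_gt0 // subr_gt0.
  have [|L cL LP] := bnd (normc z + rho); first by rewrite /rho; lra.
  have [M MP] := hol_compact_bounded F cL.
  have [d d0 dP] := lipschitz_modulus (2 * N).+1 M rho0 e0.
  exists (Num.min d rho); rewrite lt_min d0 rho0; split=> //.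
    have : Num.min d rho <= rho by rewrite ge_min lexx orbT.
    by rewrite {2}/rho; lra.
  move=> n Sn w; rewrite lt_min => /andP[wd _].
  apply: (dP (fun w => F (u n w)) z) => // y yz.
    by apply: dFu; apply: nearp yz _; rewrite /rho; lra.
  by apply: MP; apply: LP => //; rewrite nr_normc in yz; have := lerB_normc y z; lra.
(* Traps [u n] near [z] in a given neighbourhood of [f z]. By injectivity, [F] keeps a distance [de]
   between [f z] and the compact part of [L] outside the interior of [K1], and equicontinuity of
   [F \o u n] prevents crossing this gap. *)
have loc z (A0 : set Omega) : normc z < 1 -> nbhs (f z) A0 -> exists d : R,
    [/\ 0 < d, normc z + d <= 1 & exists2 A, U A & forall w, nr (w - z) < d ->
      A0 (f w) /\ forall n, A n -> A0 (u n w)].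
  move=> z1 fA0; have [c Ac cf] := atlas_cover (f z).
  have [_ [K1 [_ cK1 nK1 K1A0 _]]] := compact_chart_ball cf fA0.
  have z0' := normc_ge0 z.
  have [|L cL LP] := bnd ((1 + normc z) / 2); first lra.
  have cLK : compact (L `&` ~` K1^°).
    by apply: (compact_closedI cL); apply: open_closedC; exact: open_interior.
  have [|de de0 deP] := @hol_compact_gap _ F _ (F (f z)) cLK.
    by move=> y [_ ny] /injF yf; apply: ny; rewrite yf.
  have de2 : 0 < de / 2 by rewrite divr_gt0.
  have [d [d0 dz dP]] := equi z _ z1 de2.
  pose A := S `&` [set n | nr ((F (u n z) : 'rV[R[i]]_(2 * N).+1) - F (f z)) < de / 2].
  have UA : U A by apply: filterI => //; apply: (fP z z1 _ (hol_near F _ de2)).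
  pose d1 := Num.min d ((1 - normc z) / 2).
  have d10 : 0 < d1 by rewrite lt_min d0 divr_gt0 // subr_gt0.
  have inK n w : A n -> nr (w - z) < d1 -> K1 (u n w).
    move=> [Sn nA]; rewrite lt_min => /andP[wd wr]; apply: contrapT => nK.
    have wr' : normc w <= (1 + normc z) / 2.
      by rewrite nr_normc in wr; have := lerB_normc w z; lra.
    have /deP h : (L `&` ~` K1^°) (u n w).
      by split; [exact: LP|move=> /interior_subset].
    have := dP n Sn w wd.
    have := ler_nr_dist (F (u n w) : 'rV[R[i]]_(2 * N).+1) (F (u n z)) (F (f z)).
    by move: nA => /=; lra.
  exists d1; split=> //.
    have : d1 <= (1 - normc z) / 2 by rewrite ge_min lexx orbT.
    by lra.
  exists A => // w wd; split; last by move=> n An; apply: K1A0; exact: inK.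
  have w1 : normc w < 1.
    by apply: nearp wd _; have : d1 <= (1 - normc z) / 2; [rewrite ge_min lexx orbT|lra].
  have clK1 : closed K1 by apply: compact_closed => //; exact: manifold_hausdorff.
  apply: K1A0; apply: clK1 => B /(fP w w1) UB.
  have [n [An Bn]] := filter_ex (filterI UA UB).
  by exists (u n w); split=> //; exact: inK.
have hf : holomorphic_on unit_disc (f : CC R -> Omega).
  move=> z z1; have fc w : normc w < 1 -> {for w, continuous f}.
    move=> w1 A /(loc w A w1)[d [d0 _ [B _ dP]]].
    by apply/nbhs_nrP; exists d => // y /dP[].
  split; first exact: fc.
  move=> _ c -> Ac _ cf.
  change (differentiable (fun w : R[i] => c (f w)) z).
  have fB := chart_nbhs cf (ltr01 : 0 < 1 :> R).
  have [d [d0 dz [A UA dP]]] := loc z _ z1 fB.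
  pose M := nr (c (f z)) + 1.
  have Mb v : nr (c v - c (f z)) < 1 -> nr (c v) <= M.
    by have := lerB_nr (c v) (c (f z)); rewrite /M; lra.
  have d4 : 0 < d / 4 by rewrite divr_gt0.
  have d2 : 0 < d / 2 by rewrite divr_gt0.
  have in1 w : nr (w - z) < d -> normc w < 1 by move=> h; exact: nearp h dz.
  have unif (e : R) : 0 < e -> U [set n | forall w, nr (w - z) <= d / 4 -> nr (c (u n w) - c (f w)) < e].
    apply: (@filter_uniform_limit R R[i] _ U (fun n w => c (u n w)) (fun w => c (f w))
      [set w | nr (w - z) <= d / 4] [set w | nr (w - z) < d] A PU UA).
    - have -> : [set w : R[i] | nr (w - z) <= d / 4] = [set w | normc (w - z) <= d / 4].
        by apply/seteqP; split=> w /=; rewrite nr_normc.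
      exact: compact_closed_disc.
    - rewrite openE => w /= wz; apply/nbhs_nrP; exists (d - nr (w - z)).
        by rewrite subr_gt0.
      by move=> y yw /=; have := ler_nr_dist y w z; lra.
    - by move=> w /=; lra.
    - move=> w t /= wz t0.
      have [de de0 deP] := lipschitz_modulus N M d2 t0.
      have wB y : nr (y - w) < d / 2 -> nr (y - z) < d.
        by have := ler_nr_dist y w z; lra.
      apply/nbhs_nrP; exists de => // y yw n An.
      apply: (deP (fun y => c (u n y)) w) => // x xw.
        have [_ h] := dP x (wB x xw); have [h1 _] := h n An.
        by apply: disc_hol_chart => //; apply: in1; exact: wB.
      by apply: Mb; have [_ h] := dP x (wB x xw); have [] := h n An.
    move=> w t /= wd t0; have [[cfw _] _] := dP w wd.
    by have := fP w (in1 w wd) _ (chart_nbhs cfw t0); apply: filterS => n [].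
  have [n nP] : {n : nat -> nat & forall k, A (n k) /\
      forall w, nr (w - z) <= d / 4 -> nr (c (u (n k) w) - c (f w)) < k.+1%:R^-1}.
    apply: (@choice nat nat (fun k n => A n /\
      forall w, nr (w - z) <= d / 4 -> nr (c (u n w) - c (f w)) < k.+1%:R^-1)) => k.
    have k0 : 0 < k.+1%:R^-1 :> R by rewrite invr_gt0.
    by have [n [h1 h2]] := filter_ex (filterI UA (unif _ k0)); exists n.
  apply: differentiable_rV => j.
  apply: (@weierstrass R R[i] (fun k w => c (u (n k) w) 0 j) (fun w => c (f w) 0 j) z (d / 4) d4).
    move=> k w wz; have wd : nr (w - z) < d by lra.
    have [_ h] := dP w wd; have [h1 _] := h _ (nP k).1.
    by apply: (differentiable_coordv j (disc_hol_chart (hu _) (in1 w wd) Ac h1)).1.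
  move=> e e0; exists (Num.bound e^-1) => k ek w wz.
  have h1 := (nP k).2 w (ltW wz).
  have h2 : k.+1%:R^-1 <= e.
    rewrite -[leRHS]invrK lef_pV2 ?posrE ?invr_gt0 //.
    apply: le_trans (ltW (archi_boundP _)) _; first by rewrite invr_ge0 ltW.
    by rewrite ler_nat ltnW.
  have := nr_coord (c (u (n k) w) - c (f w)) j; rewrite !mxE.
  by move=> h3; apply: le_trans h3 _; apply: le_trans h2; exact: ltW.
have unif (r e : R) : r < 1 -> 0 < e -> U [set n | forall w, normc w <= r ->
    nr ((F (u n w) : 'rV[R[i]]_(2 * N).+1) - F (f w)) < e].
  move=> r1; apply: (@filter_uniform_limit R R[i] _ U (fun n w => F (u n w) : 'rV[R[i]]_(2 * N).+1)
    (fun w => F (f w)) [set w | normc w <= r] [set w | normc w < 1] S PU US).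
  - have -> : [set w : R[i] | normc w <= r] = [set w | normc (w - 0) <= r].
      by apply/seteqP; split=> w /=; rewrite subr0.
    exact: compact_closed_disc.
  - rewrite openE => w /= w1; apply/nbhs_nrP; exists (1 - normc w); first by rewrite subr_gt0.
    by move=> y yw; apply: nearp yw _; lra.
  - by move=> w /=; lra.
  - move=> w e1 /= wr e10; have [|d [d0 _ dP]] := equi w _ _ e10; first lra.
    by apply/nbhs_nrP; exists d => // y yw n Sn; exact: dP.
  by move=> w e1 /= w1 e10; exact: (fP w w1 _ (hol_near F _ e10)).
pose rad (j : nat) : R := 1 - j.+2%:R^-1.
have rad1 j : rad j < 1 by rewrite ltrBlDr ltrDl invr_gt0.
(* Diagonal extraction: the [j]-th index exceeds the previous one and is accurate to [j.+1%:R^-1] on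
   the disc of radius [rad j]; these discs exhaust the unit disc. *)
have [nxt nxtP] : {nxt : nat * nat -> nat & forall a, (a.2 < nxt a)%N /\
    forall w, normc w <= rad a.1 ->
      nr ((F (u (nxt a) w) : 'rV[R[i]]_(2 * N).+1) - F (f w)) < a.1.+1%:R^-1}.
  apply: (@choice (nat * nat)%type nat (fun a n => (a.2 < n)%N /\
    forall w, normc w <= rad a.1 ->
      nr ((F (u n w) : 'rV[R[i]]_(2 * N).+1) - F (f w)) < a.1.+1%:R^-1)) => -[j m] /=.
  have j0 : 0 < j.+1%:R^-1 :> R by rewrite invr_gt0.
  by have [n [h1 h2]] := filter_ex (filterI (Ularge m.+1) (unif _ _ (rad1 j) j0)); exists n.
pose k := fix k j := nxt (j, if j is i.+1 then k i else 0%N).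
have kP j : forall w, normc w <= rad j ->
    nr ((F (u (k j) w) : 'rV[R[i]]_(2 * N).+1) - F (f w)) < j.+1%:R^-1.
  by case: j => [|j]; exact: (nxtP (_, _)).2.
exists k; split; first by apply: homo_ltn ltn_trans _ => i; exact: (nxtP (i.+1, k i)).1.
exists f; split=> // K cK K1 P /uniform_nbhs[E [entE EP]].
have [e e0 eP] := entourage_nrP entE.
have [r /andP[_ r1] rP] := compact_in_disc cK K1.
pose b := Num.bound (Num.min e (1 - r))^-1.
have m0 : 0 < Num.min e (1 - r) by rewrite lt_min e0 subr_gt0.
exists b => // j bj; apply: EP => w Kw /=; apply: eP.
have jm : j.+1%:R^-1 <= Num.min e (1 - r).
  rewrite -[leRHS]invrK lef_pV2 ?posrE ?invr_gt0 //.
  apply: le_trans (ltW (archi_boundP _)) _; first by rewrite invr_ge0 ltW.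
  by rewrite ler_nat ltnW.
have je : j.+1%:R^-1 <= e by apply: le_trans jm _; rewrite ge_min lexx.
have jr : j.+1%:R^-1 <= 1 - r by apply: le_trans jm _; rewrite ge_min lexx orbT.
apply: lt_le_trans je; apply: kP; apply: le_trans (rP w Kw) _.
rewrite /rad lerBrDr -lerBrDl; apply: le_trans jr.
by rewrite lef_pV2 ?posrE // ler_nat.
Qed.

End tautness.

(** * Hypercyclicity *)

Section hypercyclicity.
Context {R : realType} {N : nat}.
Variable Omega : complex_manifold 'rV[R[i]]_N.
Implicit Types (f g h : OO Omega) (K L : set Omega) (phi : hol Omega Omega).

Local Notation close := (hyp_close (@OO_disc R N Omega)).

Lemma iter_composition_operator phi f n x :
  iter n (composition_operator phi) f x = f (iter n phi x).
Proof. by elim: n x => // n IH x; rewrite iterS iterSr -IH. Qed.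

(** Both assertions on hypercyclicity end here: a run-away sequence and an orbit tending to infinity
    each supply, for every compact set, an index at which the orbit of [z1] is outside it. *)
Lemma hypercyclic_wrt_of_escape (z0 z1 : Omega) phi (m : nat -> nat) :
  stein Omega -> connected [set: Omega] -> caratheodory_tends_to_infinity z0 ->
  dense_range (phi : Omega -> Omega) ->
  (forall L, compact L -> exists l, ~ L (iter (m l) phi z1)) ->
  hypercyclic_wrt (composition_operator phi) m.
Proof.
move=> [[Q [cQ QS QT]] _ _ _] cO tz dr esc.
have [|K f g e cK e0|h hP] := @universal_vector R N Omega Q (fun l => iter (m l) phi) cQ QS QT.
- by move=> l; exact: iter_hol_continuous.
- have [L cL LP] := transitivity z1 f g cO tz dr cK e0.
  by have [l /LP[h hP]] := esc L cL; exists l, h.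
exists h; apply/dense_OO => g K e cK e0; have [l lP] := hP g K e cK e0.
exists (iter (m l) (composition_operator phi) h); first by exists l.
by move=> x Kx; rewrite iter_composition_operator; exact: lP.
Qed.

Lemma hypercyclic_approx phi : hypercyclic (composition_operator phi) ->
  exists f, forall g K (e : R), compact K -> 0 < e ->
    exists l, forall x, K x -> normc ((f (iter l phi x) : R[i]) - g x) < e.
Proof.
move=> [f /dense_OO fP]; exists f => g K e cK e0.
have [_ [l _ <-] lP] := fP g K e cK e0.
by exists l => x Kx; rewrite -iter_composition_operator; exact: lP.
Qed.

(** An approximation by an iterate of index at least [1] lies in the range. Index [0] cannot
    approximate both [g] and [g + e / 2] within [e / 4] on a nonempty [K], and either of the two
    serves. *)
Lemma hypercyclic_dense_range phi : hypercyclic (composition_operator phi) ->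
  dense_range (phi : Omega -> Omega).
Proof.
move=> /hypercyclic_approx[f fP] g K e cK e0.
have [[p Kp]|K0] := pselect (K !=set0); last first.
  by exists g => x Kx; case: K0; exists x.
have succ l (e' : R) : e' <= e -> (forall x, K x -> normc ((f (iter l.+1 phi x) : R[i]) - g x) < e') ->
    exists G : OO Omega, forall x, K x -> normc ((G (phi x) : R[i]) - g x) < e.
  move=> e'e lP; exists (iter l (composition_operator phi) f) => x Kx.
  by rewrite iter_composition_operator -iterSr; apply: lt_le_trans e'e; exact: lP.
have e4 : 0 < e / 4 by rewrite divr_gt0.
have [[|l] lP] := fP g K _ cK e4; last by apply: (succ l _ _ lP); lra.
pose g' := OO_add g (@OO_cst R N Omega (e / 2)%:C).
have g'E x : g' x = (g x : R[i]) + (e / 2)%:C :> R[i] by [].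
have n2 : normc ((e / 2)%:C : R[i]) = e / 2 by rewrite normc_real ger0_norm // divr_ge0 // ltW.
have [[|l] lP'] := fP g' K _ cK e4.
  have h1 : normc ((f p : R[i]) - g p) < e / 4 := lP p Kp.
  have h2 : normc ((f p : R[i]) - ((g p : R[i]) + (e / 2)%:C)) < e / 4 := lP' p Kp.
  have := ler_normcB ((f p : R[i]) - g p) ((f p : R[i]) - ((g p : R[i]) + (e / 2)%:C)).
  have -> : (f p : R[i]) - g p - ((f p : R[i]) - ((g p : R[i]) + (e / 2)%:C)) = (e / 2)%:C by ring.
  by rewrite n2; lra.
apply: (succ l (e / 4 + e / 2)) => [|x Kx]; first by lra.
have := lP' x Kx; rewrite g'E => h1.
have := ler_normcD ((f (iter l.+1 phi x) : R[i]) - ((g x : R[i]) + (e / 2)%:C)) (e / 2)%:C.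
have -> : (f (iter l.+1 phi x) : R[i]) - ((g x : R[i]) + (e / 2)%:C) + (e / 2)%:C =
  (f (iter l.+1 phi x) : R[i]) - g x by ring.
by rewrite n2; lra.
Qed.

(** On an orbit inside [L] the universal function is bounded by [M], so its iterates cannot
    approximate the constant [M + 1] at [z]. *)
Lemma hypercyclic_escape phi (z : Omega) : hypercyclic (composition_operator phi) ->
  forall L, compact L -> exists n, ~ L (iter n phi z).
Proof.
move=> /hypercyclic_approx[f fP] L cL; apply: contrapT => none.
have inL n : L (iter n phi z) by apply: contrapT => nL; apply: none; exists n.
have [M M0 MP] := OO_bounded f cL.
have [l lP] := fP (@OO_cst R N Omega (M + 1)%:C) [set z] 1 (@compact_set1 Omega z) ltr01.
have /= h1 := lP z erefl; have h2 := MP _ (inL l).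
have h3 : normc ((f (iter l phi z) : R[i]) - (M + 1)%:C) < 1 by exact: h1.
have := lerB_normc ((M + 1)%:C : R[i]) (f (iter l phi z)).
by rewrite normcBC normc_real ger0_norm ?addr_ge0 ?(ltW M0) //; lra.
Qed.

(* Calka's argument: the orbit of a nonexpansive map of a proper metric space
   that meets one ball infinitely often is bounded, because its return times
   to a larger ball have bounded gaps. *)
Lemma orbit_tends_to_infinity phi (z0 : Omega) : connected [set: Omega] ->
  caratheodory_tends_to_infinity z0 ->
  (forall L, compact L -> exists n, ~ L (iter n phi z0)) ->
  forall L, compact L -> exists n0, forall n, (n0 <= n)%N -> ~ L (iter n phi z0).
Proof.
move=> cO tz esc L cL; apply: contrapT => none; pose x n := iter n phi z0.
have inf n0 : exists2 n, (n0 <= n)%N & L (x n).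
  apply: contrapT => h; apply: none; exists n0 => n n0n Ln; apply: h.
  by exists n.
have shift C i j t : close C (x i) (x j) -> close C (x (i + t)%N) (x (j + t)%N).
  by move=> h; rewrite /x (addnC i) (addnC j) !iterD; exact: iter_close.
have [C C0 CP] := close_compact z0 cO cL.
(* Two steps of closeness [1] compose to [3 = 1 + 1 + 1 * 1], and then [3] is composed with [C]. *)
pose C1 : R := 3 + C + 3 * C.
have C10 : 0 <= C1 by rewrite /C1; lra.
pose S := [set n | close C1 (x n) z0].
have S0 : S 0%N by exact: (hyp_close_refl (@OO_disc_le1 R N Omega)).
have [L1 cL1 L1P] := close_relatively_compact tz C10.
(* Near each point of [L1], a single orbit point [x n1] with a later visit [n2] to [L] provides a
   return time [n2 - n1] for all orbit points nearby, since iterates do not increase closeness;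
   compactness bounds these times. *)
have [T TP] : exists T, forall n, S n -> exists t, [/\ (0 < t)%N, (t <= T)%N & S (n + t)%N].
  move: cL1 => /compact_near_coveringP /(_ nat \oo (fun T y => forall n, x n = y -> S n ->
    exists t, [/\ (0 < t)%N, (t <= T)%N & S (n + t)%N])) near.
  have [|T _ TP] := near _; last first.
    by exists T => n Sn; apply: (TP T (leqnn T) (x n)) => //; exact: L1P.
  move=> p _; have near_p := close_near p.
  have [[n1 [Sn1 n1p]]|no] := pselect (exists n, S n /\ close 1 p (x n)); last first.
    exists ([set y | close 1 p y], setT); first by split=> //; exact: filterT.
    by move=> [y T] /= [py _] n xn Sn; case: no; exists n; rewrite xn.
  have [n2 n12 Ln2] := inf n1.+1.
  exists ([set y | close 1 p y], [set T | (n2 - n1 <= T)%N]).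
    by split=> //; exists (n2 - n1)%N.
  move=> [y T] /= [py tT] n xn Sn; exists (n2 - n1)%N; split=> //.
    by rewrite subn_gt0.
  rewrite /S /=; apply: (hyp_close_trans (ler0n R 3) C0 _ (CP _ Ln2)).
  rewrite -{2}(subnKC (ltnW n12)); apply: shift.
  have := hyp_close_trans ler01 ler01 (hyp_close_sym py) n1p.
  by rewrite xn (_ : 1 + 1 + 1 * 1 = 3%:R :> R); last by ring.
have gap m : exists n, [/\ S n, (n <= m)%N & (m <= n + T)%N].
  elim: m => [|m [n [Sn nm mT]]]; first by exists 0%N.
  have [mT'|mT'] := leqP m.+1 (n + T); first by exists n; split=> //; exact: ltnW.
  have [t [t0 tT St]] := TP n Sn; exists (n + t)%N; split=> //.
    by rewrite -ltnS in mT'; apply: leq_trans (leq_add (leqnn n) tT) _; exact: ltnW.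
  have mE : m = (n + T)%N by apply/eqP; rewrite eqn_leq mT -ltnS mT'.
  by rewrite mE addnAC -[X in (X < _)%N]addn0 ltn_add2l.
have [C2 C20 C2P] : exists2 C2, 0 <= C2 & forall i, (i <= T)%N -> close C2 (x i) z0.
  elim: (T) => [|k [D D0 DP]].
    by exists 0 => // i; rewrite leqn0 => /eqP->; exact: (hyp_close_refl (@OO_disc_le1 R N Omega)).
  have [E E0 EP] := close_connected z0 cO (x k.+1).
  exists (D + E); first exact: addr_ge0.
  move=> i; rewrite leq_eqVlt => /predU1P[->|ik].
    by apply: (hyp_close_le (@OO_disc_le1 R N Omega) _ EP); rewrite lerDr.
  by apply: (hyp_close_le (@OO_disc_le1 R N Omega) _ (DP i ik)); rewrite lerDl.
have [|L2 cL2 L2P] := close_relatively_compact tz (_ : 0 <= C1 + C2 + C1 * C2).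
  by rewrite !addr_ge0 ?mulr_ge0.
have [m] := esc L2 cL2; apply; apply: L2P.
have [n [Sn nm mT]] := gap m.
(* Applying the iterate of order [m - n] to [x n] and [z0] compares [x m] with one of the first
   [T + 1] orbit points, which are bounded. *)
have h1 : close C1 (x m) (x (m - n)%N).
  by have := shift C1 n 0%N (m - n)%N Sn; rewrite subnKC // add0n.
by apply: (hyp_close_trans C10 C20 h1); apply: C2P; rewrite leq_subLR.
Qed.

End hypercyclicity.

Theorem theorem5p3 (R : realType) (N : nat)
    (Omega : complex_manifold 'rV[R[i]]_N) :
  stein Omega -> connected [set: Omega] ->
  (exists z0 : Omega, caratheodory_tends_to_infinity z0) ->
  [/\ taut Omega,
      class_S Omega &
      forall phi : hol Omega Omega,
        hypercyclic (composition_operator phi) ->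
        hereditarily_hypercyclic (composition_operator phi)].
Proof.
move=> sO cO [z0 tz]; split.
- exact: taut_of_caratheodory tz.
- split=> // phi n _ injphi runge away.
  apply: (hypercyclic_wrt_of_escape (z1 := z0) sO cO tz).
    exact: dense_range_of_runge.
  (* Adding [z0] to [L] puts the [n l]-th iterate of [z0] in the image, and disjointness then keeps
     it out of [L]. *)
  move=> L cL; have [l lP] := away _ (compactU cL (@compact_set1 Omega z0)).
  exists l => Ll; suff : set0 (iter (n l) phi z0) by [].
  by rewrite -lP; split; [exists z0 => //; right|left].
move=> phi hphi k incr.
apply: (hypercyclic_wrt_of_escape (z1 := z0) sO cO tz).
  exact: hypercyclic_dense_range.
move=> L cL.
have [n0 n0P] := orbit_tends_to_infinity cO tz (hypercyclic_escape z0 hphi) cL.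
have kn n : (n <= k n)%N by elim: n => // n IH; exact: leq_ltn_trans IH (incr _ _ (ltnSn n)).
by exists n0; apply: n0P; exact: kn.
Qed.
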